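(* Let $L>0$, $s\in\mathbb{N}_0$, and let $U:\mathbb{R}\to\mathbb{R}$ be a shear profile such that $g:=U'(U^{-1}(\cdot))$ and $f:=U''(U^{-1}(\cdot))$ belong to $W^{s+1,\infty}(\mathbb{R})$, and suppose that there exists $c>0$ such that $0<c<U'<c^{-1}<\infty$. Suppose further that $L\,\|f\|_{W^{s+1,\infty}(\mathbb{R})}$ is sufficiently small. Then for all $m\in\mathbb{Z}$ and all $\omega_0\in H^m_xH^s_y(\mathbb{T}_L\times\mathbb{R})$, the solution $W$ of the linearized Euler equations in scattering formulation with initial datum $\omega_0$ satisfies, for all times $t\in\mathbb{R}$, $$\|W(t)\|_{H^m_xH^s_y(\mathbb{T}_L\times\mathbb{R})}\lesssim\|\omega_0\|_{H^m_xH^s_y(\mathbb{T}_L\times\mathbb{R})}.$$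
   Context: $\mathbb{T}_L=[0,L]/\sim$ is the torus of length $L$. For a function $W(t,x,y)$ on $\mathbb{T}_L\times\mathbb{R}$, $\hat W(t,k,y)$ denotes its Fourier coefficients in $x$, $k\in\frac{2\pi}{L}\mathbb{Z}$, and $\|W\|_{H^m_xH^s_y}^2=\sum_k(1+k^2)^m\|\hat W(k,\cdot)\|_{H^s(\mathbb{R})}^2$. Linearized Euler equations in scattering formulation (around the shear flow $(U(y),0)$, written in the coordinate $z=U(y)$, relabelled $y$, and moving with the flow): $W|_{t=0}=\omega_0$; the mode $k=0$ is conserved, $\partial_t\hat W(t,0,y)=0$; and for each $k\in\frac{2\pi}{L}(\mathbb{Z}\setminus\{0\})$, $$\partial_t\hat W=\frac{if}{k}\hat\Phi,\qquad\Big(-1+\Big(g\big(\tfrac{\partial_y}{k}-it\big)\Big)^2\Big)\hat\Phi=\hat W,\qquad(t,y)\in\mathbb{R}\times\mathbb{R}.$$ Here $g(\frac{\partial_y}{k}-it)$ is the operator $u\mapsto g\,(k^{-1}\partial_yu-itu)$, its square is composition, and $\hat\Phi(t,k,\cdot)\in H^1(\mathbb{R})$ is the solution of the (shifted elliptic) equation. ''Sufficiently small'' means smaller than a positive constant depending only on $s$, $c$, an upper bound for $\|g\|_{W^{s+1,\infty}}$ and an upper bound for $L$. $A\lesssim B$ means $A\le KB$ with a constant $K$ independent of $t$ and $\omega_0$. *)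

(* Defs.v *)
From HB Require Import structures.
From mathcomp Require Import all_boot all_order all_algebra.
From mathcomp Require Import all_classical all_reals all_analysis.
From mathcomp.real_closed Require Import complex.
Set Implicit Arguments.
Unset Strict Implicit.
Unset Printing Implicit Defensive.
Import Order.TTheory GRing.Theory Num.Theory.
Import numFieldNormedType.Exports.
Local Open Scope classical_set_scope.
Local Open Scope ring_scope.

(* Functions of y are represented by functions R -> R or R -> R[i]; measurability,
   integrability, differentiability of R[i]-valued functions are understood
   through the real and imaginary parts. *)

Definition smooth {R : realType} (phi : R -> R) : Prop :=
  forall n x, derivable (derive1n n phi) x 1.

Definition test_function {R : realType} (phi : R -> R) : Prop :=
  smooth phi /\ compact (closure [set x | phi x != 0]).

Definition weak_derivative {R : realType} (u v : R -> R) : Prop :=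
  [/\ locally_integrable setT u, locally_integrable setT v
    & forall phi, test_function phi ->
        \int[lebesgue_measure]_y (u y * derive1 phi y)
        = - \int[lebesgue_measure]_y (v y * phi y)].

Definition weak_derivatives {R : realType} (n : nat) (u : R -> R)
    (d : nat -> R -> R) : Prop :=
  [/\ d 0%N = u, locally_integrable setT u
    & forall j, (j < n)%N -> weak_derivative (d j) (d j.+1)].

(* Weak derivatives are unique almost everywhere, so the infimum is over at most
   one value; it is +oo when u has no weak derivatives up to order n. *)
Definition Winfty_norm {R : realType} (n : nat) (u : R -> R) : \bar R :=
  ereal_inf [set (\sum_(j < n.+1) Lnorm lebesgue_measure +oo (EFin \o d j))%E
            | d in [set d | weak_derivatives n u d]].

Definition in_Winfty {R : realType} (n : nat) (u : R -> R) : Prop :=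
  (Winfty_norm n u < +oo)%E.

Definition L2_sqnorm {R : realType} (u : R -> R[i]) : \bar R :=
  (\int[lebesgue_measure]_y ((complex.Re (u y)) ^+ 2 + (complex.Im (u y)) ^+ 2)%:E)%E.

Definition weak_derivativeC {R : realType} (u v : R -> R[i]) : Prop :=
  weak_derivative (@complex.Re R \o u) (@complex.Re R \o v) /\
  weak_derivative (@complex.Im R \o u) (@complex.Im R \o v).

Definition weak_derivativesC {R : realType} (n : nat) (u : R -> R[i])
    (d : nat -> R -> R[i]) : Prop :=
  weak_derivatives n (@complex.Re R \o u) (fun j => @complex.Re R \o d j) /\
  weak_derivatives n (@complex.Im R \o u) (fun j => @complex.Im R \o d j).

(* Square of the H^s norm, +oo outside H^s; the case s = 0 is L^2. *)
Definition Hs_sqnorm {R : realType} (s : nat) (u : R -> R[i]) : \bar R :=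
  ereal_inf [set (\sum_(j < s.+1) L2_sqnorm (d j))%E
            | d in [set d | weak_derivativesC s u d]].

Definition in_Hs {R : realType} (s : nat) (u : R -> R[i]) : Prop :=
  (Hs_sqnorm s u < +oo)%E.

Definition ae_eqC {R : realType} (u v : R -> R[i]) : Prop :=
  {ae lebesgue_measure, forall y : R, u y = v y}.

Definition torus_test {R : realType} (L : R) (phi : R -> R[i]) : Prop :=
  [/\ smooth (@complex.Re R \o phi), smooth (@complex.Im R \o phi)
    & forall x, phi (x + L) = phi x].

Definition test_bound {R : realType} (N : nat) (phi : R -> R[i]) (M : R) : Prop :=
  forall j x, (j <= N)%N ->
    `|derive1n j (@complex.Re R \o phi) x| <= M /\
    `|derive1n j (@complex.Im R \o phi) x| <= M.

(* For m < 0 the elements of H^m_x H^s_y are not functions of x.  They are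
   elements of D'(T_L; L^2(R)), i.e. continuous linear maps from C^oo(T_L; C) to
   L^2(R; C).  A function w on T_L x R acts by
   phi |-> (y |-> \int_0^L w(x,y) phi(x) dx). *)
Definition periodic_distribution {R : realType} (L : R)
    (T : (R -> R[i]) -> R -> R[i]) : Prop :=
  [/\ forall phi, torus_test L phi -> in_Hs 0 (T phi),
      forall (a : R[i]) phi psi, torus_test L phi -> torus_test L psi ->
        ae_eqC (T (fun x => a * phi x + psi x)) (fun y => a * T phi y + T psi y)
    & exists (C : R) (N : nat), forall phi M,
        torus_test L phi -> test_bound N phi M ->
        (L2_sqnorm (T phi) <= ((C * M) ^+ 2)%:E)%E].

Definition distribution_eq {R : realType} (L : R)
    (T S : (R -> R[i]) -> R -> R[i]) : Prop :=
  forall phi, torus_test L phi -> ae_eqC (T phi) (S phi).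

Definition freq {R : realType} (L : R) (n : int) : R := 2 * pi / L * n%:~R.

Definition expi {R : realType} (theta : R) : R[i] := (cos theta +i* sin theta)%C.

(* hat W(k, .) for k = freq L n *)
Definition fourier {R : realType} (L : R) (T : (R -> R[i]) -> R -> R[i])
    (n : int) (y : R) : R[i] :=
  (L^-1)%:C%C * T (fun x => expi (- (freq L n * x))) y.

Definition HmHs_norm {R : realType} (L : R) (m : int) (s : nat)
    (T : (R -> R[i]) -> R -> R[i]) : \bar R :=
  ((\esum_(n in [set: int])
      (((1 + freq L n ^+ 2) ^ m)%:E * Hs_sqnorm s (fourier L T n))) `^ 2^-1)%E.

Definition in_HmHs {R : realType} (L : R) (m : int) (s : nat)
    (T : (R -> R[i]) -> R -> R[i]) : Prop :=
  periodic_distribution L T /\ (HmHs_norm L m s T < +oo)%E.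

(* g = U' o U^{-1} and f = U'' o U^{-1}; [pinv setT U] is the inverse function of
   U whenever U is bijective. *)
Definition shear_g {R : realType} (U : R -> R) : R -> R :=
  derive1 U \o pinv setT U.

Definition shear_f {R : realType} (U : R -> R) : R -> R :=
  derive1 (derive1 U) \o pinv setT U.

(* v = g (k^{-1} d_y u - i t u) *)
Definition shifted_op {R : realType} (g : R -> R) (k t : R) (u v : R -> R[i]) : Prop :=
  exists2 du, weak_derivativeC u du &
    ae_eqC v (fun y => (g y)%:C%C * ((k^-1)%:C%C * du y - 'i%C * t%:C%C * u y)).

(* (-1 + (g (d_y / k - i t))^2) Phi = w, with Phi in H^1 *)
Definition stream_function {R : realType} (g : R -> R) (k t : R)
    (w Phi : R -> R[i]) : Prop :=
  in_Hs 1 Phi /\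
  exists v1 v2, [/\ shifted_op g k t Phi v1, shifted_op g k t v1 v2
                  & ae_eqC (fun y => - Phi y + v2 y) w].

Definition L2_time_derivative {R : realType} (w : R -> R -> R[i]) (t : R)
    (v : R -> R[i]) : Prop :=
  (fun h : R => L2_sqnorm (fun y => (h^-1)%:C%C * (w (t + h) y - w t y) - v y))
    @ 0^' --> 0%E.

Definition scattering_solution {R : realType} (L : R) (f g : R -> R)
    (omega0 : (R -> R[i]) -> R -> R[i])
    (W : R -> (R -> R[i]) -> R -> R[i]) : Prop :=
  [/\ forall t, periodic_distribution L (W t),
      distribution_eq L (W 0) omega0,
      forall t, L2_time_derivative (fun tau => fourier L (W tau) 0) t (fun=> 0)
    & forall (n : int) (t : R), n != 0 ->
        exists2 Phi : R -> R[i],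
          stream_function g (freq L n) t (fourier L (W t) n) Phi &
          L2_time_derivative (fun tau => fourier L (W tau) n) t
            (fun y => 'i%C * (f y)%:C%C / (freq L n)%:C%C * Phi y)].

(* Main.v *)
Require Import Defs.
From HB Require Import structures.
From mathcomp Require Import all_boot all_order all_algebra.
From mathcomp Require Import all_classical all_reals all_analysis.
From mathcomp.real_closed Require Import complex.
From mathcomp Require Import measurable_realfun ess_sup_inf.
From mathcomp Require Import ring lra.
Set Implicit Arguments.
Unset Strict Implicit.
Unset Printing Implicit Defensive.
Import Order.TTheory GRing.Theory Num.Theory.
Import numFieldNormedType.Exports.
Local Open Scope classical_set_scope.
Local Open Scope ring_scope.

(** The Fourier modes evolve independently.  The mode k = 0 is constant, and a mode
    k <> 0 solves w' = (i f / k) Phi, where (g D_t)^2 Phi - Phi = w and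
    D_t = k^-1 d_y - i t.  It suffices to bound its H^s norm by its initial value,
    with a constant independent of k.

    For s = 0 the bound comes from the spreading of the resonances in time.  All
    the operators D_tau are skew-adjoint and differ by multiples of i.  If B_tau is
    the resolvent of D_tau, local smoothing ([local_smoothing]) bounds the sum of
    |B_j w|^2 over the integers j by 32 |w|^2: a function is resonant during a bounded
    time.  Hence 64 |w|^2 minus the sum of the |B_i w|^2 over the past is comparable to
    |w|^2, and its time derivative contains - |B_j w|^2 at times close to j.  On the
    other side the elliptic equation bounds Phi and D_t Phi by |B_j w|
    ([elliptic_bound]): as w = (1 + D_j) B_j w, testing the equation involves only
    B_j w, at the price of one derivative of the test function, which the energy of
    the elliptic operator controls.  So the contribution of the forcing is at most a
    small multiple of |B_j w|^2 when f / k is small, and the energy does not increase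
    ([uniform_stability]).  This argument uses only the relations
    between D_tau and i, collected in [skew_frame], and no Fourier transform in y.
    For negative times i is replaced by - i.

    For s > 0 the equation is not differentiated, since w(t) is not known to stay in
    H^s.  Instead, for a step h and a weight dl, the vector of the
    (dl / h)^j Delta^j w, suitably shifted, solves an equation of the same form, where
    by the Leibniz rule ([difv_mul]) the multiplications by g and f become
    multiplications by lower triangular matrices.  The diagonal of the matrix of g
    consists of translates of g and the other entries are O(dl), uniformly in h: for a
    small dl the elliptic estimate persists, and the argument above bounds the
    differences of w(t) by those of w(0) ([difference_stability],
    [mode_differences]).  The differences of w(0) are bounded by its weak derivatives
    ([dot_difj_le]); conversely, when h tends to 0, bounded differences have weak
    limits in L2, which are weak derivatives
    ([weak_derivatives_of_differences]).

    Weak derivatives are handled through absolutely continuous representatives: by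
    the lemma of du Bois-Reymond ([weak_derivative_Prim]) a weak derivative is a
    locally integrable function of which u is a primitive almost everywhere. *)

(** * Skew frames and semidefinite forms *)

Section SkewFrame.
Variables (R : realType) (V : lmodType R).

(** The structure of L2 seen by one mode: J is the multiplication by the imaginary
    unit and der is the graph of d = k^-1 d_y, so that every D_tau = d - tau J is
    skew-adjoint.  The form is semidefinite, because functions are used in place
    of classes modulo null sets, and der is a relation, because d is unbounded.
    The last two fields say that 1 + D_tau and 1 - D_tau are onto. *)
Record skew_frame (ip : V -> V -> R) (J : V -> V) (der : V -> V -> Prop) : Prop :=
  SkewFrame {
    ip_sym : forall u v, ip u v = ip v u;
    ip_lin : forall (a : R) u v w, ip (a *: u + v) w = a * ip u w + ip v w;
    ip_ge0 : forall u, 0 <= ip u u;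
    J_lin : forall (a : R) u v, J (a *: u + v) = a *: J u + J v;
    J_inv : forall u, J (J u) = - u;
    J_iso : forall u v, ip (J u) (J v) = ip u v;
    der_lin : forall (a : R) u du v dv, der u du -> der v dv ->
      der (a *: u + v) (a *: du + dv);
    der_J : forall u du, der u du -> der (J u) (J du);
    der_skew : forall u du v dv, der u du -> der v dv -> ip du v = - ip u dv;
    der_resp : forall (tau : R) u, exists a da,
      der a da /\ a + (da - tau *: J a) = u;
    der_resm : forall (tau : R) u, exists a da,
      der a da /\ a - (da - tau *: J a) = u
  }.

Section FormTheory.
Variable (ip : V -> V -> R).
Hypothesis ipC : forall u v, ip u v = ip v u.
Hypothesis ipL : forall (a : R) u v w, ip (a *: u + v) w = a * ip u w + ip v w.
Hypothesis ip0 : forall u, 0 <= ip u u.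

Lemma form_0l w : ip 0 w = 0.
Proof. by have := ipL (-1) w w w; rewrite scaleN1r addNr mulN1r addNr. Qed.

Lemma form_Dl u v w : ip (u + v) w = ip u w + ip v w.
Proof. by rewrite -[u]scale1r ipL scale1r mul1r. Qed.

Lemma form_Dr u v w : ip w (u + v) = ip w u + ip w v.
Proof. by rewrite ipC form_Dl !(ipC w). Qed.

Lemma form_Zl (a : R) u w : ip (a *: u) w = a * ip u w.
Proof. by rewrite -[a *: u]addr0 ipL form_0l addr0. Qed.

Lemma form_Zr (a : R) u w : ip w (a *: u) = a * ip w u.
Proof. by rewrite ipC form_Zl ipC. Qed.

Lemma form_Nl u w : ip (- u) w = - ip u w.
Proof. by rewrite -scaleN1r form_Zl mulN1r. Qed.

Lemma form_Nr u w : ip w (- u) = - ip w u.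
Proof. by rewrite ipC form_Nl ipC. Qed.

Lemma form_suml (I : Type) (r : seq I) (P : pred I) (F : I -> V) w :
  ip (\sum_(i <- r | P i) F i) w = \sum_(i <- r | P i) ip (F i) w.
Proof.
apply: (big_ind2 (fun x y => ip x w = y)) => //; first exact: form_0l.
by move=> x1 x2 y1 y2 <- <-; rewrite form_Dl.
Qed.

Lemma form_sumr (I : Type) (r : seq I) (P : pred I) (F : I -> V) w :
  ip w (\sum_(i <- r | P i) F i) = \sum_(i <- r | P i) ip w (F i).
Proof. by rewrite ipC form_suml; apply: eq_bigr => i _; rewrite ipC. Qed.

Lemma form_young (e : R) u v : 0 < e ->
  2 * ip u v <= e * ip u u + e^-1 * ip v v.
Proof.
move=> e0; have := ip0 (e *: u - v).
rewrite !(form_Dl, form_Dr, form_Nl, form_Nr, form_Zl, form_Zr) (ipC v u) => h.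
rewrite -(ler_pM2l e0).
have -> : e * (e * ip u u + e^-1 * ip v v) = e * e * ip u u + ip v v.
  by rewrite mulrDr !mulrA mulfV ?gt_eqF// mul1r.
nra.
Qed.

Lemma form_eq0 u v : ip u u = 0 -> ip u v = 0.
Proof.
move=> u0.
have key (s : R) : 2 * (s * ip u v) <= ip v v.
  have := ip0 (v - s *: u).
  rewrite !(form_Dl, form_Dr, form_Nl, form_Nr, form_Zl, form_Zr) u0 (ipC v u).
  lra.
have [//|uv0] := eqVneq (ip u v) 0.
have := key ((ip v v + 1) / ip u v).
rewrite -mulrA mulVf// mulr1; have := ip0 v; lra.
Qed.

Lemma form_cs u v : (ip u v) ^+ 2 <= ip u u * ip v v.
Proof.
have [u0|u0] := eqVneq (ip u u) 0; first by rewrite (form_eq0 v u0) u0 expr0n/= mul0r.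
have {u0}up : 0 < ip u u by rewrite lt0r u0 ip0.
have := ip0 (ip u u *: v - ip u v *: u).
rewrite !(form_Dl, form_Dr, form_Nl, form_Nr, form_Zl, form_Zr) (ipC v u) => h.
rewrite -subr_ge0 -(pmulr_rge0 _ up); apply: le_trans h _; rewrite le_eqVlt; apply/orP; left; apply/eqP; ring.
Qed.

Lemma form_sq_add u v : ip (u + v) (u + v) <= 2 * ip u u + 2 * ip v v.
Proof.
have := ip0 (u - v).
rewrite !(form_Dl, form_Dr, form_Nl, form_Nr) (ipC v u); lra.
Qed.

End FormTheory.

(** * Resolvents and local smoothing *)

Section Local_smoothing.
Variables (ip : V -> V -> R) (J : V -> V) (der : V -> V -> Prop).
Hypothesis F : skew_frame ip J der.

Let ipE := (form_Dl (ip_lin F), form_Dr (ip_sym F) (ip_lin F),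
  form_Nl (ip_lin F), form_Nr (ip_sym F) (ip_lin F),
  form_Zl (ip_lin F), form_Zr (ip_sym F) (ip_lin F)).

Lemma JD u v : J (u + v) = J u + J v.
Proof. by rewrite -[u in LHS]scale1r (J_lin F) scale1r. Qed.

Lemma J0 : J 0 = 0.
Proof. by have := J_lin F (-1) 0 0; rewrite scaleN1r addNr scaleN1r addNr. Qed.

Lemma JZ (a : R) u : J (a *: u) = a *: J u.
Proof. by have := J_lin F a u 0; rewrite J0 !addr0. Qed.

Lemma JN u : J (- u) = - J u.
Proof. by rewrite -scaleN1r JZ scaleN1r. Qed.

Lemma ip_Jl u v : ip (J u) v = - ip u (J v).
Proof. by rewrite -(J_iso F) (J_inv F) ipE. Qed.

Lemma ip_JJ0 u : ip (J u) u = 0.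
Proof. by have := ip_Jl u u; rewrite (ip_sym F u); lra. Qed.

(** The equation (1 + sg D_tau) b = u, with D_tau = d - tau J; it is tested
    against every z because the form does not separate points. *)
Definition res (sg tau : R) (u b : V) := exists2 db, der b db &
  forall z, ip b z + sg * (ip db z - tau * ip (J b) z) = ip u z.

Lemma resp_ex tau u : exists b, res 1 tau u b.
Proof.
have [a [da [h1 h2]]] := der_resp F tau u; exists a, da => // z.
by rewrite -h2 !ipE; ring.
Qed.

Lemma resm_ex tau u : exists b, res (-1) tau u b.
Proof.
have [a [da [h1 h2]]] := der_resm F tau u; exists a, da => // z.
by rewrite -h2 !ipE; ring.
Qed.

Lemma res_lin sg tau a u b v c : res sg tau u b -> res sg tau v c ->
  res sg tau (a *: u + v) (a *: b + c).
Proof.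
move=> [db hb eb] [dc hc ec]; exists (a *: db + dc); first exact: der_lin F _ _ _ _ _ hb hc.
by move=> z; rewrite (J_lin F) !ipE -eb -ec; ring.
Qed.

Lemma res_J sg tau u b : res sg tau u b -> res sg tau (J u) (J b).
Proof.
move=> [db hb eb]; exists (J db); first exact: der_J F _ _ hb.
move=> z; have := eb (J z); rewrite !ip_Jl !(J_inv F) !ipE; lra.
Qed.

(** D_tau is skew-adjoint, so that its contribution to the product with b
    vanishes; in particular the resolvent is a contraction. *)
Lemma res_norm sg tau u b : res sg tau u b -> ip u b = ip b b.
Proof.
move=> [db hb eb]; rewrite -eb ip_JJ0.
have := der_skew F hb hb; rewrite (ip_sym F b db) => h.
have -> : ip db b = 0 by lra.
by ring.
Qed.

Lemma res_contr sg tau u b : res sg tau u b -> ip b b <= ip u u.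
Proof.
move=> h; have := res_norm h; have := ip_ge0 F (u - b).
rewrite !ipE (ip_sym F b u); lra.
Qed.

Lemma res_uniq sg tau u b c : res sg tau u b -> res sg tau u c ->
  forall z, ip b z = ip c z.
Proof.
move=> hb hc z; have h := res_lin (-1) hb hc.
have := res_norm h; rewrite scaleN1r addNr (form_0l (ip_lin F)) => /esym e.
have := form_eq0 (ip_sym F) (ip_lin F) (ip_ge0 F) z e.
rewrite !ipE; lra.
Qed.

(** The operators D at the times ti and tj differ by (ti - tj) J, which makes the
    distance of the times appear in the products of the resolvents. *)
Lemma res_crossmm (ti tj : R) bi bj si sj :
  res (-1) ti bi si -> res (-1) tj bj sj ->
  2 * ip si sj - (ti - tj) * ip si (J sj) = ip bi sj + ip si bj.
Proof.
move=> [dsi si1 si2] [dsj sj1 sj2].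
have := si2 sj; have := sj2 si; have := der_skew F si1 sj1.
rewrite !ip_Jl (ip_sym F sj si) (ip_sym F dsj si) (ip_sym F bj si).
have -> : ip sj (J si) = - ip si (J sj) by rewrite (ip_sym F) ip_Jl.
lra.
Qed.

Lemma res_crossmp (ti tj : R) u bi bj si :
  res (-1) ti bi si -> res 1 tj u bj ->
  (ti - tj) * ip si (J bj) = ip u si - ip bi bj.
Proof.
move=> [dsi si1 si2] [dbj bj1 bj2].
have := si2 bj; have := bj2 si; have := der_skew F si1 bj1.
rewrite !ip_Jl (ip_sym F bj si) (ip_sym F dbj si).
have -> : ip bj (J si) = - ip si (J bj) by rewrite (ip_sym F) ip_Jl.
lra.
Qed.

Lemma res_mp (t : R) u b s : res 1 t u b -> res (-1) t b s -> ip u s = ip b b.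
Proof.
by move=> hb hs; have := res_crossmp hs hb; rewrite subrr mul0r; lra.
Qed.

(** Almost orthogonality of the s_i = (1 - D_i^2)^-1 u.  In a spectral variable
    x at distance d from another one, the bound is
    4 + d^2 <= 4 ((1 + x^2) + (1 + (x - d)^2)) divided by the product
    (1 + x^2) (1 + (x - d)^2); the identities above replace the variable. *)
Lemma res_pair (ti tj : R) u bi bj si sj :
  res 1 ti u bi -> res 1 tj u bj -> res (-1) ti bi si -> res (-1) tj bj sj ->
  (4 + (ti - tj) ^+ 2) * ip si sj <= 4 * (ip bi bi + ip bj bj).
Proof.
move=> hbi hbj hsi hsj.
have ni := res_contr hsi; have nj := res_contr hsj.
have y1 := form_young (ip_sym F) (ip_lin F) (ip_ge0 F) si bj ltr01.
have y2 := form_young (ip_sym F) (ip_lin F) (ip_ge0 F) bi sj ltr01.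
rewrite invr1 !mul1r in y1 y2.
have y3 := ip_ge0 F (bi + bj); rewrite !ipE (ip_sym F bj bi) in y3.
have c1 := res_crossmm hsi hsj.
have c2 := res_crossmm hsi (res_J hsj).
have c3 := res_crossmp hsi hbj; rewrite (res_mp hbi hsi) in c3.
have c4 := res_crossmp hsj hbi; rewrite (res_mp hbj hsj) (ip_sym F bj bi) in c4.
rewrite (J_inv F) !ipE in c2.
have e4 : ip sj (J bi) = - ip bi (J sj) by rewrite (ip_sym F) ip_Jl.
rewrite e4 in c4.
suff -> : (4 + (ti - tj) ^+ 2) * ip si sj = 2 * ip si bj + 2 * ip bi sj
    + ip bi bi + ip bj bj - 2 * ip bi bj by lra.
rewrite mulrDl expr2 -mulrA.
have -> : (ti - tj) * ip si sj = ip bi (J sj) + ip si (J bj) - 2 * ip si (J sj) by lra.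
rewrite mulrBr mulrDr c3.
have -> : (ti - tj) * ip bi (J sj) = ip bj bj - ip bi bj by lra.
have -> : (ti - tj) * (2 * ip si (J sj)) = 2 * ((ti - tj) * ip si (J sj)) by ring.
have -> : (ti - tj) * ip si (J sj) = 2 * ip si sj - ip bi sj - ip si bj by lra.
ring.
Qed.

Lemma sum_weight (N i : nat) :
  \sum_(0 <= j < N) (4 + (i%:R - j%:R) ^+ 2)^-1 <= 4 :> R.
Proof.
(* 2x/(1+|x|) is bounded by 2 and its increments at the integers dominate the
   weight, so that the sum telescopes. *)
pose A (x : R) := - (2 * x / (1 + `|x|)).
have A2 x : `|A x| <= 2.
  have p : 0 < 1 + `|x| by have := normr_ge0 x; lra.
  rewrite /A normrN normrM normfV normrM (ger0_norm (ltW p)) ger0_norm//.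
  rewrite ler_pdivrMr//; have := normr_ge0 x; lra.
have wt (j : nat) : (4 + (i%:R - j%:R) ^+ 2)^-1 <=
    A (i.+1%:R - j.+1%:R) - A (i.+1%:R - j%:R).
  have -> : i.+1%:R - j.+1%:R = i%:R - j%:R :> R by rewrite -!natr1; ring.
  have -> : i.+1%:R - j%:R = (i%:R - j%:R) + 1 :> R by rewrite -!natr1; ring.
  rewrite /A; have [le|lt] := leqP j i.
    have x0 : 0 <= i%:R - j%:R :> R by rewrite subr_ge0 ler_nat.
    move: (i%:R - j%:R) x0 => x x0.
    have x1 : 0 <= x + 1 by lra.
    rewrite !ger0_norm//.
    have -> : - (2 * x / (1 + x)) - - (2 * (x + 1) / (1 + (x + 1)))
       = 2 / ((x + 1) * (x + 2)).
      by field; apply/andP; split; apply/lt0r_neq0; lra.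
    rewrite -[leLHS]div1r ler_pdivlMr; last by nra.
    rewrite mulrC mul1r ler_pdivrMr; last by nra.
    by have := sqr_ge0 (2 * x - 3); nra.
  have x0 : (i%:R - j%:R) + 1 <= 0 :> R.
    by rewrite addrAC natr1 subr_le0 ler_nat.
  move: (i%:R - j%:R) x0 => x x0.
  have x1 : x <= 0 by lra.
  rewrite !ler0_norm//.
  have -> : - (2 * x / (1 + - x)) - - (2 * (x + 1) / (1 + - (x + 1)))
       = 2 / (x * (x - 1)).
    have xn : x != 0 by rewrite lt_eqF//; lra.
    have xn1 : x - 1 != 0 by rewrite lt_eqF//; lra.
    have xn2 : 1 - x != 0 by rewrite gt_eqF//; lra.
    have -> : 1 + - (x + 1) = - x by ring.
    by field; rewrite ?xn ?xn1 ?xn2 ?oppr_eq0 ?xn.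
  rewrite -[leLHS]div1r ler_pdivlMr; last by nra.
  rewrite mulrC mul1r ler_pdivrMr; last by nra.
  by have := sqr_ge0 (2 * x + 3); nra.
apply: le_trans (ler_sum _ (fun j _ => wt j)) _.
rewrite (telescope_sumr (fun j => A (i.+1%:R - j%:R)))//.
have := A2 (i.+1%:R - N%:R); have := A2 (i.+1%:R - 0%:R).
rewrite !ler_norml => /andP[? ?] /andP[? ?]; lra.
Qed.

(** Local smoothing, sampled at integer times.  In a spectral variable x the
    resolvents have square moduli 1 / (1 + (x - i)^2), with a bounded sum over
    the integers i.  Here the sum to bound is <Z, u>, where Z is the sum of the
    almost orthogonal s_i, which gives |Z|^2 <= 32 <Z, u>. *)
Lemma local_smoothing (N : nat) u (b : nat -> V) :
  (forall i, res 1 i%:R u (b i)) ->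
  \sum_(0 <= i < N) ip (b i) (b i) <= 32 * ip u u.
Proof.
move=> hb.
have /choice[s hs] i := resm_ex i%:R (b i).
set q := \sum_(0 <= i < N) _.
pose Z := \sum_(0 <= i < N) s i.
have Zu : ip Z u = q.
  rewrite (form_suml (ip_lin F)); apply: eq_bigr => i _.
  by rewrite (ip_sym F) (res_mp (hb i) (hs i)).
have ZZ : ip Z Z <= 32 * q.
  rewrite (form_suml (ip_lin F)).
  pose w i j : R := (4 + (i%:R - j%:R) ^+ 2)^-1.
  rewrite (@le_trans _ _ (\sum_(0 <= i < N) \sum_(0 <= j < N)
     (4 * (w i j * ip (b i) (b i)) + 4 * (w j i * ip (b j) (b j)))))//.
    apply: ler_sum => i _; rewrite (form_sumr (ip_sym F) (ip_lin F)).
    apply: ler_sum => j _.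
    have p : 0 < 4 + (i%:R - j%:R) ^+ 2 :> R by have := sqr_ge0 (i%:R - j%:R : R); lra.
    have wC : w j i = w i j by rewrite /w -sqrrN opprB.
    rewrite wC -(ler_pM2l p).
    have -> : (4 + (i%:R - j%:R) ^+ 2) * (4 * (w i j * ip (b i) (b i)) + 4 * (w i j * ip (b j) (b j)))
      = ((4 + (i%:R - j%:R) ^+ 2) * w i j) * (4 * (ip (b i) (b i) + ip (b j) (b j))) by ring.
    by rewrite mulfV ?gt_eqF// mul1r; exact: (res_pair (hb i) (hb j) (hs i) (hs j)).
  under eq_bigr do rewrite big_split/=.
  rewrite big_split/= [X in _ + X]exchange_big/=.
  have half : \sum_(0 <= i < N) \sum_(0 <= j < N) 4 * (w i j * ip (b i) (b i)) <= 16 * q.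
    rewrite mulr_sumr; apply: ler_sum => i _.
    rewrite -mulr_sumr -mulr_suml.
    have -> : 16 * ip (b i) (b i) = 4 * (4 * ip (b i) (b i)) by ring.
    by rewrite ler_pM2l// ler_wpM2r ?(ip_ge0 F)//; exact: sum_weight.
  have -> : 32 * q = 16 * q + 16 * q by ring.
  exact: lerD.
have e : 0 < 32^-1 :> R by rewrite invr_gt0.
have := form_young (ip_sym F) (ip_lin F) (ip_ge0 F) Z u e.
rewrite Zu invrK; have := ip_ge0 F u; lra.
Qed.

Lemma res_polar t u b v c : res 1 t u b -> res 1 t v c ->
  2 * ip b c = ip u c + ip b v.
Proof.
move=> [db hb eb] [dc hc ec].
have := eb c; have := ec b; have := der_skew F hb hc.
rewrite (ip_sym F c b) (ip_sym F dc b) (ip_sym F v b).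
have -> : ip (J c) b = - ip (J b) c by rewrite ip_Jl (ip_sym F c).
rewrite !mul1r; lra.
Qed.

(** The resolvents commute with D_tj: the factor 1 + D_tj of w = (1 + D_tj) psi
    passes to the other side as 1 - D_tj and turns w1 into h. *)
Lemma res_cross (ti tj : R) w1 dw1 w psi x y f e h :
  der w1 dw1 -> (forall z, ip w1 z - (ip dw1 z - tj * ip (J w1) z) = ip h z) ->
  res 1 tj w psi -> res 1 ti w1 x -> res 1 ti w y ->
  res 1 ti h f -> res 1 ti psi e -> ip x y = ip f e.
Proof.
move=> dw hh hpsi hx hy hf he.
have derB a da b db : der a da -> der b db -> der (a - b) (da - db).
  by move=> h1 h2; have := der_lin F (-1) h2 h1; rewrite !scaleN1r (addrC _ a) (addrC _ da).
have derZ (k : R) a da : der a da -> der (k *: a) (k *: da).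
  move=> h1; have := der_lin F k h1 (derB _ _ _ _ h1 h1).
  by rewrite !subrr !addr0.
have hf0 : res 1 ti h (2 *: x - w1 - (ti - tj) *: J x).
  have [dx dx1 ex] := hx.
  exists (2 *: dx - dw1 - (ti - tj) *: J dx).
    by apply: (derB _ _ _ _ (derB _ _ _ _ (derZ _ _ _ dx1) dw) (derZ _ _ _ (der_J F dx1))).
  move=> z; rewrite !(JD, JN, JZ) !(J_inv F) !ipE -hh.
  have := congr1 (fun r => (ti - tj) * r) (ex (J z)); have := ex z.
  rewrite !ip_Jl !(J_inv F) !ipE; lra.
have hy0 : res 1 ti w (psi + (ti - tj) *: J e).
  have [de de1 ee] := he; have [dp dp1 ep] := hpsi.
  exists (dp + (ti - tj) *: J de).
    by rewrite addrC (addrC dp); apply: (der_lin F) => //; exact: der_J F _ _ de1.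
  move=> z; rewrite !(JD, JZ) !(J_inv F) !ipE -ep.
  have := congr1 (fun r => (ti - tj) * r) (ee (J z)).
  rewrite !ip_Jl !(J_inv F) !ipE; lra.
rewrite (res_uniq hf hf0) (ip_sym F x) (res_uniq hy hy0) !ipE.
have := res_polar hx he; rewrite !ip_Jl (ip_sym F psi).
have -> : ip e (J x) = - ip x (J e) by rewrite (ip_sym F) ip_Jl.
rewrite ?(ip_sym F (J e)); lra.
Qed.

(** * The energy and uniform stability *)

Definition tder (w : R -> V) (v : V) (t : R) :=
  (fun h : R => ip (h^-1 *: (w (t + h) - w t) - v) (h^-1 *: (w (t + h) - w t) - v))
    @ 0^' --> (0 : R).

Lemma tder_form (bt : V -> V -> R) w v t :
  (forall u v, bt u v = bt v u) ->
  (forall (a : R) u v w, bt (a *: u + v) w = a * bt u w + bt v w) ->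
  (forall u, 0 <= bt u u) -> (forall u, bt u u <= ip u u) ->
  tder w v t -> is_derive t 1 (fun s => bt (w s) (w s)) (2 * bt v (w t)).
Proof.
move=> bC bL b0 bi hw.
pose e h := h^-1 *: (w (t + h) - w t) - v.
have bE := (form_Dl bL, form_Dr bC bL, form_Nl bL, form_Nr bC bL,
  form_Zl bL, form_Zr bC bL).
pose Q h := 2 * bt (e h) (w t) + h * bt (v + e h) (v + e h).
have quot h : h != 0 -> h^-1 *: (bt (w (h *: 1 + t)) (w (h *: 1 + t)) - bt (w t) (w t))
    = 2 * bt v (w t) + Q h.
  move=> h0; rewrite /Q [h *: 1]mulr1 (addrC h).
  have ve : v + e h = h^-1 *: (w (t + h) - w t) by rewrite /e addrCA subrr addr0.
  have -> : w (t + h) = w t + h *: (v + e h).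
    by rewrite ve scalerA mulfV// scale1r addrCA subrr addr0.
  have dE : bt (v + e h) (w t) = bt v (w t) + bt (e h) (w t) by exact: (form_Dl bL).
  move: (bt (e h) (w t)) (v + e h) dE => r d dE; rewrite !bE (bC (w t) d).
  have -> : 2 * bt v (w t) + (2 * r + h * bt d d)
     = 2 * bt d (w t) + h * bt d d by rewrite dE; ring.
  rewrite -[LHS]/(h^-1 * _); field.
  by [].
have Q0 : Q h @[h --> 0^'] --> (0 : R).
  have bd h : `|Q h| <= 2 * Num.sqrt (ip (e h) (e h) * bt (w t) (w t))
       + `|h| * (2 * bt v v + 2 * ip (e h) (e h)).
    rewrite /Q (le_trans (ler_normD _ _))// lerD//.
      rewrite normrM ger0_norm// ler_pM2l// -sqrtr_sqr ler_sqrt; last first.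
        by rewrite mulr_ge0// (ip_ge0 F).
      by rewrite (le_trans (form_cs bC bL b0 _ _))// ler_wpM2r.
    rewrite normrM ler_wpM2l// ger0_norm//.
    rewrite (le_trans (form_sq_add bC bL b0 _ _))// lerD2l ler_pM2l//.
  apply/norm_cvg0P; apply: (@squeeze_cvgr _ _ _ _ (fun=> 0)
     (fun h => 2 * Num.sqrt (ip (e h) (e h) * bt (w t) (w t))
       + `|h| * (2 * bt v v + 2 * ip (e h) (e h)))).
  - by near=> h; rewrite normr_ge0/= bd.
  - exact: cvg_cst.
  - suff : 2 * Num.sqrt (ip (e h) (e h) * bt (w t) (w t))
       + `|h| * (2 * bt v v + 2 * ip (e h) (e h)) @[h --> 0^'] -->
      (2 * Num.sqrt (0 * bt (w t) (w t)) + `|0 : R| * (2 * bt v v + 2 * 0)).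
      by rewrite mul0r sqrtr0 normr0 mul0r mulr0 addr0.
    apply: cvgD; first apply: cvgM; first exact: cvg_cst.
      apply: (continuous_cvg _ (@sqrt_continuous _ _)).
      by apply: cvgM; [exact: hw|exact: cvg_cst].
    apply: cvgM.
      apply: cvg_norm; apply: cvg_within_filter; exact: cvg_id.
    apply: cvgD; first exact: cvg_cst.
    by apply: cvgM; [exact: cvg_cst|exact: hw].
have lim : h^-1 *: (bt (w (h *: 1 + t)) (w (h *: 1 + t)) - bt (w t) (w t)) @[h --> 0^']
    --> (2 * bt v (w t) : R^o).
  rewrite -[X in _ --> X]addr0.
  apply: cvg_trans (cvgD (cvg_cst (2 * bt v (w t))) Q0).
  apply: near_eq_cvg; near=> h; rewrite /= quot//.
  by near: h; exact: nbhs_dnbhs_neq.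
split; first by apply/cvg_ex; exists (2 * bt v (w t)).
exact: cvg_lim.
Unshelve. all: by end_near.
Qed.

Definition sres (i : nat) (u : V) : V := projT1 (cid (resp_ex i%:R u)).

Lemma sresP i u : res 1 i%:R u (sres i u).
Proof. by rewrite /sres; case: cid. Qed.

Let bt i u v := ip (sres i u) (sres i v).

Lemma bt_sym i u v : bt i u v = bt i v u. Proof. exact: (ip_sym F). Qed.

Lemma bt_lin i (a : R) u v w : bt i (a *: u + v) w = a * bt i u w + bt i v w.
Proof.
rewrite /bt (res_uniq (sresP i _) (res_lin a (sresP i u) (sresP i v))).
exact: (ip_lin F).
Qed.

Lemma bt_ge0 i u : 0 <= bt i u u. Proof. exact: (ip_ge0 F). Qed.

Lemma bt_le i u : bt i u u <= ip u u. Proof. exact: res_contr (sresP i u). Qed.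

Lemma bt_sum (N : nat) u : \sum_(0 <= i < N) bt i u u <= 32 * ip u u.
Proof. exact: (local_smoothing N (fun i => sresP i u)). Qed.

(** The coefficient of the j-th term grows linearly from time j to time j + 1: the
    functional is continuous in time and its derivative contains the negative
    term - |B_j w|^2, where B_j is the resolvent at time j. *)
Let energy (j : nat) (t : R) u : R :=
  64 * ip u u - \sum_(0 <= i < j) bt i u u - (t - j%:R) * bt j u u.

Lemma energy_lower j t u : j%:R <= t -> t <= j%:R + 1 ->
  32 * ip u u <= energy j t u.
Proof.
move=> jt tj; rewrite /energy.
have := bt_sum j.+1 u; rewrite big_nat_recr//=.
have : (t - j%:R) * bt j u u <= bt j u u.
  by rewrite -[leRHS]mul1r ler_wpM2r ?bt_ge0//; lra.
lra.
Qed.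

(** The forcing w1 enters through the products <B_i h, B_i psi> with psi = B_j w,
    whose sum over i is controlled by local smoothing for h and for psi; the
    term - |psi|^2 absorbs it. *)
Lemma energy_decay j t w w1 dw1 psi h : j%:R <= t -> t <= j%:R + 1 ->
  der w1 dw1 -> (forall z, ip w1 z - (ip dw1 z - j%:R * ip (J w1) z) = ip h z) ->
  res 1 j%:R w psi -> 192 ^+ 2 * ip h h <= ip psi psi ->
  128 * ip w1 w - \sum_(0 <= i < j) 2 * bt i w1 w
    - (t - j%:R) * (2 * bt j w1 w) - bt j w w <= 0.
Proof.
move=> jt tj dw hh hpsi small.
have hbtj : bt j w w = ip psi psi.
  by rewrite /bt (res_uniq (sresP j w) hpsi) (ip_sym F) (res_uniq (sresP j w) hpsi).
have hw : ip w1 w = ip h psi.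
  have [dp dp1 ep] := hpsi.
  rewrite (ip_sym F) -ep -hh mul1r.
  have := der_skew F dp1 dw.
  rewrite (ip_sym F psi w1) (ip_sym F psi dw1) ip_Jl (ip_sym F psi (J w1)); lra.
have bE i : bt i w1 w = ip (sres i h) (sres i psi).
  exact: (res_cross dw hh hpsi (sresP i w1) (sresP i w) (sresP i h) (sresP i psi)).
(* Young's inequality is used 64 + 32 times, the 32 coming from local smoothing;
   each time it costs 192 |h|^2 + |psi|^2 / 192, that is at most |psi|^2 / 96. *)
have e0 : 0 < 192^-1 :> R by rewrite invr_gt0.
have young i : - (2 * bt i w1 w) <= 192 * bt i h h + 192^-1 * bt i psi psi.
  have := form_young (ip_sym F) (ip_lin F) (ip_ge0 F) (- sres i psi) (sres i h) e0.
  rewrite invrK !ipE bE (ip_sym F (sres i psi)) /bt; lra.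
have s1 : - \sum_(0 <= i < j) 2 * bt i w1 w <=
    192 * \sum_(0 <= i < j) bt i h h + 192^-1 * \sum_(0 <= i < j) bt i psi psi.
  by rewrite -sumrN !mulr_sumr -big_split/=; apply: ler_sum => i _; exact: young.
have s2 : - ((t - j%:R) * (2 * bt j w1 w)) <= 192 * bt j h h + 192^-1 * bt j psi psi.
  have y := young j.
  have p : 0 <= 192 * bt j h h + 192^-1 * bt j psi psi.
    by rewrite addr_ge0// mulr_ge0 ?bt_ge0// ltW.
  rewrite -mulrN; apply: (@le_trans _ _ ((t - j%:R) * (192 * bt j h h + 192^-1 * bt j psi psi))).
    by rewrite ler_wpM2l//; lra.
  by rewrite -[leRHS]mul1r ler_wpM2r//; lra.
have s3 := bt_sum j.+1 h; rewrite big_nat_recr//= in s3.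
have s4 := bt_sum j.+1 psi; rewrite big_nat_recr//= in s4.
have y := form_young (ip_sym F) (ip_lin F) (ip_ge0 F) psi h e0.
rewrite invrK (ip_sym F psi h) in y.
rewrite hw hbtj.
have i192 : 192 * 192^-1 = 1 :> R by rewrite mulfV.
have := ip_ge0 F psi; have := ip_ge0 F h; lra.
Qed.

(** The energy does not increase, starts at 64 |w(0)|^2 and stays above
    32 |w(t)|^2, by local smoothing.  The forcing has to be small in the graph norm
    of D_j, relative to the resolvent of the solution at the integer time j. *)
Theorem uniform_stability (w w1 : R -> V) :
  (forall t : R, 0 <= t -> tder w (w1 t) t) ->
  (forall (j : nat) (t : R) psi, j%:R <= t -> t <= j%:R + 1 ->
     res 1 j%:R (w t) psi ->
     exists dw1 h, [/\ der (w1 t) dw1,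
       forall z, ip (w1 t) z - (ip dw1 z - j%:R * ip (J (w1 t)) z) = ip h z &
       192 ^+ 2 * ip h h <= ip psi psi]) ->
  forall t : R, 0 <= t -> ip (w t) (w t) <= 2 * ip (w 0) (w 0).
Proof.
move=> wd wsmall.
pose D j t := 2 * (64 * ip (w1 t) (w t)) - \sum_(0 <= i < j) 2 * bt i (w1 t) (w t)
  - ((t - j%:R) * (2 * bt j (w1 t) (w t)) + bt j (w t) (w t)).
have dE j (t : R) : 0 <= t -> is_derive t 1 (fun s => energy j s (w s)) (D j t).
  move=> t0; have wt := wd t t0.
  have d1 := tder_form (ip_sym F) (ip_lin F) (ip_ge0 F) (fun u => lexx _) wt.
  have d2 i := tder_form (bt_sym i) (bt_lin i) (bt_ge0 i) (bt_le i) wt.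
  have d3 : is_derive t 1 (fun s => \sum_(0 <= i < j) bt i (w s) (w s))
      (\sum_(0 <= i < j) 2 * bt i (w1 t) (w t)).
    elim: j => [|j IH].
      under eq_fun do rewrite big_geq//.
      by rewrite big_geq//; exact: is_derive_cst.
    under eq_fun do rewrite big_nat_recr//=.
    by rewrite big_nat_recr//=; apply: is_deriveD.
  have d4 : is_derive t 1 (fun s => (s - j%:R) * bt j (w s) (w s))
     ((t - j%:R) * (2 * bt j (w1 t) (w t)) + bt j (w t) (w t)).
    apply: is_derive_eq.
    by rewrite oppr0 addr0 -[_ *: 1]/(_ * 1) mulr1.
  have d5 : is_derive t 1 (fun s => 64 * ip (w s) (w s)) (64 * (2 * ip (w1 t) (w t))).
    exact: is_deriveZ.
  rewrite /energy /D mulrCA; exact: (is_deriveB (is_deriveB d5 d3) d4).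
have cont j (t : R) : 0 <= t -> {for t, continuous (fun s => energy j s (w s))}.
  move=> t0; apply/differentiable_continuous/derivable1_diffP.
  by have [] := dE j t t0.
have mono (j : nat) (t : R) : j%:R <= t -> t <= j%:R + 1 ->
    energy j t (w t) <= energy j j%:R (w j%:R).
  move=> jt tj; have j0 : 0 <= j%:R :> R by [].
  have df x : x \in `]j%:R, t[ -> derivable (fun s => energy j s (w s)) x 1.
    rewrite in_itv/= => /andP[jx _].
    by have [] := dE j x (le_trans j0 (ltW jx)).
  have df0 x : x \in `]j%:R, t[ -> derive1 (fun s => energy j s (w s)) x <= 0.
    rewrite in_itv/= => /andP[jx xt].
    have [dx ex] := dE j x (le_trans j0 (ltW jx)).
    rewrite derive1E ex /D.
    have [psi hpsi] := resp_ex j%:R (w x).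
    have xj : x <= j%:R + 1 by rewrite (le_trans (ltW xt)).
    have [dw1 [h [h1 h2 h3]]] := wsmall j x psi (ltW jx) xj hpsi.
    by have := energy_decay (ltW jx) xj h1 h2 hpsi h3; lra.
  have cf : {within `[j%:R, t], continuous (fun s => energy j s (w s))}.
    apply: continuous_in_subspaceT => x; rewrite inE/= in_itv/= => /andP[jx _].
    exact: (cont j x (le_trans j0 jx)).
  exact: (ler0_derive1_nincr df df0 cf (lexx _) jt (lexx _)).
have glue j : energy j j%:R (w j%:R) <= 64 * ip (w 0) (w 0).
  elim: j => [|j IH]; first by rewrite /energy big_geq// subr0 subrr mul0r subr0.
  apply: le_trans IH; have := mono j j.+1%:R.
  rewrite -natr1 lerDl ler01 => /(_ isT (lexx _)); rewrite /energy big_nat_recr//=.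
  by rewrite -natr1; lra.
move=> t t0.
pose j := Num.truncn t.
have [jt tj] : j%:R <= t /\ t <= j%:R + 1.
  by have := truncn_itv t0; rewrite -/j => /andP[? /ltW]; rewrite -natr1.
have := mono j t jt tj; have := glue j; have := energy_lower (w t) jt tj; lra.
Qed.

End Local_smoothing.
End SkewFrame.

(** * Multipliers and the elliptic estimate *)

Section Elliptic.
Variables (R : realType) (V : lmodType R).
Variables (ip : V -> V -> R) (J : V -> V) (der : V -> V -> Prop).
Hypothesis F : skew_frame ip J der.

Let ipE := (form_Dl (ip_lin F), form_Dr (ip_sym F) (ip_lin F),
  form_Nl (ip_lin F), form_Nr (ip_sym F) (ip_lin F),
  form_Zl (ip_lin F), form_Zr (ip_sym F) (ip_lin F)).

(** A acts like the multiplication by a matrix of Lipschitz functions, A' like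
    the multiplication by its derivative; K bounds the squares of both norms. *)
Record multiplier (A A' : V -> V) (K : R) : Prop := Multiplier {
  mult_lin : forall (a : R) u v, A (a *: u + v) = a *: A u + A v;
  mult_J : forall u, A (J u) = J (A u);
  mult_der : forall u du, der u du -> der (A u) (A du + A' u);
  mult_bound : forall u, ip (A u) (A u) <= K * ip u u;
  mult_bound' : forall u, ip (A' u) (A' u) <= K * ip u u
}.

Lemma multD A A' K u v : multiplier A A' K -> A (u + v) = A u + A v.
Proof. by move=> h; rewrite -[u in LHS]scale1r (mult_lin h) scale1r. Qed.

Lemma mult0 A A' K : multiplier A A' K -> A 0 = 0.
Proof. by move=> h; have := mult_lin h (-1) 0 0; rewrite !scaleN1r !addNr. Qed.

Lemma multZ A A' K (a : R) u : multiplier A A' K -> A (a *: u) = a *: A u.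
Proof. by move=> h; rewrite -[in LHS](addr0 (a *: u)) (mult_lin h) (mult0 h) addr0. Qed.

Lemma multN A A' K u : multiplier A A' K -> A (- u) = - A u.
Proof. by move=> h; rewrite -scaleN1r (multZ _ _ h) scaleN1r. Qed.

Lemma mult_shift A A' K t x dx z : multiplier A A' K ->
  ip (A dx + A' x) z - t * ip (J (A x)) z = ip (A (dx - t *: J x)) z + ip (A' x) z.
Proof.
by move=> h; rewrite (multD _ _ h) (multN _ h) (multZ _ _ h) (mult_J h) !ipE; ring.
Qed.

(** D_tj differs from D_t by the bounded operator (t - tj) J, and A commutes with
    D_t up to A'. *)
Lemma mult_graph A A' K t tj x dx h : multiplier A A' K -> 0 <= K ->
  `|t - tj| <= 1 -> der x dx ->
  (forall z, ip (A x) z - (ip (A dx + A' x) z - tj * ip (J (A x)) z) = ip h z) ->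
  ip h h <= 12 * K * (ip x x + ip (dx - t *: J x) (dx - t *: J x)).
Proof.
move=> hA K0 tt dx_ hh.
set X := dx - t *: J x.
pose r := t - tj.
have hE z : ip h z = ip (A x - A' x - (A X + r *: J (A x))) z.
  rewrite -hh; have := mult_shift t x dx z hA; rewrite -/X.
  by rewrite !ipE /r; lra.
have -> : ip h h = ip (A x - A' x - (A X + r *: J (A x))) (A x - A' x - (A X + r *: J (A x))).
  by rewrite hE (ip_sym F) hE.
have sq := form_sq_add (ip_sym F) (ip_lin F) (ip_ge0 F).
have h1 := sq (A x - A' x) (- (A X + r *: J (A x))).
have h2 := sq (A x) (- A' x).
have h3 := sq (A X) (r *: J (A x)).
have e1 u : ip (- u) (- u) = ip u u by rewrite !ipE opprK.
have e2 : ip (r *: J (A x)) (r *: J (A x)) <= ip (A x) (A x).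
  rewrite !ipE (J_iso F) mulrA -expr2 -[leRHS]mul1r ler_wpM2r ?(ip_ge0 F)//.
  by rewrite -real_normK ?num_real// expr_le1.
rewrite !e1 in h1 h2.
have b1 := mult_bound hA x; have b2 := mult_bound' hA x; have b3 := mult_bound hA X.
have p1 := ip_ge0 F x; have p2 := ip_ge0 F X.
have p3 : 0 <= K * ip X X by rewrite mulr_ge0.
lra.
Qed.

(** Let X = D_t Psi.  The equation (G D_t)^2 Psi - Psi = W is tested against Q Psi,
    where Q is the inverse of the diagonal of G and P = G^T Q - 1: integration
    by parts gives <G X, X> + <Psi, Q Psi>, which is coercive, up to terms with
    the small P.  The source enters only through its resolvent psi, as the factor
    1 + D_tj of W = (1 + D_tj) psi passes to Q Psi. *)
Lemma elliptic_bound (c C nu t tj : R) (G Q Q' P P' : V -> V) Psi dPsi v1 dv1 W psi :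
  0 < c -> 0 < C -> 0 <= nu -> 8 * C * nu <= c ^+ 2 -> `|t - tj| <= 1 ->
  (forall x, c * ip x x <= ip (G x) x) ->
  (forall x, ip (G x) (G x) <= C * ip x x) ->
  (forall x y, ip (G y) (Q x) = ip y x + ip y (P x)) ->
  (forall x, c * ip x x <= ip x (Q x)) ->
  multiplier Q Q' C -> multiplier P P' nu ->
  der Psi dPsi -> der v1 dv1 ->
  (forall z, ip v1 z = ip (G (dPsi - t *: J Psi)) z) ->
  (forall z, ip (G (dv1 - t *: J v1)) z - ip Psi z = ip W z) ->
  res ip J der 1 tj W psi ->
  ip Psi Psi + ip (dPsi - t *: J Psi) (dPsi - t *: J Psi)
    <= 48 * C / c ^+ 2 * ip psi psi.
Proof.
move=> c0 C0 nu0 small tt Gc Gb GQ Qc hQ hP dP dv v1E WE [dpsi dpsi1 epsi].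
set X := dPsi - t *: J Psi; set S := _ + _.
have young := form_young (ip_sym F) (ip_lin F) (ip_ge0 F).
have sq := form_sq_add (ip_sym F) (ip_lin F) (ip_ge0 F).
have p1 := ip_ge0 F Psi; have p2 := ip_ge0 F X.
have dQ := mult_der hQ dP; have dPP := mult_der hP dP.
(* G^T Q Psi = Psi + P Psi, and D_t passes to each of the two terms. *)
have main : ip (G X) X + ip Psi (Q Psi) =
    - ip W (Q Psi) - ip (G X) (P X + P' Psi).
  rewrite -WE GQ.
  have skew x dx : der x dx -> ip (dv1 - t *: J v1) x = - ip (G X) (dx - t *: J x).
    move=> dx1; rewrite -v1E !ipE (der_skew F dv dx1).
    have -> : ip (J v1) x = - ip v1 (J x) by exact: (ip_Jl F).
    by ring.
  rewrite (skew _ _ dP) (skew _ _ dPP) -/X.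
  have -> : ip (G X) (P dPsi + P' Psi - t *: J (P Psi)) = ip (G X) (P X + P' Psi).
    rewrite (ip_sym F) (ip_sym F (G X) (P X + _)).
    have := mult_shift t Psi dPsi (G X) hP; rewrite -/X !ipE; lra.
  by lra.
have [h [hh hE]] : exists h, (forall z, ip (Q Psi) z - (ip (Q dPsi + Q' Psi) z -
     tj * ip (J (Q Psi)) z) = ip h z) /\ ip W (Q Psi) = ip psi h.
  exists (Q Psi - (Q dPsi + Q' Psi - tj *: J (Q Psi))); split.
    by move=> z; rewrite !ipE; ring.
  rewrite -epsi mul1r (der_skew F dpsi1 dQ) (ip_Jl F) !ipE; ring.
have hb := mult_graph hQ (ltW C0) tt dP hh; rewrite -/X -/S in hb.
have S0 : 0 <= S by exact: addr_ge0.
have e1 : 0 < c / (24 * C) by rewrite divr_gt0// mulr_gt0.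
have y1 := young _ h (- psi) e1; rewrite invf_div !ipE opprK in y1.
have e2 : 0 < c / (2 * C) by rewrite divr_gt0// mulr_gt0.
have y2 := young _ (G X) (- (P X + P' Psi)) e2.
have nE u : ip (- u) (- u) = ip u u by rewrite !ipE opprK.
rewrite invf_div nE (form_Nr (ip_sym F) (ip_lin F)) in y2.
have z1 : c / (24 * C) * ip h h <= c / 2 * S.
  rewrite (le_trans (ler_wpM2l (ltW e1) hb))// le_eqVlt; apply/orP; left; apply/eqP.
  by field; rewrite gt_eqF.
have z2 : c / (2 * C) * ip (G X) (G X) <= c / 2 * ip X X.
  rewrite (le_trans (ler_wpM2l (ltW e2) (Gb X)))// le_eqVlt; apply/orP; left; apply/eqP.
  by field; rewrite gt_eqF.
have z3 : 2 * C / c * ip (P X + P' Psi) (P X + P' Psi) <= c / 2 * S.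
  have e3 : 0 < 2 * C / c by rewrite divr_gt0// mulr_gt0.
  apply: (@le_trans _ _ (2 * C / c * (2 * nu * S))).
    rewrite ler_wpM2l ?(ltW e3)//.
    have := sq (P X) (P' Psi); have := mult_bound hP X; have := mult_bound' hP Psi.
    by rewrite /S; lra.
  have -> : 2 * C / c * (2 * nu * S) = (8 * C * nu) * S / (2 * c) by field; rewrite gt_eqF.
  rewrite ler_pdivrMr ?mulr_gt0//.
  have -> : c / 2 * S * (2 * c) = c ^+ 2 * S by field.
  by rewrite ler_wpM2r.
have SE : S = ip Psi Psi + ip X X by [].
have coer : c * S <= ip (G X) X + ip Psi (Q Psi).
  by rewrite SE; have := Gc X; have := Qc Psi; lra.
rewrite main hE (ip_sym F psi) in coer.
have fin : c * S <= 48 * C / c * ip psi psi.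
  have -> : 48 * C / c = 2 * (24 * C / c) by field; rewrite gt_eqF.
  have : 0 <= c / 2 * ip Psi Psi by rewrite mulr_ge0// ltW// divr_gt0.
  rewrite SE in z1 z3 coer *; lra.
rewrite -(ler_pM2l c0); apply: (le_trans fin).
rewrite le_eqVlt; apply/orP; left; apply/eqP; by field; rewrite gt_eqF.
Qed.

End Elliptic.

(** * Isometries of the line *)

Lemma ae_imp {R : realType} (P Q : R -> Prop) :
  {ae @lebesgue_measure R, forall x, P x} -> (forall x, P x -> Q x) ->
  {ae @lebesgue_measure R, forall x, Q x}.
Proof.
move=> [N [mN N0 PN]] PQ; exists N; split=> // x /= nQ.
by apply: PN => /= /PQ.
Qed.

Lemma ae_all {R : realType} (P : R -> Prop) : (forall x, P x) ->
  {ae @lebesgue_measure R, forall x, P x}.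
Proof. by move=> h; exists set0; split=> // x /= /(_ (h x)). Qed.

Lemma ae_and {R : realType} (P Q : R -> Prop) :
  {ae @lebesgue_measure R, forall x, P x} -> {ae @lebesgue_measure R, forall x, Q x} ->
  {ae @lebesgue_measure R, forall x, P x /\ Q x}.
Proof.
move=> [N [mN N0 PN]] [M [mM M0 QM]]; exists (N `|` M); split.
- exact: measurableU.
- exact: null_set_setU.
- move=> x /=; apply: contra_notP => /not_orP[nN nM]; split.
    by apply: contrapT => h; apply: nN; exact: PN.
  by apply: contrapT => h; apply: nM; exact: QM.
Qed.

Section Lebesgue.
Context {R : realType}.
Local Notation mu := (@lebesgue_measure R).

Definition iso_line (phi : R -> R) :=
  measurable_fun setT phi /\
  forall A : set R, measurable A -> mu (phi @^-1` A) = mu A.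

Lemma iso_shift (a : R) : iso_line (fun x => x + a).
Proof.
have mphi : measurable_fun setT (fun x : R => x + a).
  by apply: measurable_funD => //; exact: measurable_cst.
split=> // A mA; apply/esym.
rewrite -[RHS]/(pushforward mu (fun x => x + a : measurableTypeR R) A).
apply: lebesgue_measure_unique => //= _ [[x y]] _ <-.
rewrite /pushforward [X in _ = mu X](_ : _ = `]x - a, y - a]%classic); last first.
  by apply/seteqP; split=> z /=; rewrite !in_itv/= ltrBlDr lerBrDr.
by rewrite !lebesgue_measure_itv/= !lte_fin ltrD2r -!EFinB opprB addrA subrK.
Qed.

Lemma iso_opp : iso_line (fun x => - x).
Proof.
split; first exact: oppr_measurable.
by move=> A mA; exact: lebesgue_measureN.
Qed.

Variables (phi : R -> R) (iphi : iso_line phi).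

Let mphi : measurable_fun setT phi := iphi.1.

Lemma measurable_iso (f : R -> R) : measurable_fun setT f -> measurable_fun setT (f \o phi).
Proof. by move=> mf; exact: measurableT_comp. Qed.

Let pushE (A : set R) : measurable A ->
  pushforward mu (phi : R -> measurableTypeR R) A = mu A.
Proof. exact: iphi.2. Qed.

Lemma ge0_integral_iso (f : R -> \bar R) : measurable_fun setT f ->
  (forall x, 0 <= f x)%E -> (\int[mu]_x f (phi x) = \int[mu]_x f x)%E.
Proof.
move=> mf f0.
rewrite -[LHS](@ge0_integral_pushforward _ _ (measurableTypeR R) (measurableTypeR R) R phi mphi mu setT f)//.
by apply: eq_measure_integral => //= A mA _; exact: pushE.
Qed.

Lemma integrable_iso (f : R -> R) : mu.-integrable setT (EFin \o f) ->
  mu.-integrable setT (EFin \o (f \o phi)).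
Proof.
move=> /integrableP[/measurable_EFinP mf foo]; apply/integrableP; split.
  by apply/measurable_EFinP; exact: measurable_iso.
rewrite (ge0_integral_iso (f := fun x => `|(f x)%:E|%E))//.
by apply: measurableT_comp => //; exact/measurable_EFinP.
Qed.

Lemma Rintegral_iso (f : R -> R) : mu.-integrable setT (EFin \o f) ->
  \int[mu]_x f (phi x) = \int[mu]_x f x.
Proof.
move=> intf; have /integrableP[/measurable_EFinP mf _] := intf.
rewrite /Rintegral; congr fine.
rewrite -[LHS](@integral_pushforward _ _ (measurableTypeR R) (measurableTypeR R) R phi mphi mu setT (EFin \o f))//.
- by apply: eq_measure_integral => //= A mA _; exact: pushE.
- exact/measurable_EFinP.
- exact: integrable_iso.
Qed.

Lemma ae_iso (P : R -> Prop) : {ae mu, forall x, P x} -> {ae mu, forall x, P (phi x)}.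
Proof.
move=> [N [mN N0 PN]]; exists (phi @^-1` N); split.
- by rewrite -[X in measurable X]setTI; exact: mphi.
- by rewrite -N0; exact: iphi.2.
- by move=> x /= nP; exact: PN.
Qed.

End Lebesgue.

(** * Square integrable functions *)

Section L2.
Context {R : realType}.
Local Notation mu := (@lebesgue_measure R).
Local Notation L1 f := (mu.-integrable setT (EFin \o f)).

Definition L2 (f : R -> R) := measurable_fun setT f /\ L1 (fun x => f x ^+ 2).

Definition dot (f g : R -> R) : R := \int[mu]_x (f x * g x).

Lemma le_L1 (f g : R -> R) : measurable_fun setT f -> L1 g ->
  (forall x, `|f x| <= g x) -> L1 f.
Proof.
move=> mf ig fg; apply: le_integrable ig => //; first exact/measurable_EFinP.
by move=> x _ /=; rewrite lee_fin (le_trans (fg x))// ler_norm.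
Qed.

Lemma L1D (f g : R -> R) : L1 f -> L1 g -> L1 (fun x => f x + g x).
Proof. by move=> h1 h2; have := integrableD measurableT h1 h2. Qed.

Lemma L1Z (a : R) (f : R -> R) : L1 f -> L1 (fun x => a * f x).
Proof. by move=> h1; have := integrableZl measurableT a h1. Qed.

Lemma L1_meas (f : R -> R) : L1 f -> measurable_fun setT f.
Proof. by move=> /integrableP[/measurable_EFinP]. Qed.

Lemma L2_mul (f g : R -> R) : L2 f -> L2 g -> L1 (fun x => f x * g x).
Proof.
move=> [mf f2] [mg g2]; apply: (le_L1 _ (L1D f2 g2)).
  exact: measurable_funM.
move=> x; rewrite normrM.
have := sqr_ge0 (`|f x| - `|g x|); rewrite -(real_normK (num_real (f x))) -(real_normK (num_real (g x))).
have := normr_ge0 (f x); have := normr_ge0 (g x).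
by nra.
Qed.

Lemma L2_lin (a : R) (f g : R -> R) : L2 f -> L2 g -> L2 (fun x => a * f x + g x).
Proof.
move=> hf hg; have [mf f2] := hf; have [mg g2] := hg; split.
  by apply: measurable_funD => //; apply: measurable_funM.
have h := L1D (L1Z (a ^+ 2) f2) (L1D (L1Z (2 * a) (L2_mul hf hg)) g2).
by apply: eq_integrable h => //= x _; congr EFin; ring.
Qed.

Lemma L2_0 : L2 (fun=> 0).
Proof.
split=> //; apply: eq_integrable (integrable0 _ _) => //= x _.
by rewrite expr0n.
Qed.

Lemma L2Z (a : R) (f : R -> R) : L2 f -> L2 (fun x => a * f x).
Proof.
move=> hf; have := L2_lin a hf L2_0.
by under [X in L2 X -> _]eq_fun do rewrite addr0.
Qed.

Lemma L2D (f g : R -> R) : L2 f -> L2 g -> L2 (fun x => f x + g x).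
Proof.
move=> hf hg; have := L2_lin 1 hf hg.
by under [X in L2 X -> _]eq_fun do rewrite mul1r.
Qed.

Lemma L2_bounded (m f : R -> R) (K : R) : measurable_fun setT m ->
  (forall x, `|m x| <= K) -> L2 f ->
  L2 (fun x => m x * f x) /\ dot (fun x => m x * f x) (fun x => m x * f x) <= K ^+ 2 * dot f f.
Proof.
move=> mm mK [mf f2].
have K0 : 0 <= K by exact: le_trans (normr_ge0 (m 0)) (mK 0).
have bd x : (m x * f x) ^+ 2 <= K ^+ 2 * f x ^+ 2.
  rewrite exprMn ler_wpM2r ?sqr_ge0// -real_normK ?num_real//.
  by rewrite ler_pXn2r// ?nnegrE.
have mmf : measurable_fun setT (fun x => m x * f x) by exact: measurable_funM.
have L : L2 (fun x => m x * f x).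
  split=> //; apply: (le_L1 _ (L1Z (K ^+ 2) f2)).
    exact: measurable_funX.
  by move=> x; rewrite ger0_norm ?sqr_ge0.
split=> //; rewrite /dot.
have -> : \int[mu]_x (f x * f x) = \int[mu]_x (f x ^+ 2) by apply: eq_Rintegral => x _; rewrite expr2.
rewrite -RintegralZl//.
apply: le_Rintegral => //.
- exact: L2_mul.
- exact: L1Z.
- by move=> x _; rewrite -expr2.
Qed.

Lemma dotC f g : dot f g = dot g f.
Proof. by apply: eq_Rintegral => x _; rewrite mulrC. Qed.

Lemma dot_lin (a : R) (f g h : R -> R) : L2 f -> L2 g -> L2 h ->
  dot (fun x => a * f x + g x) h = a * dot f h + dot g h.
Proof.
move=> hf hg hh; rewrite /dot -RintegralZl//; last exact: L2_mul.
rewrite -RintegralD//; [|by apply: L1Z; exact: L2_mul|exact: L2_mul].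
by apply: eq_Rintegral => x _; rewrite mulrDl mulrA.
Qed.

Lemma dot_ge0 f : 0 <= dot f f.
Proof. by apply: Rintegral_ge0 => x _; rewrite -expr2 sqr_ge0. Qed.

Lemma eq_ae_Rintegral (f g : R -> R) : measurable_fun setT f -> measurable_fun setT g ->
  {ae mu, forall x, f x = g x} -> \int[mu]_x f x = \int[mu]_x g x.
Proof.
move=> mf mg fg; rewrite /Rintegral; congr fine.
apply: ae_eq_integral => //; [exact/measurable_EFinP|exact/measurable_EFinP|].
by apply: (ae_imp fg) => x /= -> _.
Qed.

Lemma ae_L1 (f g : R -> R) : L1 f -> measurable_fun setT g ->
  {ae mu, forall x, f x = g x} -> L1 g.
Proof.
move=> /integrableP[/measurable_EFinP mf foo] mg fg; apply/integrableP; split.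
  exact/measurable_EFinP.
rewrite -(ge0_ae_eq_integral (mu := mu) (f := fun x => `|(f x)%:E|%E))//.
- by apply: measurableT_comp => //; exact/measurable_EFinP.
- by apply: measurableT_comp => //; exact/measurable_EFinP.
- by apply: (ae_imp fg) => x /= -> _.
Qed.

Lemma ae_L2 (f g : R -> R) : L2 f -> measurable_fun setT g ->
  {ae mu, forall x, f x = g x} -> L2 g.
Proof.
move=> [mf f2] mg fg; split=> //; apply: (ae_L1 f2); first exact: measurable_funX.
by apply: (ae_imp fg) => x /= ->.
Qed.

Lemma dot_ae (f f' g : R -> R) : measurable_fun setT f -> measurable_fun setT f' ->
  measurable_fun setT g -> {ae mu, forall x, f x = f' x} -> dot f g = dot f' g.
Proof.
move=> mf mf' mg ff; apply: eq_ae_Rintegral; [exact: measurable_funM|exact: measurable_funM|].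
by apply: (ae_imp ff) => x /= ->.
Qed.

Lemma L2_iso phi f : iso_line phi -> L2 f -> L2 (f \o phi).
Proof.
move=> ip [mf f2]; split; first exact: measurable_iso.
by have := integrable_iso ip f2.
Qed.

Lemma dot_iso phi f g : iso_line phi -> L2 f -> L2 g -> dot (f \o phi) (g \o phi) = dot f g.
Proof. by move=> ip hf hg; exact: (Rintegral_iso ip (L2_mul hf hg)). Qed.

End L2.

(** * Primitives of locally integrable functions *)

Section Primitives.
Context {R : realType}.
Local Notation mu := (@lebesgue_measure R).
Local Notation L1 f := (mu.-integrable setT (EFin \o f)).

Lemma int_cut (A : set R) (f : R -> R) :
  \int[mu]_(x in A) f x = \int[mu]_x (f x * \1_A x).
Proof. by rewrite Rintegral_mkcond patch_indic. Qed.

Lemma L1_cut (A : set R) (f : R -> R) : measurable A ->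
  mu.-integrable A (EFin \o f) <-> L1 (fun x => f x * \1_A x).
Proof.
move=> mA; have := @integrable_mkcond _ _ _ mu A (EFin \o f) mA.
rewrite restrict_EFin patch_indic => ->.
by split.
Qed.

Lemma mcc (a b : R) : measurable (`[a, b]%classic : set (measurableTypeR R)).
Proof. exact: measurable_itv. Qed.

(** u is absolutely continuous with derivative v almost everywhere. *)
Definition Prim (u v : R -> R) := measurable_fun setT v /\
  forall a b, a <= b -> mu.-integrable `[a, b] (EFin \o v) /\
    u b - u a = \int[mu]_(x in `[a, b]) v x.

Lemma Prim_continuous u v : Prim u v -> continuous u.
Proof.
move=> [mv uv] x; pose a := x - 1; pose b := x + 1.
have ab : a < b by rewrite /a /b; lra.
have [iab _] := uv a b (ltW ab).
have c := parameterized_integral_continuous (ltW ab) iab.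
have xab : x \in `]a, b[ by rewrite in_itv/= /a /b; apply/andP; split; lra.
have h := within_continuous_continuous ab c xab.
have h2 : {for x, continuous (fun y => u a + parameterized_integral mu a y v)}.
  by apply: continuousD; [exact: cst_continuous|exact: h].
rewrite /prop_for /continuous_at in h2 *.
have e0 : u a + parameterized_integral mu a x v = u x.
  have ax : a <= x by rewrite /a; lra.
  by rewrite /parameterized_integral; have [_ <-] := uv a x ax; rewrite addrC subrK.
rewrite e0 in h2; apply: cvg_trans h2; apply: near_eq_cvg.
exists 1 => //= y; rewrite /ball_/= ltr_norml => /andP[_ xy1].
have ay : a <= y by rewrite /a; lra.
by rewrite /parameterized_integral; have [_ <-] := uv a y ay; rewrite addrC subrK.
Qed.

Lemma Prim_meas u v : Prim u v -> measurable_fun setT u.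
Proof. by move=> /Prim_continuous/continuous_measurable_fun. Qed.

Lemma Prim_lin (a : R) u v u' v' : Prim u v -> Prim u' v' ->
  Prim (fun x => a * u x + u' x) (fun x => a * v x + v' x).
Proof.
move=> [mv uv] [mv' uv']; split.
  by apply: measurable_funD => //; exact: measurable_funM.
move=> x y xy; have [i1 e1] := uv x y xy; have [i2 e2] := uv' x y xy.
have i3 : mu.-integrable `[x, y] (EFin \o (fun x => a * v x)).
  by have := integrableZl (mcc _ _) a i1.
split; first by have := integrableD (mcc _ _) i3 i2.
by rewrite RintegralD// RintegralZl// -e1 -e2; ring.
Qed.

Lemma Prim_cst (a : R) : Prim (fun=> a) (fun=> 0).
Proof.
split=> // x y xy; split; last by rewrite subrr Rintegral_cst// mul0r.
exact: integrable0.
Qed.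

Lemma Prim_D u v u' v' : Prim u v -> Prim u' v' ->
  Prim (fun x => u x + u' x) (fun x => v x + v' x).
Proof.
move=> h1 h2; have := Prim_lin 1 h1 h2.
by under [X in Prim X _ -> _]eq_fun do rewrite mul1r;
   under [X in Prim _ X -> _]eq_fun do rewrite mul1r.
Qed.

Lemma Prim_Z (a : R) u v : Prim u v -> Prim (fun x => a * u x) (fun x => a * v x).
Proof.
move=> h1; have := Prim_lin a h1 (Prim_cst 0).
by under [X in Prim X _ -> _]eq_fun do rewrite addr0;
   under [X in Prim _ X -> _]eq_fun do rewrite addr0.
Qed.

Lemma Prim_C1 (f f' : R -> R) : (forall x, derivable f x 1) ->
  (forall x, derive1 f x = f' x) -> continuous f' -> Prim f f'.
Proof.
move=> df ef cf'; split; first exact: continuous_measurable_fun.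
have cw (a b : R) : {within `[a, b], continuous f'} by exact: continuous_subspaceT.
move=> a b ab; split.
  by apply: continuous_compact_integrable => //; exact: segment_compact.
move: ab; rewrite le_eqVlt => /predU1P[->|ab].
  by rewrite subrr set_itv1 Rintegral_set1.
have cf : continuous f.
  by move=> x; apply/differentiable_continuous/derivable1_diffP.
rewrite /Rintegral (@continuous_FTC2 _ f' f a b)//.
split; first by move=> x _.
- by apply: cvg_at_right_filter; exact: cf.
- by apply: cvg_at_left_filter; exact: cf.
Qed.

Lemma Prim_shift (a : R) u v : Prim u v -> Prim (fun x => u (x + a)) (fun x => v (x + a)).
Proof.
move=> [mv uv]; have ia := iso_shift a; split; first exact: (measurable_iso ia mv).
move=> x y xy; have xya : x + a <= y + a by rewrite lerD2r.
have [i e] := uv _ _ xya.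
have ind z : \1_`[x + a, y + a] (z + a) = \1_`[x, y] z :> R.
  rewrite !indicE; congr (_%:R); congr nat_of_bool.
  by apply/idP/idP; rewrite !inE/= !in_itv/= !lerD2r.
split.
  apply/L1_cut => //; move/L1_cut: i => /(_ (mcc _ _))/(integrable_iso ia).
  by apply: eq_integrable => //= z _; rewrite ind.
have h := Rintegral_iso ia ((L1_cut v (mcc (x + a) (y + a))).1 i).
rewrite e int_cut; apply: etrans (esym h) _; rewrite [RHS]int_cut.
by apply: eq_Rintegral => z _; rewrite ind.
Qed.

Lemma Prim_opp u v : Prim u v -> Prim (fun x => u (- x)) (fun x => - v (- x)).
Proof.
move=> [mv uv]; have ia := @iso_opp R; split.
  by apply: measurableT_comp => //; exact: (measurable_iso ia mv).
move=> x y xy; have xya : - y <= - x by rewrite lerN2.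
have [i e] := uv _ _ xya.
have ind z : \1_`[- y, - x] (- z) = \1_`[x, y] z :> R.
  rewrite !indicE; congr (_%:R); congr nat_of_bool.
  by apply/idP/idP; rewrite !inE/= !in_itv/= !lerN2 andbC.
have i2 : mu.-integrable `[x, y] (EFin \o (fun z => v (- z))).
  apply/L1_cut => //; move/L1_cut: i => /(_ (mcc _ _))/(integrable_iso ia).
  by apply: eq_integrable => //= z _; rewrite ind.
have i3 : mu.-integrable `[x, y] (EFin \o (fun z => - v (- z))).
  by have := integrableN i2.
split=> //.
have -> : \int[mu]_(z in `[x, y]) (- v (- z)) = - \int[mu]_(z in `[x, y]) v (- z).
  by under eq_Rintegral do rewrite -mulN1r; rewrite RintegralZl// mulN1r.
apply/esym; rewrite int_cut; under eq_Rintegral do rewrite -ind.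
apply/esym.
have h := Rintegral_iso ia ((L1_cut v (mcc (- y) (- x))).1 i).
apply: etrans (congr1 (fun r => - r) (esym h)); rewrite -int_cut -e; exact: opprB || ring.
Qed.

Lemma RFubini (f : R * R -> R) : measurable_fun setT f ->
  (forall x, L1 (fun y => f (x, y))) -> (forall y, L1 (fun x => f (x, y))) ->
  (\int[mu]_x \int[mu]_y `|(f (x, y))%:E| < +oo)%E ->
  \int[mu]_x \int[mu]_y f (x, y) = \int[mu]_y \int[mu]_x f (x, y).
Proof.
move=> mf i1 i2 foo.
have mef : measurable_fun setT (EFin \o f) by exact/measurable_EFinP.
have intf : (mu \x mu)%E.-integrable setT (EFin \o f) by exact/integrable12ltyP.
have h := Fubini intf.
rewrite /Rintegral; congr fine.
transitivity (\int[mu]_x \int[mu]_y (EFin \o f) (x, y))%E.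
  apply: eq_integral => x _; rewrite fineK//; apply: integrable_fin_num => //; exact: i1.
rewrite h; apply: eq_integral => y _; rewrite fineK//; apply: integrable_fin_num => //; exact: i2.
Qed.

End Primitives.

(** * Products of primitives and integration by parts *)

Section Products.
Context {R : realType}.
Local Notation mu := (@lebesgue_measure R).
Local Notation L1 f := (mu.-integrable setT (EFin \o f)).

Lemma L1_bounded (m f : R -> R) (K : R) : measurable_fun setT m ->
  (forall x, `|m x| <= K) -> L1 f -> L1 (fun x => m x * f x).
Proof.
move=> mm mK f1; have K0 : 0 <= K by exact: le_trans (normr_ge0 (m 0)) (mK 0).
apply: (le_L1 _ (L1Z K (integrable_norm f1))).
  by apply: measurable_funM => //; exact: L1_meas.
by move=> x; rewrite normrM ler_wpM2r.
Qed.

Lemma RFubini_prod (v w : R -> R) (chi : R * R -> R) : L1 v -> L1 w ->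
  measurable_fun setT chi -> (forall p, `|chi p| <= 1) ->
  \int[mu]_x \int[mu]_y (v x * w y * chi (x, y)) =
  \int[mu]_y \int[mu]_x (v x * w y * chi (x, y)).
Proof.
move=> v1 w1 mchi chi1.
pose f (p : R * R) := v p.1 * w p.2 * chi p.
have mv := L1_meas v1; have mw := L1_meas w1.
have mf : measurable_fun setT f.
  apply: measurable_funM => //; apply: measurable_funM.
  - by apply: measurableT_comp => //; exact: measurable_fst.
  - by apply: measurableT_comp => //; exact: measurable_snd.
have mchi1 x : measurable_fun setT (fun y => chi (x, y)).
  by apply: measurableT_comp => //; exact: measurable_pair1.
have mchi2 y : measurable_fun setT (fun x => chi (x, y)).
  by apply: measurableT_comp => //; exact: measurable_pair2.
apply: (@RFubini _ f) => //.
- move=> x; rewrite /f/=.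
  have := L1_bounded (mchi1 x) (fun y => chi1 _) (L1Z (v x) w1).
  by under [X in L1 X -> _]eq_fun do rewrite mulrC.
- move=> y; rewrite /f/=.
  have := L1_bounded (mchi2 y) (fun y => chi1 _) (L1Z (w y) v1).
  by under [X in L1 X -> _]eq_fun do rewrite mulrC (mulrC (w y)).
have nw : (\int[mu]_y `|(w y)%:E| < +oo)%E by case/integrableP: w1.
have nv : (\int[mu]_y `|(v y)%:E| < +oo)%E by case/integrableP: v1.
have nw0 : (0 <= \int[mu]_y `|(w y)%:E|)%E by exact: integral_ge0.
apply: (@le_lt_trans _ _ (\int[mu]_x (\int[mu]_y `|(w y)%:E| * `|(v x)%:E|))%E).
  apply: ge0_le_integral => //.
  - by move=> x _; exact: integral_ge0.
  - have h : measurable_fun setT (fun p => `|(f p)%:E|%E).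
      by apply: measurableT_comp => //; exact/measurable_EFinP.
    exact: (@measurable_fun_fubini_tonelli_F _ _ (measurableTypeR R) (measurableTypeR R) R mu _ h).
  - apply: measurable_funeM; apply: measurableT_comp => //; exact/measurable_EFinP.
  - move=> x _; rewrite muleC -ge0_integralZl//=; last 1 first.
      by apply/measurable_EFinP; exact: measurableT_comp.
    apply: ge0_le_integral => //.
    + apply/measurable_EFinP; apply: measurableT_comp => //.
      by apply: measurableT_comp => //; exact: measurable_pair1.
    + by apply: measurable_funeM; apply/measurable_EFinP; exact: measurableT_comp.
    + move=> y _ /=; rewrite lee_fin /f/= normrM normrM -[leRHS]mulr1.
      by rewrite ler_wpM2l// mulr_ge0.
rewrite ge0_integralZl//; last by apply: measurableT_comp => //; exact/measurable_EFinP.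
rewrite -(fineK (x := \int[mu]_y `|(w y)%:E|)%E) ?ge0_fin_numE//.
by rewrite lte_mul_pinfty ?lee_fin ?fine_ge0.
Qed.

Lemma measurable_le_prod : measurable_fun setT (fun p : R * R => (p.1 <= p.2)%R%:R : R).
Proof.
have h : measurable_fun setT (fun p : R * R => p.1 <= p.2)%R.
  by apply: measurable_fun_ler; [exact: measurable_fst|exact: measurable_snd].
have -> : (fun p : R * R => (p.1 <= p.2)%R%:R : R) =
    (fun p : R * R => if (p.1 <= p.2)%R then 1 else 0).
  by apply/funext => p; case: ifP.
by apply: measurable_fun_ifT => //; exact: measurable_cst.
Qed.

(** Fubini's theorem for v1(x) v2(y) on the triangle x <= y of the square [a, b]^2
    is the formula of integration by parts. *)
Lemma Prim_mul (u1 v1 u2 v2 : R -> R) : Prim u1 v1 -> Prim u2 v2 ->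
  Prim (fun x => u1 x * u2 x) (fun x => v1 x * u2 x + u1 x * v2 x).
Proof.
move=> p1 p2; have [m1 e1] := p1; have [m2 e2] := p2.
have c1 := Prim_continuous p1; have c2 := Prim_continuous p2.
have mu1 := Prim_meas p1; have mu2 := Prim_meas p2.
split; first by apply: measurable_funD; apply: measurable_funM.
move=> a b ab; have [i1 E1] := e1 a b ab; have [i2 E2] := e2 a b ab.
have bnd (u : R -> R) : continuous u -> [bounded u x | x in `[a, b]].
  move=> cu; have /compact_bounded[M [Mr hM]] := continuous_compact (continuous_subspaceT cu) (@segment_compact _ a b).
  by exists M; split=> // x xM y yab /=; apply: hM => //; exists y.
have j1 : mu.-integrable `[a, b] (EFin \o (fun x => v1 x * u2 x)).
  have := integrableMl (mcc a b) i1 (measurable_funTS mu2) (bnd _ c2).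
  by [].
have j2 : mu.-integrable `[a, b] (EFin \o (fun x => u1 x * v2 x)).
  have := integrableMr (mcc a b) (measurable_funTS mu1) (bnd _ c1) i2.
  by [].
split; first by have := integrableD (mcc a b) j1 j2.
rewrite RintegralD//.
pose w1 x := v1 x * \1_`[a, b] x; pose w2 x := v2 x * \1_`[a, b] x.
have L1w1 : L1 w1 by exact: (L1_cut v1 (mcc _ _)).1.
have L1w2 : L1 w2 by exact: (L1_cut v2 (mcc _ _)).1.
have tri1 y : w2 y * (u1 y - u1 a) = \int[mu]_x (w1 x * w2 y * (x <= y)%R%:R).
  rewrite /w2 /w1 [in LHS]indicE.
  have [yab|yab] := boolP (y \in `[a, b]%classic); last first.
    rewrite mulr0 mul0r; apply/esym.
    under eq_Rintegral => x _ do rewrite [\1_ _ y]indicE (negbTE yab) mulr0 mulr0 mul0r.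
    by rewrite Rintegral_cst ?mul0r.
  move: (yab); rewrite inE/= in_itv/= => /andP[ay yb].
  have [I1 ->] := e1 a y ay; rewrite mulr1 int_cut.
  rewrite -RintegralZl//; last exact: (L1_cut v1 (mcc a y)).1.
  apply: eq_Rintegral => x _; rewrite [\1_ _ y]indicE yab mulr1 !indicE.
  have -> : (x \in `[a, y]%classic) = (x \in `[a, b]%classic) && (x <= y).
    apply/idP/andP; rewrite !inE/= !in_itv/=.
      by move=> /andP[-> xy]; rewrite xy (le_trans xy yb).
    by move=> [/andP[-> _] ->].
  by case: (_ \in _); case: (_ <= _); rewrite /= ?mulr0 ?mulr1 ?mul0r ?mulr0// mulrC.
have tri2 x : w1 x * (u2 b - u2 x) = \int[mu]_y (w1 x * w2 y * (x <= y)%R%:R).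
  rewrite /w2 /w1 [in LHS]indicE.
  have [xab|xab] := boolP (x \in `[a, b]%classic); last first.
    rewrite mulr0 mul0r; apply/esym.
    under eq_Rintegral => y _ do rewrite [\1_ _ x]indicE (negbTE xab) mulr0 mul0r mul0r.
    by rewrite Rintegral_cst ?mul0r.
  move: (xab); rewrite inE/= in_itv/= => /andP[ax xb].
  have [I2 ->] := e2 x b xb; rewrite mulr1 int_cut.
  rewrite -RintegralZl//; last exact: (L1_cut v2 (mcc x b)).1.
  apply: eq_Rintegral => y _; rewrite [\1_ _ x]indicE xab mulr1 !indicE.
  have -> : (y \in `[x, b]%classic) = (y \in `[a, b]%classic) && (x <= y).
    apply/idP/andP; rewrite !inE/= !in_itv/=.
      by move=> /andP[xy ->]; rewrite xy (le_trans ax xy).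
    by move=> [/andP[_ ->] ->].
  by case: (_ \in _); case: (_ <= _); rewrite /= ?mulr0 ?mulr1 ?mul0r ?mulr0// mulrC.
have key : \int[mu]_y (w2 y * (u1 y - u1 a)) = \int[mu]_x (w1 x * (u2 b - u2 x)).
  under eq_Rintegral do rewrite tri1.
  under [RHS]eq_Rintegral do rewrite tri2.
  apply/esym; apply: (RFubini_prod (chi := fun p => (p.1 <= p.2)%R%:R)) => //.
    exact: measurable_le_prod.
  by move=> [x y]; rewrite /= normr_nat lern1 leq_b1.
have k1 : L1 (fun x => v1 x * u2 x * \1_`[a, b] x) by exact: (L1_cut _ (mcc _ _)).1.
have k2 : L1 (fun x => u1 x * v2 x * \1_`[a, b] x) by exact: (L1_cut _ (mcc _ _)).1.
have S1 : \int[mu]_y (w2 y * (u1 y - u1 a)) =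
    \int[mu]_(x in `[a, b]) (u1 x * v2 x) - u1 a * (u2 b - u2 a).
  rewrite E2 !(int_cut `[a, b]) -RintegralZl// -RintegralB//; last exact: L1Z.
  by apply: eq_Rintegral => y _; rewrite /w2; ring.
have S2 : \int[mu]_x (w1 x * (u2 b - u2 x)) =
    u2 b * (u1 b - u1 a) - \int[mu]_(x in `[a, b]) (v1 x * u2 x).
  rewrite E1 !(int_cut `[a, b]) -RintegralZl// -RintegralB//; last exact: L1Z.
  by apply: eq_Rintegral => y _; rewrite /w1; ring.
by rewrite S1 S2 in key; lra.
Qed.

(** The integral over the line of p(x + 1) - p(x) vanishes by translation
    invariance, and equals the integral of F by exchanging integrals. *)
Lemma Prim_int0 (p F : R -> R) : Prim p F -> L1 p -> L1 F -> \int[mu]_x F x = 0.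
Proof.
move=> [mF pF] L1p L1F.
pose chi (q : R * R) : R := (q.2 <= q.1)%R%:R * (q.1 <= q.2 + 1)%R%:R.
have mchi : measurable_fun setT chi.
  apply: measurable_funM.
    have mswap : measurable_fun setT (fun q : R * R => (q.2, q.1)) by exact: measurable_swap.
    exact: (measurableT_comp measurable_le_prod mswap).
  have mq : measurable_fun setT (fun q : R * R => (q.1, q.2 + 1)).
    apply: measurable_fun_pair; first exact: measurable_fst.
    by apply: measurable_funD; [exact: measurable_snd|exact: measurable_cst].
  exact: (measurableT_comp measurable_le_prod mq).
pose f (q : R * R) := F q.1 * chi q.
have chi1 z y : chi (z, y) = \1_`[z - 1, z] y.
  rewrite /chi indicE -natrM mulnb; congr (_%:R); congr nat_of_bool.
  by rewrite mem_setE in_itv/= lerBlDr andbC.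
have chi2 z y : chi (z, y) = \1_`[y, y + 1] z.
  rewrite /chi indicE -natrM mulnb; congr (_%:R); congr nat_of_bool.
  by rewrite mem_setE in_itv/=.
have c01 q : `|chi q| <= 1.
  by rewrite /chi -natrM mulnb normr_nat lern1 leq_b1.
have len (z : R) : (\int[mu]_y (\1_`[z - 1, z] y)%:E = 1)%E.
  transitivity (mu `[z - 1, z]); first by rewrite integral_indic ?setIT//; exact: mcc.
  rewrite lebesgue_measure_itv/= lte_fin ifT; last by rewrite ltrBlDr ltrDl.
  by rewrite -EFinB opprB addrCA subrr addr0.
have L1ind z : L1 (\1_`[z - 1, z]).
  apply/integrableP; split; first by apply/measurable_EFinP; exact: measurable_indic.
  under eq_integral => y _ do rewrite /= ger0_norm//.
  by rewrite len ltry.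
have fub : \int[mu]_z \int[mu]_y f (z, y) = \int[mu]_y \int[mu]_z f (z, y).
  apply: RFubini.
  - apply: measurable_funM => //; apply: measurableT_comp => //; exact: measurable_fst.
  - move=> z; rewrite /f/=; have := L1Z (F z) (L1ind z).
    by apply: eq_integrable => //= y _; rewrite chi1.
  - move=> y; rewrite /f/=.
    have m1 : measurable_fun setT (fun z => chi (z, y)).
      by apply: measurableT_comp => //; exact: measurable_pair2.
    have := L1_bounded m1 (fun z => c01 _) L1F.
    by apply: eq_integrable => //= z _; rewrite mulrC.
  - have nF : (\int[mu]_y `|(F y)%:E| < +oo)%E by case/integrableP: L1F.
    apply: le_lt_trans nF; rewrite le_eqVlt; apply/orP; left; apply/eqP.
    apply: eq_integral => z _ /=.
    under eq_integral => y _ do rewrite /f/= normrM chi1 [`|\1_ _ _|]ger0_norm// EFinM.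
    rewrite ge0_integralZl//; last by apply/measurable_EFinP; exact: measurable_indic.
    by rewrite len mule1.
have lhs : \int[mu]_z \int[mu]_y f (z, y) = \int[mu]_z F z.
  apply: eq_Rintegral => z _.
  under eq_Rintegral => y _ do rewrite /f/= chi1.
  by rewrite RintegralZl// /Rintegral len mulr1.
have rhs : \int[mu]_y \int[mu]_z f (z, y) = \int[mu]_y (p (y + 1) - p y).
  apply: eq_Rintegral => y _.
  have yy1 : y <= y + 1 by rewrite lerDl.
  have [_ ->] := pF y (y + 1) yy1.
  by rewrite [RHS]int_cut; apply: eq_Rintegral => z _; rewrite /f/= chi2.
have ia := iso_shift (1 : R).
rewrite -lhs fub rhs RintegralB//; last exact: (integrable_iso ia L1p).
by have h := Rintegral_iso ia L1p; rewrite [X in X - _]h subrr.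
Qed.

(** There are no boundary terms, since u v and its derivative are integrable. *)
Lemma L2_skew (u u' v v' : R -> R) : Prim u u' -> Prim v v' -> L2 u -> L2 u' -> L2 v -> L2 v' ->
  dot u' v = - dot u v'.
Proof.
move=> pu pv Lu Lu' Lv Lv'.
have := Prim_int0 (Prim_mul pu pv) (L2_mul Lu Lv) (L1D (L2_mul Lu' Lv) (L2_mul Lu Lv')).
by rewrite RintegralD//; [rewrite /dot; lra|exact: L2_mul|exact: L2_mul].
Qed.

End Products.

(** * The scalar resolvent *)

Section Resolvent.
Context {R : realType}.
Local Notation mu := (@lebesgue_measure R).
Local Notation L1 f := (mu.-integrable setT (EFin \o f)).

Lemma Prim_scale (f f' : R -> R) (k : R) : (forall x : R, is_derive x 1 f (f' x)) ->
  continuous f' -> Prim (fun y => f (k * y)) (fun y => k * f' (k * y)).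
Proof.
move=> df cf'.
have d (x : R) : is_derive x 1 (f \o ( *%R k)) (f' (k * x) * k).
  apply: is_derive1_comp.
  have h : is_derive x 1 ( *%R k) (k *: 1) by exact: is_deriveZ.
  by move: h; rewrite -[k *: 1]/(k * 1) mulr1.
apply: Prim_C1.
- by move=> x; have [] := d x.
- by move=> x; rewrite derive1E; have [_ ->] := d x; rewrite mulrC.
- move=> x; apply: continuousM; first exact: cst_continuous.
  apply: continuous_comp; last exact: cf'.
  exact: mulrl_continuous.
Qed.

Lemma dot_young (e : R) (f g : R -> R) : 0 < e -> L2 f -> L2 g ->
  2 * `|dot f g| <= e * dot f f + e^-1 * dot g g.
Proof.
move=> e0 hf hg; have hfg := L2_mul hf hg.
rewrite /dot -!RintegralZl//; [|exact: L2_mul|exact: L2_mul].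
rewrite -RintegralD//; [|by apply: L1Z; exact: L2_mul|by apply: L1Z; exact: L2_mul].
apply: (@le_trans _ _ (\int[mu]_x (2 * `|f x * g x|))).
  rewrite RintegralZl//; last exact: integrable_norm.
  by rewrite ler_pM2l// le_normr_Rintegral.
apply: le_Rintegral => //.
- by apply: L1Z; exact: integrable_norm.
- by apply: L1D; apply: L1Z; exact: L2_mul.
move=> x _; rewrite normrM -(ler_pM2l e0) mulrDr [e * (e^-1 * _)]mulrA mulfV ?gt_eqF// mul1r.
rewrite -!expr2 -[f x ^+ 2]real_normK ?num_real// -[g x ^+ 2]real_normK ?num_real//.
have := sqr_ge0 (e * `|f x| - `|g x|); nra.
Qed.

Lemma L1_sub_exhaust (f : R -> R) (C : R) : measurable_fun setT f ->
  (forall x, 0 <= f x) ->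
  (forall n : nat, mu.-integrable `[- n%:R, n%:R] (EFin \o f) /\
     \int[mu]_(x in `[- n%:R, n%:R]) f x <= C) -> L1 f.
Proof.
move=> mf f0 hC; apply/integrableP; split; first exact/measurable_EFinP.
under eq_integral => x _ do rewrite /= ger0_norm//.
have mono : nondecreasing_seq (fun n : nat => `[- n%:R, n%:R]%classic : set R).
  move=> m n mn; rewrite subsetEset => x /=; rewrite !in_itv/= => /andP[h1 h2].
  have : m%:R <= n%:R :> R by rewrite ler_nat.
  by move=> h3; apply/andP; split; lra.
have := @ge0_nondecreasing_set_cvg_integral _ (measurableTypeR R) R
  (fun n : nat => `[- n%:R, n%:R]%classic) (EFin \o f) mu mono (fun n => mcc _ _)
  (fun n => measurable_funTS ((measurable_EFinP _ _).2 mf)) (fun n x _ => f0 x).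
have -> : \bigcup_i (`[- i%:R, i%:R]%classic : set R) = [set: R].
  apply/seteqP; split=> // x _; exists (Num.truncn `|x|).+1 => //=.
  have := truncnS_gt `|x|; rewrite in_itv/= -ler_norml; exact: ltW.
move=> h; have le : (\int[mu]_x (f x)%:E <= C%:E)%E.
  rewrite -(cvg_lim (@ereal_hausdorff R) h); apply: lime_le.
    by apply/cvg_ex; eexists; exact: h.
  apply: nearW => n; have [int le] := hC n.
  have fn := integrable_fin_num (mcc (- n%:R) n%:R) int.
  by rewrite -(fineK fn) lee_fin.
by apply: le_lt_trans le _; rewrite ltry.
Qed.

Variables (k : R) (w : R -> R).
Hypotheses (k0 : 0 < k) (hw : L2 w).

Let E (y x : R) : R := expR (- k * (x - y)) * \1_`[0, +oo[ (x - y).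

(** The kernel is compared with the exponential density of parameter 2 k, whose
    total mass is 1. *)
Let E2 y x : E y x ^+ 2 = (2 * k)^-1 * exponential_pdf (2 * k) (x - y).
Proof.
rewrite /E /exponential_pdf patchE indicE; case: ifPn => h; last first.
  by rewrite mulr0 expr0n/= mulr0.
rewrite mulr1 expr2 -expRD mulrA mulVf ?mul1r; last by rewrite gt_eqF// mulr_gt0.
by congr expR; ring.
Qed.

Let mE y : measurable_fun setT (E y).
Proof.
have m1 : measurable_fun setT (fun x : R => x - y) by apply: measurable_funB.
apply: measurable_funM.
  apply: measurableT_comp; first exact: measurable_expR.
  by apply: measurable_funM.
apply: (@measurableT_comp _ _ _ _ _ _ (\1_`[0, +oo[ : R -> R)) => //.
Qed.

Let L2E y : L2 (E y) /\ dot (E y) (E y) = (2 * k)^-1.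
Proof.
have k2 : 0 < 2 * k by rewrite mulr_gt0.
have ia := iso_shift (- y).
have ip : L1 (exponential_pdf (2 * k)) by exact: integrable_exponential_pdf.
have L : L2 (E y).
  split=> //; have := L1Z (2 * k)^-1 (integrable_iso ia ip).
  by apply: eq_integrable => //= x _; rewrite E2.
split=> //; rewrite /dot.
transitivity (\int[mu]_x ((2 * k)^-1 * exponential_pdf (2 * k) (x - y))).
  by apply: eq_Rintegral => x _; rewrite -expr2 E2.
rewrite RintegralZl//; last exact: (integrable_iso ia ip).
have h := Rintegral_iso ia ip; rewrite [X in _ * X]h.
by rewrite /Rintegral integral_exponential_pdf// mulr1.
Qed.

Let q x := expR (- k * x) * w x.

Let qE y x : q x * \1_`[y, +oo[ x = expR (- k * y) * (E y x * w x).
Proof.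
rewrite /q /E.
have -> : \1_`[0, +oo[ (x - y) = \1_`[y, +oo[ x :> R.
  by rewrite !indicE !mem_setE !in_itv/= !andbT subr_ge0.
have -> : expR (- k * x) = expR (- k * y) * expR (- k * (x - y)).
  by rewrite -expRD; congr expR; ring.
ring.
Qed.

Let iq y : mu.-integrable `[y, +oo[ (EFin \o q).
Proof.
apply/L1_cut; first exact: measurable_itv.
have := L1Z (expR (- k * y)) (L2_mul (L2E y).1 hw).
by apply: eq_integrable => //= x _; rewrite qE.
Qed.

Let T y := \int[mu]_(x in `[y, +oo[) q x.

Let TE y : expR (k * y) * T y = dot (E y) w.
Proof.
rewrite /T int_cut; under eq_Rintegral do rewrite qE.
rewrite RintegralZl//; last exact: L2_mul (L2E y).1 hw.
by rewrite mulrA -expRD mulNr addrN expR0 mul1r.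
Qed.

Let PT : Prim T (fun x => - q x).
Proof.
have mq : measurable_fun setT q.
  apply: measurable_funM; last exact: hw.1.
  by apply: measurableT_comp; [exact: measurable_expR|exact: measurable_funM].
split; first exact: measurableT_comp.
move=> a b ab.
have i1 : mu.-integrable `[a, b] (EFin \o q).
  apply: integrableS (iq a) => //.
  by move=> x /=; rewrite !in_itv/= => /andP[-> _].
split; first by have := integrableN i1.
have -> : \int[mu]_(x in `[a, b]) (- q x) = - \int[mu]_(x in `[a, b]) q x.
  by under eq_Rintegral do rewrite -mulN1r; rewrite RintegralZl ?mulN1r//; exact: mcc.
have h := @Rintegral_itvB R q (BLeft a) (BInfty R false) b (iq a).
have -> : T b = T a - \int[mu]_(x in `[a, b]) q x.
  rewrite /T h ?bnd_simp//; apply/esym/Rintegral_itv_obnd_cbnd.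
  apply: integrableS (iq b) => //.
  by move=> x /=; rewrite !in_itv/= !andbT => /ltW.
ring.
Qed.

(** The solution is psi(y) = k e^(k y) times the integral of e^(-k x) w(x) over
    x >= y.  It is bounded, by Cauchy-Schwarz, and the derivative of psi^2 then
    bounds the integral of psi^2 over every interval. *)
Lemma resolvent_neg : exists2 psi, L2 psi & Prim psi (fun x => k * (psi x - w x)).
Proof.
pose psi y := k * (expR (k * y) * T y).
have PE : Prim (fun y => expR (k * y)) (fun y => k * expR (k * y)).
  exact: (Prim_scale k (@is_derive_expR R) (@continuous_expR R)).
have Ppsi : Prim psi (fun x => k * (psi x - w x)).
  have := Prim_Z k (Prim_mul PE PT).
  congr Prim; apply/funext => x; rewrite /psi /q; congr (_ * _).
  have -> : expR (k * x) * - (expR (- k * x) * w x) = - (expR (k * x) * expR (- k * x)) * w x by ring.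
  have -> : expR (k * x) * expR (- k * x) = 1.
    by rewrite -expRD mulNr addrN expR0.
  ring.
exists psi => //.
have mpsi := Prim_meas Ppsi.
pose W := dot w w.
have W0 : 0 <= W := dot_ge0 w.
have bpsi y : `|psi y| <= k / 4 + W / 2.
  have kn0 : k != 0 by rewrite gt_eqF.
  have y1 := dot_young k0 (L2E y).1 hw; rewrite (L2E y).2 -/W in y1.
  rewrite /psi TE normrM gtr0_norm//.
  have e1 : k * (k * (2 * k)^-1 + k^-1 * W) = k / 2 + W by field.
  have h : k * (2 * `|dot (E y) w|) <= k / 2 + W.
    by rewrite -e1 ler_pM2l.
  by have := mulr_ge0 (ltW k0) (normr_ge0 (dot (E y) w)); lra.
pose B := k / 4 + W / 2.
split=> //; apply: (@L1_sub_exhaust _ (W + B ^+ 2 / k)).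
- exact: measurable_funX.
- by move=> x; exact: sqr_ge0.
move=> n; pose a := - n%:R : R; pose b := n%:R : R.
have ab : a <= b by rewrite /a /b; have := ler0n R n; lra.
have cpsi := Prim_continuous Ppsi.
have i1 : mu.-integrable `[a, b] (EFin \o (fun x => psi x ^+ 2)).
  apply: continuous_compact_integrable; first exact: segment_compact.
  apply: continuous_subspaceT => x.
  by apply: (@continuous_comp _ _ _ psi (fun x => x ^+ 2)); [exact: cpsi|exact: exprn_continuous].
split=> //.
have [_ /(_ a b ab)[i2 e2]] := Prim_mul Ppsi Ppsi.
have iw : mu.-integrable `[a, b] (EFin \o (fun x => w x ^+ 2)).
  by apply: integrableS hw.2 => //; exact: mcc.
have i3 : mu.-integrable `[a, b] (EFin \o (fun x => k * (psi x ^+ 2 - w x ^+ 2))).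
  have h := integrableB (mcc a b) i1 iw.
  by have := integrableZl (mcc a b) k h.
(* (psi^2)' = 2 k psi (psi - w) = k (psi^2 - w^2) + k (psi - w)^2 *)
have le : \int[mu]_(x in `[a, b]) (k * (psi x ^+ 2 - w x ^+ 2)) <= psi b * psi b - psi a * psi a.
  rewrite e2; apply: le_Rintegral => //.
  move=> x _; have := sqr_ge0 (psi x - w x); have := k0; nra.
rewrite RintegralZl// in le; last by have := integrableB (mcc a b) i1 iw.
rewrite RintegralB// in le.
have lw : \int[mu]_(x in `[a, b]) (w x ^+ 2) <= W.
  rewrite int_cut /W /dot; apply: le_Rintegral => //.
  - exact: (L1_cut _ (mcc _ _)).1.
  - exact: L2_mul.
  - move=> x _; rewrite -expr2 indicE -[leRHS]mulr1 ler_wpM2l ?sqr_ge0//.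
    by rewrite lern1 leq_b1.
have pb : psi b * psi b <= B ^+ 2.
  by rewrite -expr2 -real_normK ?num_real// ler_pXn2r ?nnegrE// ?(le_trans _ (bpsi b)).
have pa : 0 <= psi a * psi a by rewrite -expr2 sqr_ge0.
rewrite -lerBlDl -(ler_pM2l k0).
rewrite mulrCA mulfV ?gt_eqF// mulr1.
apply: (@le_trans _ _ (k * (\int[mu]_(x in `[a, b]) psi x ^+ 2 - \int[mu]_(x in `[a, b]) w x ^+ 2))).
  by rewrite ler_pM2l// lerD2l lerN2.
apply: (le_trans le); apply: le_trans pb; by rewrite gerBl.
Qed.

End Resolvent.

(** * Smooth cut-off functions *)

Section SmoothSteps.
Context {R : realType}.

Lemma smooth_stable (S : (R -> R) -> Prop) :
  (forall f, S f -> (forall x, derivable f x 1) /\ S (derive1 f)) ->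
  forall f, S f -> smooth f.
Proof.
move=> h f Sf n.
have Sn : S (derive1n n f) by elim: n => [//|n IH]; exact: (h _ IH).2.
exact: (h _ Sn).1.
Qed.

Lemma smooth_derive1 (f : R -> R) : (forall x, derivable f x 1) ->
  smooth (derive1 f) -> smooth f.
Proof. by move=> df sf [|n] x; [exact: df|rewrite derive1Sn; exact: sf]. Qed.

Lemma smooth_derivable (f : R -> R) x : smooth f -> derivable f x 1.
Proof. by move=> /(_ 0%N x). Qed.

Lemma smooth_derive1S (f : R -> R) : smooth f -> smooth (derive1 f).
Proof. by move=> sf n x; have := sf n.+1 x; rewrite derive1Sn. Qed.

Lemma flat_derive (f : R -> R) (C : R) : f 0 = 0 ->
  (forall h, `|f h| <= C * h ^+ 2) -> is_derive (0 : R) 1 f 0.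
Proof.
move=> f0 fC.
have C0 : 0 <= C by have := fC 1; rewrite expr1n mulr1; exact: le_trans.
have lim : h^-1 *: (f (h *: 1 + 0) - f 0) @[h --> 0^'] --> (0 : R).
  apply/norm_cvg0P; apply: (@squeeze_cvgr _ _ _ _ (fun=> 0) (fun h => C * `|h|)).
  - near=> h; have h0 : h != 0 by near: h; exact: nbhs_dnbhs_neq.
    rewrite normr_ge0/= f0 subr0 addr0 [h *: 1]mulr1 [_ *: _]/(_ * _) normrM normfV.
    rewrite mulrC ler_pdivrMr ?normr_gt0//.
    by rewrite -mulrA -expr2 real_normK ?num_real.
  - exact: cvg_cst.
  - rewrite -[X in _ --> X](mulr0 C); apply: cvgM; first exact: cvg_cst.
    rewrite -[X in _ --> X](@normr0 _ R); apply: cvg_norm.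
    by apply: cvg_within_filter; exact: cvg_id.
split; first by apply/cvg_ex; exists 0.
exact: cvg_lim.
Unshelve. all: by end_near. Qed.

Definition flat (n : nat) (x : R) : R :=
  if 0 < x then x^-1 ^+ n * expR (- x^-1) else 0.

(** The exponential of 1 / h dominates the term of order n + 2 of its series. *)
Lemma flat_bound n (h : R) : `|flat n h| <= (n.+2)`!%:R * h ^+ 2.
Proof.
rewrite /flat; case: ltP => h0; last by rewrite normr0 mulr_ge0 ?sqr_ge0.
rewrite ger0_norm; last by rewrite mulr_ge0 ?expR_ge0// exprn_ge0// invr_ge0 ltW.
have t0 : 0 <= h^-1 by rewrite invr_ge0 ltW.
have := expR_ge1Dxn n.+1 t0 => le.
have {le} : h^-1 ^+ n.+2 * expR (- h^-1) <= (n.+2)`!%:R.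
  rewrite expRN ler_pdivrMr ?expR_gt0// mulrC -ler_pdivrMr ?ltr0n ?fact_gt0//.
  by apply: le_trans le; rewrite lerDr.
rewrite -(ler_pM2r (exprn_gt0 2 h0)); apply: le_trans.
rewrite le_eqVlt; apply/orP; left; apply/eqP.
rewrite -[n.+2]addn2 exprD; field; by rewrite gt_eqF.
Qed.

Lemma flat_derive1 n (x : R) :
  is_derive x 1 (flat n) (flat n.+2 x - n%:R * flat n.+1 x).
Proof.
have [x0|x0|->] := ltgtP x 0.
- have -> : flat n.+2 x - n%:R * flat n.+1 x = 0.
    by rewrite /flat ltNge (ltW x0)/= mulr0 subr0.
  have nr : \near x, (cst 0 : R -> R) x = flat n x.
    near=> y; rewrite /flat ifF//; apply/negbTE; rewrite -leNgt ltW//.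
    by near: y; exact: lt_nbhsl.
  apply: (near_eq_is_derive nr); exact: is_derive_cst.
- have nr : \near x, x^-1 ^+ n * expR (- x^-1) = flat n x.
    near=> y; rewrite /flat ifT//.
    by near: y; exact: lt_nbhsr.
  apply: (near_eq_is_derive nr).
  have xn0 : x != 0 by rewrite gt_eqF.
  have d1 : is_derive x 1 (fun y : R => y^-1) (- x ^- 2).
    split; first exact: (derivableV xn0 (@derivable_id _ _ x 1)).
    by rewrite (deriveV xn0 (@derivable_id _ _ x 1)) derive_id -[_ *: 1]/(_ * 1) mulr1.
  have d2 : is_derive x 1 (fun y : R => expR (- y^-1)) (expR (- x^-1) * x ^- 2).
    have := @is_derive1_comp R expR (fun y => - y^-1) x _ _ (is_derive_expR _) (is_deriveN d1).
    by rewrite opprK.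
  have dX := is_deriveX n d1.
  have fE : (fun y : R => y^-1 ^+ n) = ([eta GRing.inv] ^+ n).
    by apply/funext => y; elim: (n) => [//|m IH]; rewrite !exprS IH.
  rewrite -fE in dX; have d3 := is_deriveM dX d2.
  apply: (is_derive_eq d3).
  rewrite /flat ifT// ifT//= -![_ *: _]/(_ * _).
  rewrite -!exprVn; case: n {nr d3 dX fE} => [|n].
    by rewrite !expr0 !mul0r mulr0 addr0 mul1r subr0 mulrC.
  rewrite [n.+1.-1]/=.
  have -> : x^-1 ^+ n.+3 = x^-1 * (x^-1 * (x^-1 * x^-1 ^+ n)) by rewrite -!exprS.
  have -> : x^-1 ^+ n.+2 = x^-1 * (x^-1 * x^-1 ^+ n) by rewrite -!exprS.
  rewrite exprS expr2.
  move: (x^-1 ^+ n) (expR (- x^-1)) (n.+1%:R) => p e c.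
  by move: (x^-1) => t; ring.
- have := flat_derive (f := flat n) _ (@flat_bound n).
  by rewrite /flat ltxx mulr0 subr0; apply.
Unshelve. all: by end_near. Qed.

(** An algebra of functions stable under derivation, by [flat_derive1] for its
    generators; affine changes of variable localize them. *)
Inductive cutoff : (R -> R) -> Prop :=
| cutoff_flat n : cutoff (flat n)
| cutoff_cst c : cutoff (fun=> c)
| cutoff_add f g : cutoff f -> cutoff g -> cutoff (fun x => f x + g x)
| cutoff_mul f g : cutoff f -> cutoff g -> cutoff (fun x => f x * g x)
| cutoff_aff a b f : cutoff f -> cutoff (fun x => f (a * x + b)).

Lemma cutoff_smooth f : cutoff f -> smooth f.
Proof.
apply: smooth_stable => {}f hf.
suff [g hg dg] : exists2 g, cutoff g & forall x : R, is_derive x 1 f (g x).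
  split; first by move=> x; have [] := dg x.
  rewrite (_ : derive1 f = g)//; apply/funext => x.
  by rewrite derive1E; have [_ ->] := dg x.
elim: hf => [n|c|{}f g _ [f' hf' df] _ [g' hg' dg]|{}f g hf [f' hf' df] hg [g' hg' dg]|a b {}f _ [f' hf' df]].
- exists (fun x => flat n.+2 x + (- n%:R) * flat n.+1 x).
    by apply: cutoff_add; [exact: cutoff_flat|apply: cutoff_mul; [exact: cutoff_cst|exact: cutoff_flat]].
  by move=> x; have := flat_derive1 n x; rewrite mulNr.
- by exists (fun=> 0); [exact: cutoff_cst|move=> x; exact: is_derive_cst].
- by exists (fun x => f' x + g' x); [exact: cutoff_add|move=> x; exact: is_deriveD].
- exists (fun x => f x * g' x + g x * f' x).
    by apply: cutoff_add; exact: cutoff_mul.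
  by move=> x; apply: (is_derive_eq (is_deriveM (df x) (dg x))).
- exists (fun x => f' (a * x + b) * a).
    by apply: cutoff_mul; [exact: (cutoff_aff a b hf')|exact: cutoff_cst].
  move=> x; have d : is_derive x 1 (fun y : R => a * y + b) a.
    have := is_deriveD (is_deriveZ a (is_derive_id x 1)) (is_derive_cst b x 1).
    by rewrite addr0 -[a *: 1]/(a * 1) mulr1.
  exact: (@is_derive1_comp R f (fun y => a * y + b) x _ _ (df _) d).
Qed.

(** A smooth bump supported in [-1, 1]; the factors 1 and -1 keep it in [cutoff]. *)
Definition bell (x : R) : R := flat 0 (1 * x + 1) * flat 0 (-1 * x + 1).

Lemma flat0_ge0 x : 0 <= flat 0 x.
Proof. by rewrite /flat; case: ifP => // _; rewrite expr0 mul1r expR_ge0. Qed.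

Lemma flat0_le1 x : flat 0 x <= 1.
Proof.
rewrite /flat; case: ifP => // x0; rewrite expr0 mul1r -[leRHS]expR0 ler_expR.
by rewrite oppr_le0 invr_ge0 ltW.
Qed.

Lemma bell_smooth : smooth bell.
Proof.
apply: cutoff_smooth; apply: cutoff_mul; apply: (@cutoff_aff _ _ (flat 0)); exact: cutoff_flat.
Qed.

Lemma bell_ge0 x : 0 <= bell x.
Proof. by rewrite mulr_ge0 ?flat0_ge0. Qed.

Lemma bell_le1 x : bell x <= 1.
Proof. by rewrite -[leRHS]mulr1 ler_pM ?flat0_ge0 ?flat0_le1. Qed.

Lemma bell_out x : 1 <= `|x| -> bell x = 0.
Proof.
rewrite /bell /flat mul1r mulN1r ler_normr => /orP[h|h].
  by rewrite [X in _ * X]ifF ?mulr0//; apply/negbTE; rewrite -leNgt; lra.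
by rewrite ifF ?mul0r//; apply/negbTE; rewrite -leNgt; lra.
Qed.

End SmoothSteps.

(** * Weak derivatives and primitives *)

Section WeakDerivatives.
Context {R : realType}.
Local Notation mu := (@lebesgue_measure R).
Local Notation L1 f := (mu.-integrable setT (EFin \o f)).

Definition locL1 (v : R -> R) := measurable_fun setT v /\
  forall a b, mu.-integrable `[a, b] (EFin \o v).

Lemma locally_integrable_locL1 v : locally_integrable setT v -> locL1 v.
Proof.
move=> [mv _ h]; split=> // a b; apply/integrableP; split.
  by apply/measurable_EFinP; exact: measurable_funTS.
by apply: h => //; exact: segment_compact.
Qed.

Lemma locL1_continuous v : continuous v -> locL1 v.
Proof.
move=> cv; split; first exact: continuous_measurable_fun.
move=> a b; apply: continuous_compact_integrable; first exact: segment_compact.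
exact: continuous_subspaceT.
Qed.

Lemma locL1_locally_integrable v : locL1 v -> locally_integrable setT v.
Proof.
move=> [mv h]; split => //; first exact: openT.
move=> K _ cK.
have [M [_ hM]] := compact_bounded cK.
pose N := `|M| + 1.
have KN : K `<=` `[- N, N].
  move=> x Kx; rewrite /= in_itv/= -ler_norml; apply: hM => //.
  by rewrite /N (le_lt_trans (ler_norm M))// ltrDl.
have := h (- N) N => /integrableP[_]; apply: le_lt_trans.
apply: ge0_subset_integral => //.
- exact: compact_measurable.
- by apply/measurable_EFinP; apply: measurableT_comp => //; exact: measurable_funTS.
Qed.

Lemma locL1_sub (u v : R -> R) : locL1 u -> locL1 v -> locL1 (fun x => u x - v x).
Proof.
move=> [mu_ hu] [mv hv]; split; first exact: measurable_funB.
by move=> a b; have := integrableB (mcc a b) (hu a b) (hv a b).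
Qed.

Definition pint (v : R -> R) (x : R) : R :=
  if 0 <= x then \int[mu]_(y in `[0, x]) v y else - \int[mu]_(y in `[x, 0]) v y.

Lemma Prim_pint v : locL1 v -> Prim (pint v) v.
Proof.
move=> [mv hv]; split=> // a b ab; split; first exact: hv.
have cut x y z : x <= y -> y <= z -> \int[mu]_(t in `[x, z]) v t =
    \int[mu]_(t in `[x, y]) v t + \int[mu]_(t in `[y, z]) v t.
  move=> xy yz.
  have h := @Rintegral_itvB R v (BLeft x) (BRight z) y (hv x z).
  have e : \int[mu]_(t in `]y, z]) v t = \int[mu]_(t in `[y, z]) v t.
    apply: Rintegral_itv_obnd_cbnd; apply: integrableS (hv y z) => //.
    by move=> t /=; rewrite !in_itv/= => /andP[/ltW -> ->].
  by rewrite -e -h ?bnd_simp//; ring.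
rewrite /pint; case: (leP 0 b) => b0; case: (leP 0 a) => a0.
- by rewrite (cut 0 a b)//; ring.
- by rewrite opprK (cut a 0 b) ?(ltW a0)//; ring.
- by have := lt_le_trans b0 (le_trans a0 ab); rewrite ltxx.
- by rewrite (cut a b 0) ?(ltW b0)//; ring.
Qed.

Lemma Prim_is_derive u v (x : R) : Prim u v -> continuous v -> is_derive x 1 u (v x).
Proof.
move=> [mv uv] cv; pose a := x - 1; pose b := x + 1.
have ax : a < x by rewrite /a; lra.
have xb : x < b by rewrite /b; lra.
have [iab _] := uv a b (ltW (lt_trans ax xb)).
have [dF eF] := continuous_FTC1_closed xb iab ax (cv x).
pose F y := u a + \int[mu]_(t in `[a, y]) v t.
have nr : \near x, F x = u x.
  near=> y; have ay : a <= y by apply: ltW; near: y; exact: lt_nbhsr.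
  by rewrite /F; have [_ <-] := uv a y ay; rewrite addrC subrK.
apply: (near_eq_is_derive nr).
have dI : is_derive x 1 (fun y => \int[mu]_(t in `[a, y]) v t) (v x).
  by split=> //; rewrite -derive1E.
have := is_deriveD (is_derive_cst (u a) x 1) dI.
by rewrite add0r.
Unshelve. all: by end_near. Qed.

Lemma test_functionP (phi : R -> R) : test_function phi ->
  exists N M : R, [/\ 0 <= N, forall x, N < `|x| -> phi x = 0 /\ derive1 phi x = 0,
    forall x, `|phi x| <= M /\ `|derive1 phi x| <= M,
    continuous phi /\ continuous (derive1 phi) & Prim phi (derive1 phi)].
Proof.
move=> [sm cS].
have d0 x : derivable phi x 1 := sm 0%N x.
have d1 x : derivable (derive1 phi) x 1 := sm 1%N x.
have c0 : continuous phi by move=> x; apply/differentiable_continuous/derivable1_diffP.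
have c1 : continuous (derive1 phi) by move=> x; apply/differentiable_continuous/derivable1_diffP.
have [M0 [_ hM0]] := compact_bounded cS.
pose N := `|M0| + 1.
have out x : N < `|x| -> phi x = 0.
  move=> Nx; apply/eqP; apply: contraPT Nx => px.
  apply/negP; rewrite -leNgt; apply: hM0.
    by rewrite /N (le_lt_trans (ler_norm M0))// ltrDl.
  exact: subset_closure.
have out1 x : N < `|x| -> derive1 phi x = 0.
  move=> Nx; rewrite derive1E.
  have nr : \near x, (cst 0 : R -> R) x = phi x.
    exists (`|x| - N); first by rewrite /= subr_gt0.
    move=> y; rewrite /ball_/= => xy; rewrite out//.
    by have := lerB_dist x y; lra.
  by have [_ ->] := near_eq_is_derive nr (is_derive_cst 0 x 1).
have bd (f : R -> R) : continuous f -> (forall x, N < `|x| -> f x = 0) -> exists2 M, 0 <= M & forall x, `|f x| <= M.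
  move=> cf f0.
  have /compact_bounded[M [_ hM]] := continuous_compact (continuous_subspaceT cf) (@segment_compact _ (- N) N).
  exists (`|M| + 1); first by rewrite addr_ge0.
  move=> x; case: (leP `|x| N) => [xN|/f0 ->]; last by rewrite normr0 addr_ge0.
  apply: hM; first by rewrite (le_lt_trans (ler_norm M))// ltrDl.
  by exists x => //=; rewrite in_itv/= -ler_norml.
have [M1 M10 h1] := bd _ c0 out; have [M2 M20 h2] := bd _ c1 out1.
exists N, (M1 + M2); split.
- by rewrite addr_ge0.
- by move=> x Nx; rewrite out// out1.
- by move=> x; split; [rewrite (le_trans (h1 x))// lerDl|rewrite (le_trans (h2 x))// lerDr].
- by split.
- exact: Prim_C1.
Qed.

Lemma locL1_test (f m : R -> R) (N M : R) : locL1 f -> measurable_fun setT m ->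
  (forall x, `|m x| <= M) -> (forall x, N < `|x| -> m x = 0) ->
  L1 (fun x => f x * m x).
Proof.
move=> [mf hf] mm mM m0.
have h := L1_bounded mm mM ((L1_cut f (mcc (- N) N)).1 (hf (- N) N)).
apply: eq_integrable h => //= x _; congr EFin.
rewrite indicE mem_setE in_itv/= -ler_norml.
by case: (leP `|x| N) => [_|/m0 ->]; [rewrite mulr1 mulrC|rewrite mul0r mulr0].
Qed.

End WeakDerivatives.

Section DuBoisReymond.
Context {R : realType}.
Local Notation mu := (@lebesgue_measure R).
Local Notation L1 f := (mu.-integrable setT (EFin \o f)).

Let beta : R -> R := @bell R.

Lemma bell_continuous : continuous beta.
Proof.
move=> x; apply/differentiable_continuous/derivable1_diffP.
exact: (@bell_smooth R 0%N x).
Qed.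

Definition step : R -> R := pint beta.

Lemma Prim_step : Prim step beta.
Proof. by apply: Prim_pint; apply: locL1_continuous; exact: bell_continuous. Qed.

Lemma step_is_derive (x : R) : is_derive x 1 step (beta x).
Proof. exact: (Prim_is_derive x Prim_step bell_continuous). Qed.

Lemma step_eq (a b : R) : a <= b -> (forall x, a <= x -> x <= b -> 1 <= `|x|) ->
  step a = step b.
Proof.
move=> ab out; have [_ /(_ a b ab)[_ e]] := Prim_step.
have : \int[mu]_(x in `[a, b]) beta x = \int[mu]_(x in `[a, b]) (0 : R).
  apply: eq_Rintegral => x; rewrite inE/= in_itv/= => /andP[ax xb].
  exact: bell_out (out _ ax xb).
by rewrite Rintegral_cst// mul0r -e; lra.
Qed.

Lemma step_left x : x <= -1 -> step x = step (-1).
Proof.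
move=> x1; apply: step_eq => // y _ y1.
by rewrite ler_normr; apply/orP; right; lra.
Qed.

Lemma step_right x : 1 <= x -> step x = step 1.
Proof.
move=> x1; apply/esym; apply: step_eq => // y y1 _.
by rewrite ler_normr; apply/orP; left.
Qed.

Let c := step 1 - step (-1).

Lemma step_gt0 : 0 < c.
Proof.
have h0 : - 2^-1 <= 2^-1 :> R by lra.
have [_ P] := Prim_step.
have mono (a b : R) : a <= b -> step a <= step b.
  move=> ab; rewrite -subr_ge0; have [_ ->] := P a b ab.
  by apply: Rintegral_ge0 => x _; exact: bell_ge0.
have m1 : step (-1) <= step (- 2^-1) by apply: mono; lra.
have m2 : step (2^-1) <= step 1 by apply: mono; lra.
have [i e] := P _ _ h0.
pose d : R := expR (-2) * expR (-2).
have d0 : 0 < d by rewrite mulr_gt0 ?expR_gt0.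
have low : d <= step 2^-1 - step (- 2^-1).
  rewrite e; apply: (@le_trans _ _ (\int[mu]_(x in `[- 2^-1, 2^-1]) d)).
    rewrite Rintegral_cst//= lebesgue_measure_itv/= lte_fin ifT; last by lra.
    by rewrite -EFinB/= (_ : 2^-1 - - 2^-1 = 1 :> R) ?mulr1//; lra.
  apply: le_Rintegral => //.
    apply: continuous_compact_integrable; first exact: segment_compact.
    by apply: continuous_subspaceT; exact: cst_continuous.
  move=> x; rewrite /= in_itv/= => /andP[x1 x2].
  rewrite /d /beta /bell /flat !expr0 !mul1r mulN1r.
  have p1 : 2^-1 <= x + 1 by lra.
  have p2 : 2^-1 <= - x + 1 by lra.
  rewrite !ifT; [|lra|lra].
  have inv2 (t : R) : 2^-1 <= t -> t^-1 <= 2.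
    move=> t2; have t0 : 0 < t by lra.
    by rewrite -[t^-1]mul1r ler_pdivrMr//; lra.
  by rewrite ler_pM ?expR_ge0// ler_expR lerN2 inv2.
rewrite /c; lra.
Qed.

(** Its derivative is a bell of mass c around a minus a bell of mass c around b,
    where c is the total increment of [step]. *)
Definition plateau (a b e : R) (y : R) : R :=
  step (e^-1 * y + (- (e^-1 * a))) - step (e^-1 * y + (- (e^-1 * b))).

Lemma aff_is_derive (e a x : R) (f f' : R -> R) : (forall x : R, is_derive x 1 f (f' x)) ->
  is_derive x 1 (fun y => f (e * y + a)) (f' (e * x + a) * e).
Proof.
move=> df; have d : is_derive x 1 (fun y : R => e * y + a) e.
  have := is_deriveD (is_deriveZ e (is_derive_id x 1)) (is_derive_cst a x 1).
  by rewrite addr0 -[e *: 1]/(e * 1) mulr1.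
exact: (@is_derive1_comp R f (fun y => e * y + a) x _ _ (df _) d).
Qed.

Lemma plateau_derive1 a b e : derive1 (plateau a b e) =
  (fun y => beta (e^-1 * y + (- (e^-1 * a))) * e^-1 + -1 * (beta (e^-1 * y + (- (e^-1 * b))) * e^-1)).
Proof.
apply/funext => y; rewrite derive1E.
have d1 := aff_is_derive e^-1 (- (e^-1 * a)) y step_is_derive.
have d2 := aff_is_derive e^-1 (- (e^-1 * b)) y step_is_derive.
by have [_ ->] := is_deriveB d1 d2; rewrite mulN1r.
Qed.

Lemma plateau_test (a b e : R) : 0 < e -> test_function (plateau a b e).
Proof.
move=> e0; split.
  apply: smooth_derive1.
    move=> y.
    have d1 := aff_is_derive e^-1 (- (e^-1 * a)) y step_is_derive.
    have d2 := aff_is_derive e^-1 (- (e^-1 * b)) y step_is_derive.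
    by have [] := is_deriveB d1 d2.
  rewrite plateau_derive1; apply: cutoff_smooth.
  have cb : cutoff beta.
    by apply: cutoff_mul; apply: (@cutoff_aff _ _ _ (flat 0)); exact: cutoff_flat.
  apply: cutoff_add.
    by apply: cutoff_mul; [exact: (cutoff_aff _ _ cb)|exact: cutoff_cst].
  apply: cutoff_mul; first exact: cutoff_cst.
  by apply: cutoff_mul; [exact: (cutoff_aff _ _ cb)|exact: cutoff_cst].
pose M : R := `|a| + `|b| + e.
have sub : closure [set x | plateau a b e x != 0] `<=` `[- M, M].
  have cl : closed (`[- M, M]%classic : set R) by exact: interval_closed.
  rewrite [X in _ `<=` X](iffLR (closure_id _) cl); apply: closure_subset => y /=.
  apply: contraNT; rewrite /plateau in_itv/= negb_and -!ltNge => out.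
  have key (t : R) : `|t| <= `|a| + `|b| -> (e^-1 * y + - (e^-1 * t) <= -1 /\ y < 0) \/ (1 <= e^-1 * y + - (e^-1 * t) /\ 0 < y).
    move=> ht; rewrite -mulrBr -(mulrC (y - t)) ler_pdivrMr// ler_pdivlMr//.
    have := normr_ge0 a; have := normr_ge0 b; have := ler_norm t; have := ler_norm (- t); rewrite normrN.
    by case/orP: out; rewrite /M => ?; [left|right]; lra.
  have la : `|a| <= `|a| + `|b| by rewrite lerDl.
  have lb : `|b| <= `|a| + `|b| by rewrite lerDr.
  have [[ha ya]|[ha ya]] := key a la; have [[hb yb]|[hb yb]] := key b lb.
  - by rewrite (step_left ha) (step_left hb) subrr.
  - by have := lt_trans ya yb; rewrite ltxx.
  - by have := lt_trans ya yb; rewrite ltxx.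
  - by rewrite (step_right ha) (step_right hb) subrr.
by apply: subclosed_compact sub; [exact: closed_closure|exact: segment_compact].
Qed.

Let kern (a e y : R) := beta (e^-1 * y + (- (e^-1 * a))) * e^-1.

Let kern_out (a e y : R) : 0 < e -> e <= `|y - a| -> kern a e y = 0.
Proof.
move=> e0 ya; rewrite /kern /beta bell_out ?mul0r//.
by rewrite -mulrBr normrM gtr0_norm ?invr_gt0// -(mulrC `|_|) ler_pdivlMr// mul1r.
Qed.

Let kern_le (a e y : R) : 0 < e -> `|kern a e y| <= e^-1.
Proof.
move=> e0; rewrite /kern normrM (gtr0_norm (x := e^-1)) ?invr_gt0// ger0_norm ?bell_ge0//.
by rewrite ler_piMl ?bell_le1// invr_ge0 ltW.
Qed.

Let kern_continuous (a e : R) : continuous (kern a e).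
Proof.
have -> : kern a e = (fun y => e^-1 * beta (e^-1 * y + - (e^-1 * a))).
  by apply/funext => y; rewrite /kern mulrC.
move=> x; apply: (@continuousM _ R (fun=> e^-1) (fun y => beta (e^-1 * y - e^-1 * a)) x).
  exact: cst_continuous.
apply: (@continuous_comp _ _ _ (fun y => e^-1 * y + - (e^-1 * a)) beta); last exact: bell_continuous.
by apply: continuousD; [exact: mulrl_continuous|exact: cst_continuous].
Qed.

Let kern_int (a e : R) : 0 < e -> \int[mu]_y kern a e y = c.
Proof.
move=> e0.
have P : Prim (fun y => step (e^-1 * y + - (e^-1 * a))) (kern a e).
  apply: Prim_C1.
  - by move=> x; have [] := aff_is_derive e^-1 (- (e^-1 * a)) x step_is_derive.
  - by move=> x; rewrite derive1E; have [_ ->] := aff_is_derive e^-1 (- (e^-1 * a)) x step_is_derive.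
  - exact: kern_continuous.
have ae : a - e <= a + e by lra.
have [_ P2] := P; have [_ ] := P2 _ _ ae.
have -> : e^-1 * (a + e) + - (e^-1 * a) = 1 by field; rewrite gt_eqF.
have -> : e^-1 * (a - e) + - (e^-1 * a) = -1 by field; rewrite gt_eqF.
rewrite -/c => ->; rewrite [RHS]int_cut; apply: eq_Rintegral => y _.
rewrite indicE mem_setE in_itv/= -ler_distlC.
case: (leP `|a - y| e) => [|h]; first by rewrite mulr1.
by rewrite mulr0 kern_out// distrC ltW.
Qed.

(** The rescaled bells are bounded by 1 / e on intervals of length 2 e, so that
    they average z at a Lebesgue point as the intervals do. *)
Let kern_avg (z : R -> R) (a e : R) : locL1 z -> 0 < e ->
  (`|\int[mu]_y (z y * kern a e y) - c * z a|%:E <= 2%:E * davg z a e)%E.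
Proof.
move=> hz e0; have mz := hz.1.
have mk := continuous_measurable_fun (@kern_continuous a e).
have ok f : locL1 f -> L1 (fun y => f y * kern a e y).
  move=> hf; apply: (locL1_test (N := `|a| + e) (M := e^-1)) => //.
    by move=> y; exact: kern_le.
  move=> x xa; apply: kern_out => //; have := lerB_dist x a; lra.
have iz := ok z hz.
have ik : L1 (kern a e).
  have l1 : locL1 (fun=> 1 : R) by apply: locL1_continuous; exact: cst_continuous.
  have := ok _ l1; by apply: eq_integrable => //= y _; rewrite mul1r.
have ic := L1Z (z a) ik.
have -> : \int[mu]_y (z y * kern a e y) - c * z a = \int[mu]_y ((z y - z a) * kern a e y).
  rewrite -(kern_int a e0) mulrC -RintegralZl// -RintegralB//.
  by apply: eq_Rintegral => y _; rewrite mulrBl.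
have id : L1 (fun y => (z y - z a) * kern a e y).
  have := L1D iz (L1Z (-1) ic); apply: eq_integrable => //= y _; congr EFin; ring.
rewrite (EFin_normr_Rintegral measurableT id).
apply: (le_trans (le_abse_integral _ measurableT _)).
  by apply/measurable_EFinP; exact: L1_meas.
have mb : measurable (ball a e : set (measurableTypeR R)) by exact: measurable_ball.
rewrite /davg /iavg (lebesgue_measure_ball _ (ltW e0)).
have e2 : (0 < e *+ 2)%R by rewrite pmulrn_lgt0.
rewrite inver (gt_eqF e2).
have -> : (2%:E * ((e *+ 2)^-1%:E * \int[mu]_(y in ball a e) `|((center (z a) \o z) y)%:E|) =
   e^-1%:E * \int[mu]_(y in ball a e) `|((center (z a) \o z) y)%:E|)%E.
  by rewrite muleA -EFinM; congr (_%:E * _)%E; rewrite -mulr_natl; field; rewrite gt_eqF.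
have mm : measurable_fun setT (fun y => `|((z y - z a))%:E|%E).
  by apply: measurableT_comp => //; apply/measurable_EFinP; exact: measurable_funB.
rewrite -ge0_integralZl//; last 2 first.
- exact: measurable_funTS.
- by rewrite lee_fin invr_ge0 ltW.
rewrite [leRHS]integral_mkcond.
apply: ge0_le_integral => //.
- by apply: measurableT_comp => //; apply/measurable_EFinP; exact: L1_meas.
- apply: (measurable_restrictT (fun x => e^-1%:E * `|((center (z a) \o z) x)%:E|)%E mb).1.
  by apply: measurable_funeM; exact: measurable_funTS.
move=> y _; rewrite patchE; case: ifPn => yb.
  rewrite /= lee_fin normrM mulrC ler_wpM2r//; exact: kern_le.
rewrite /= kern_out ?mulr0 ?normr0//.
by move: yb; rewrite notin_setE /ball/= => /negP; rewrite -leNgt distrC.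
Qed.

Lemma ae_itv (P : R -> Prop) (a b : R) : a < b -> {ae mu, forall x, P x} ->
  exists2 x, a <= x <= b & P x.
Proof.
move=> ab [N [mN N0 sub]]; apply: contrapT => no.
have : (mu `[a, b] <= mu N)%E.
  apply: le_measure; rewrite ?inE//.
  move=> x; rewrite /= in_itv/= => xab; apply: sub => Px; apply: no.
  by exists x.
rewrite [X in (_ <= X)%E]N0 lebesgue_measure_itv/= lte_fin ab -EFinB lee_fin.
by rewrite subr_le0 leNgt ab.
Qed.

(** Testing against the plateau between two Lebesgue points compares the values of
    z at these points. *)
Lemma weak_zero_cst (z : R -> R) : locL1 z ->
  (forall phi, test_function phi -> \int[mu]_y (z y * derive1 phi y) = 0) ->
  exists k, {ae mu, forall y, z y = k}.
Proof.
move=> hz h0; have leb := lebesgue_differentiation (locL1_locally_integrable hz).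
have eqz a b : lebesgue_pt z a -> lebesgue_pt z b -> z a = z b.
  move=> la lb.
  have bound e : 0 < e -> ((c * `|z a - z b|)%:E <= 2%:E * davg z a e + 2%:E * davg z b e)%E.
    move=> e0; have := h0 _ (plateau_test a b e0); rewrite plateau_derive1.
    have ik (t : R) : L1 (fun y => z y * kern t e y).
      apply: (locL1_test (N := `|t| + e) (M := e^-1)) => //.
      - exact: (continuous_measurable_fun (@kern_continuous t e)).
      - by move=> y; exact: kern_le.
      - by move=> x xa; apply: kern_out => //; have := lerB_dist x t; lra.
    under eq_Rintegral => y _ do rewrite mulN1r mulrBr.
    have ka := ik a; have kb := ik b; rewrite /kern in ka kb.
    rewrite RintegralB// => /eqP; rewrite subr_eq0 => /eqP E.
    have ha := kern_avg a hz e0; have hb := kern_avg b hz e0.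
    apply: le_trans (leeD ha hb); rewrite -EFinD lee_fin.
    rewrite /kern in E ha hb *; rewrite E.
    rewrite -[X in X * `|_|](gtr0_norm step_gt0) -normrM mulrBr.
    set I := \int[mu]_y _; have -> : c * z a - c * z b = (I - c * z b) - (I - c * z a) by ring.
    by rewrite [leRHS]addrC ler_normB.
  have lim : (2%:E * davg z a e + 2%:E * davg z b e)%E @[e --> (0 : R)^'+] --> (0 : \bar R)%E.
    rewrite -[X in _ --> X](_ : 2%:E * 0 + 2%:E * 0 = 0)%E; last by rewrite mule0 adde0.
    by apply: cvgeD; [rewrite mule0|exact: cvgeZl|exact: cvgeZl].
  have : ((c * `|z a - z b|)%:E <= 0)%E.
    rewrite -(cvg_lim (@ereal_hausdorff R) lim); apply: lime_ge.
      by apply/cvg_ex; exists 0%E.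
    by near=> e; apply: bound; near: e; exact: nbhs_right_gt.
  rewrite lee_fin pmulr_rle0 ?step_gt0// normr_le0 subr_eq0 => /eqP.
  exact.
have [a la] : exists a, lebesgue_pt z a.
  by have [x _ lx] := ae_itv ltr01 leb; exists x.
by exists (z a); apply: (ae_imp leb) => y ly; exact: eqz.
Unshelve. all: by end_near. Qed.

(** The lemma of du Bois-Reymond: the difference of u and of a primitive of v has
    zero weak derivative. *)
Lemma weak_derivative_Prim (u v : R -> R) : weak_derivative u v ->
  exists2 u1, Prim u1 v & {ae mu, forall y, u y = u1 y}.
Proof.
move=> [/locally_integrable_locL1 lu /locally_integrable_locL1 lv h].
have P := Prim_pint lv.
have lP := locL1_continuous (Prim_continuous P).
have lz := locL1_sub lu lP.
have [k hk] : exists k, {ae mu, forall y, u y - pint v y = k}.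
  apply: weak_zero_cst => // phi tphi.
  have [N [M [N0 out bd [c0 c1] Pphi]]] := test_functionP tphi.
  have m0 := continuous_measurable_fun c0; have m1 := continuous_measurable_fun c1.
  have i0 f : locL1 f -> L1 (fun y => f y * phi y).
    move=> lf; apply: (locL1_test (N := N) (M := M)) => //.
      by move=> y; exact: (bd y).1.
    by move=> y /out[].
  have i1 f : locL1 f -> L1 (fun y => f y * derive1 phi y).
    move=> lf; apply: (locL1_test (N := N) (M := M)) => //.
      by move=> y; exact: (bd y).2.
    by move=> y /out[].
  under eq_Rintegral do rewrite mulrBl.
  rewrite RintegralB//; [|exact: i1|exact: i1].
  rewrite h//.
  have := Prim_int0 (Prim_mul P Pphi) (i0 _ lP) (L1D (i0 _ lv) (i1 _ lP)).
  rewrite RintegralD//; [lra|exact: i0|exact: i1].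
exists (fun y => pint v y + k).
  have := Prim_D P (Prim_cst k).
  by under [X in Prim _ X -> _]eq_fun do rewrite addr0.
by apply: (ae_imp hk) => y <-; rewrite addrC subrK.
Qed.

End DuBoisReymond.

(** * Bounded Lipschitz coefficients *)

Section LipschitzCoefficients.
Context {R : realType}.
Local Notation mu := (@lebesgue_measure R).
Local Notation L1 f := (mu.-integrable setT (EFin \o f)).

Lemma locL1_bounded (v : R -> R) (K : R) : measurable_fun setT v ->
  (forall x, `|v x| <= K) -> locL1 v.
Proof.
move=> mv vK; split=> // a b; apply: measurable_bounded_integrable.
- exact: mcc.
- by apply: compact_finite_measure; exact: segment_compact.
- exact: measurable_funTS.
- exists K; split; first exact: num_real.
  by move=> M KM x _ /=; rewrite (le_trans (vK x))// ltW.
Qed.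

Lemma Prim_ae (u v w : R -> R) : Prim u v -> measurable_fun setT w ->
  {ae mu, forall x, v x = w x} -> Prim u w.
Proof.
move=> [mv uv] mw vw; split=> // a b ab; have [i e] := uv a b ab.
have h : {ae mu, forall x, v x * \1_`[a, b] x = w x * \1_`[a, b] x}.
  by apply: (ae_imp vw) => x ->.
have mI : measurable_fun setT (\1_`[a, b] : R -> R) by apply: measurable_indic; exact: mcc.
have mwI : measurable_fun setT (fun x => w x * \1_`[a, b] x) by exact: measurable_funM.
have mvI : measurable_fun setT (fun x => v x * \1_`[a, b] x) by exact: measurable_funM.
have i1 := (L1_cut v (mcc a b)).1 i.
split; first by apply/(L1_cut w (mcc a b)); exact: (ae_L1 i1).
rewrite e !(int_cut `[a, b]); exact: eq_ae_Rintegral.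
Qed.

Lemma Prim_le (u v : R -> R) (K a b : R) : Prim u v -> (forall x, `|v x| <= K) ->
  a <= b -> `|u b - u a| <= K * (b - a).
Proof.
move=> [mv uv] vK ab; have [i ->] := uv a b ab.
apply: (le_trans (le_normr_Rintegral _ i)); first exact: mcc.
apply: (@le_trans _ _ (\int[mu]_(x in `[a, b]) K)).
  apply: le_Rintegral => //; first exact: integrable_norm.
  apply: continuous_compact_integrable; first exact: segment_compact.
  by apply: continuous_subspaceT; exact: cst_continuous.
rewrite Rintegral_cst//= lebesgue_measure_itv/= lte_fin.
move: ab; rewrite le_eqVlt => /predU1P[->|ab]; first by rewrite ltxx subrr !mulr0.
by rewrite ab -EFinB.
Qed.

Lemma Prim_nonincr (u v : R -> R) (a b : R) : Prim u v -> a <= b ->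
  (forall x, a <= x <= b -> v x <= 0) -> u b <= u a.
Proof.
move=> [mv uv] ab v0; have [int ] := uv a b ab; rewrite -subr_le0 => ->.
rewrite -[leRHS](_ : \int[mu]_(x in `[a, b]) (0 : R) = 0); last by rewrite Rintegral_cst// mul0r.
apply: le_Rintegral => //; exact: integrable0.
Qed.

(** Uniqueness for the linear equation e' = r e, by the exponential weights
    exp(-2Lx) to the right of the origin and exp(2Lx) to its left. *)
Lemma linear_unique (e r : R -> R) (L : R) : (forall x, `|r x| <= L) ->
  Prim e (fun x => r x * e x) -> e 0 = 0 -> forall x, e x = 0.
Proof.
move=> rL P e0 x.
have W (k : R) : Prim (fun x => e x * e x * expR (k * x))
    (fun x => (2 * r x + k) * (e x * e x) * expR (k * x)).
  have := Prim_mul (Prim_mul P P) (Prim_scale k (@is_derive_expR R) (@continuous_expR R)).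
  by congr Prim; apply/funext => y; ring.
have fin (k : R) : e x * e x * expR (k * x) <= 0 -> e x = 0.
  rewrite pmulr_lle0 ?expR_gt0// -expr2 => h.
  by apply/eqP; rewrite -sqrf_eq0 eq_le h sqr_ge0.
case: (leP 0 x) => x0.
  apply: (fin (- 2 * L)).
  have := Prim_nonincr (W (- 2 * L)) x0.
  rewrite e0 !mul0r; apply => y _.
  rewrite -mulrA mulr_le0_ge0//; last by rewrite mulr_ge0 ?expR_ge0// -expr2 sqr_ge0.
  by have := rL y; rewrite ler_norml => /andP[_ ?]; lra.
apply: (fin (2 * L)).
have P2 := Prim_Z (-1) (W (2 * L)).
have := Prim_nonincr P2 (ltW x0).
rewrite e0 !mul0r mulr0 => h.
suff : 0 <= -1 * (e x * e x * expR (2 * L * x)) by lra.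
apply: h => y _.
rewrite mulN1r oppr_le0 -mulrA mulr_ge0//; last by rewrite mulr_ge0 ?expR_ge0// -expr2 sqr_ge0.
by have := rL y; rewrite ler_norml => /andP[? _]; lra.
Qed.

(** Let q be the primitive of the expected derivative with the right value at the
    origin: g q - 1 solves a linear equation and vanishes at the origin. *)
Lemma Prim_recip (g g' : R -> R) (c K : R) : 0 < c -> (forall x, c <= g x) ->
  (forall x, `|g' x| <= K) -> Prim g g' ->
  Prim (fun x => (g x)^-1) (fun x => - (g' x * (g x)^-1 * (g x)^-1)).
Proof.
move=> c0 cg g'K P.
have gp x : 0 < g x := lt_le_trans c0 (cg x).
have gn x : g x != 0 by rewrite gt_eqF.
have mg := Prim_meas P; have mg' := P.1.
have K0 : 0 <= K := le_trans (normr_ge0 _) (g'K 0).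
have cig : continuous (fun x => (g x)^-1).
  by move=> x; apply: cvgV; [exact: gn|exact: (Prim_continuous P)].
have mi := continuous_measurable_fun cig.
have iK x : `|(g x)^-1| <= c^-1.
  by rewrite normfV gtr0_norm// lef_pV2 ?posrE.
pose r x := g' x * (g x)^-1.
have rK x : `|r x| <= K * c^-1 by rewrite normrM ler_pM.
pose q' x := - (r x * (g x)^-1).
have mq' : measurable_fun setT q'.
  by apply: measurableT_comp => //; apply: measurable_funM => //; exact: measurable_funM.
have lq : locL1 q'.
  apply: (@locL1_bounded _ (K * c^-1 * c^-1)) => // x.
  by rewrite normrN normrM ler_pM.
pose q x := pint q' x + (g 0)^-1 - pint q' 0.
have Pq : Prim q q'.
  have := Prim_D (Prim_D (Prim_pint lq) (Prim_cst (g 0)^-1)) (Prim_cst (- pint q' 0)).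
  by congr Prim; apply/funext => x; rewrite ?addr0.
have q0 : q 0 = (g 0)^-1 by rewrite /q addrAC subrr add0r.
pose e x := g x * q x - 1.
have Pe : Prim e (fun x => r x * e x).
  have := Prim_D (Prim_mul P Pq) (Prim_cst (- 1)).
  congr Prim; apply/funext => x; rewrite /q' /r /e; field; exact: gn.
have ex := linear_unique rK Pe _.
have qE : q = (fun x => (g x)^-1).
  apply/funext => x; apply: (mulfI (gn x)); rewrite mulfV//.
  by apply/eqP; rewrite -subr_eq0; apply/eqP; apply: ex; rewrite /e q0 mulfV ?subrr.
by rewrite -qE; exact: Pq.
Qed.

(** The precise representatives of a function of W^(n, oo) and of its derivatives:
    the bounds hold everywhere rather than almost everywhere. *)
Definition regular (n : nat) (K : R) (e : nat -> R -> R) :=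
  [/\ forall j, (j <= n)%N -> measurable_fun setT (e j),
      forall j x, (j <= n)%N -> `|e j x| <= K &
      forall j, (j < n)%N -> Prim (e j) (e j.+1)].

Lemma Lnormy_le (f : R -> R) (K : R) :
  (Lnorm mu +oo (EFin \o f) <= K%:E)%E -> {ae mu, forall x, `|f x| <= K}.
Proof.
rewrite unlock ifT; last first.
  apply: (@lt_le_trans _ _ (mu `[0, 1])); first by rewrite lebesgue_measure_itv/= lte_fin ltr01 -EFinB subr0 lte_fin ltr01.
  by apply: le_measure; rewrite ?inE//.
move=> /ess_supP h; apply: (ae_imp h) => x /=.
by rewrite lee_fin.
Qed.

Lemma continuous_ae_le (f : R -> R) (K : R) : continuous f ->
  {ae mu, forall x, f x <= K} -> forall x, f x <= K.
Proof.
move=> cf fK x; rewrite leNgt; apply/negP => Kx.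
have /= [e e0 he] := (cvgrPdist_lt _ _).1 (cf x) _ (eq_rect _ is_true Kx _ (esym (subr_gt0 _ _))).
have xe : x < x + e / 2 by rewrite ltrDl divr_gt0.
have [y /andP[xy ye] fy] := ae_itv xe fK.
have : `|x - y| < e.
  by rewrite ler0_norm ?subr_le0// opprB; lra.
by move=> /he; rewrite /= ltr_norml => /andP[_]; lra.
Qed.

(** The derivatives of order at most n have continuous representatives, which are
    bounded everywhere; the last one is truncated at K, which changes it on a
    null set. *)
Lemma regular_rep (n : nat) (K : R) (u : R -> R) (d : nat -> R -> R) :
  weak_derivatives n.+1 u d ->
  (forall j, (j <= n.+1)%N -> {ae mu, forall x, `|d j x| <= K}) -> 0 <= K ->
  exists2 e, regular n.+1 K e & {ae mu, forall x, u x = e 0%N x}.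
Proof.
move=> [d0 _ wd] dK K0.
have /choice[e0 he0] : forall j, exists u1, (j < n.+1)%N ->
    Prim u1 (d j.+1) /\ {ae mu, forall y, d j y = u1 y}.
  move=> j; case: (ltnP j n.+1) => jn; last by exists (fun=> 0).
  by have [u1 h1 h2] := weak_derivative_Prim (wd j jn); exists u1.
pose top x := Num.max (- K) (Num.min K (d n.+1 x)).
pose e j := if (j < n.+1)%N then e0 j else top.
have mtop : measurable_fun setT top.
  apply: measurable_maxr; first exact: measurable_cst.
  apply: measurable_minr; first exact: measurable_cst.
  by have [/locally_integrable_locL1 _ /locally_integrable_locL1[]] := wd n (leqnn _).
have eK j x : (j < n.+1)%N -> `|e0 j x| <= K.
  move=> jn; have [P ae] := he0 j jn; have cP := Prim_continuous P.
  have h : {ae mu, forall x, `|e0 j x| <= K}.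
    by apply: (ae_imp (ae_and ae (dK j (ltnW jn)))) => y [<-].
  apply: (@continuous_ae_le (fun x => `|e0 j x|)) => // y.
  exact: (cvg_norm (cP y)).
have de j : (j <= n.+1)%N -> {ae mu, forall x, d j x = e j x}.
  rewrite leq_eqVlt => /predU1P[->|jn].
    apply: (ae_imp (dK n.+1 (leqnn _))) => x; rewrite ler_norml => /andP[h1 h2].
    by rewrite /e ltnn /top (min_idPr h2) (max_idPr h1).
  by rewrite /e jn; have [_] := he0 j jn.
have me j : (j <= n.+1)%N -> measurable_fun setT (e j).
  rewrite leq_eqVlt /e => /predU1P[->|jn]; first by rewrite ltnn.
  by rewrite jn; have [P _] := he0 j jn; exact: Prim_meas P.
exists e; last by rewrite -d0; exact: de.
split=> //.
  move=> j x; rewrite leq_eqVlt /e => /predU1P[->|jn]; last by rewrite jn eK.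
  rewrite ltnn /top ler_norml le_max lexx/= ge_max ge_min lexx/= andbT.
  lra.
move=> j jn; have [P _] := he0 j jn.
have ej : e j = e0 j by rewrite /e jn.
by rewrite ej; apply: (Prim_ae P (me _ jn) (de _ jn)).
Qed.

End LipschitzCoefficients.

(** * The space of square integrable vectors *)

Section ResolventScalar.
Context {R : realType}.

Lemma L2N (f : R -> R) : L2 f -> L2 (fun x => - f x).
Proof. by move=> hf; have := L2Z (-1) hf; under [X in L2 X -> _]eq_fun do rewrite mulN1r. Qed.

Lemma resolvent_scalar (k : R) (w : R -> R) : k != 0 -> L2 w ->
  exists2 psi, L2 psi & Prim psi (fun x => k * (w x - psi x)).
Proof.
move=> kn hw; case: (ltP k 0) => k0.
  have k0' : 0 < - k by rewrite oppr_gt0.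
  have [psi h1 h2] := resolvent_neg k0' hw; exists psi => //.
  by move: h2; congr Prim; apply/funext => x; ring.
have {}k0 : 0 < k by rewrite lt0r kn.
have ia := @iso_opp R.
have [chi h1 h2] := resolvent_neg k0 (L2_iso ia hw).
exists (fun x => chi (- x)); first exact: (L2_iso ia h1).
have := Prim_opp h2; congr Prim; apply/funext => x /=.
by rewrite opprK; ring.
Qed.

End ResolventScalar.

Section Vectors.
Variables (R : realType) (I : finType).

Definition l2pred : pred (I -> R -> R) := fun f => `[< forall i, L2 (f i) >].

Lemma l2_submod : submod_closed l2pred.
Proof.
split; first by apply/asboolP => i; exact: L2_0.
move=> a u v /asboolP hu /asboolP hv; apply/asboolP => i; exact: L2_lin.
Qed.

HB.instance Definition _ :=
  GRing.isSubmodClosed.Build R (I -> R -> R) l2pred l2_submod.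

Record vec := Vec { vfun :> I -> R -> R; vec_mem : vfun \in l2pred }.

HB.instance Definition _ := [isSub for vfun].
HB.instance Definition _ := [Choice of vec by <:].
HB.instance Definition _ := [SubChoice_isSubLmodule of vec by <:].

Definition mkvec (f : I -> R -> R) (h : forall i, L2 (f i)) : vec :=
  Vec (introT (asboolP _) h).

Lemma vecL2 (u : vec) i : L2 (u i).
Proof. by case: u => f /= /asboolP. Qed.

Lemma vecP (u v : vec) : (forall i x, u i x = v i x) -> u = v.
Proof. by move=> h; apply/val_inj/funext => i; apply/funext => x; exact: h. Qed.

Lemma vecE (a : R) (u v : vec) i x : (a *: u + v) i x = a * u i x + v i x.
Proof. by []. Qed.

Lemma vecDE (u v : vec) i x : (u + v) i x = u i x + v i x.
Proof. by []. Qed.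

Lemma vecZE (a : R) (u : vec) i x : (a *: u) i x = a * u i x.
Proof. by []. Qed.

Lemma vecNE (u : vec) i x : (- u) i x = - u i x.
Proof. by []. Qed.

Definition ip (u v : vec) : R := \sum_i dot (u i) (v i).

Lemma ip_symE u v : ip u v = ip v u.
Proof. by apply: eq_bigr => i _; rewrite dotC. Qed.

Lemma ip_linE (a : R) u v w : ip (a *: u + v) w = a * ip u w + ip v w.
Proof.
rewrite /ip mulr_sumr -big_split/=; apply: eq_bigr => i _.
by rewrite -dot_lin//; exact: vecL2.
Qed.

Lemma ip_ge0E u : 0 <= ip u u.
Proof. by apply: sumr_ge0 => i _; exact: dot_ge0. Qed.

Lemma ip_ae (u u' v : vec) :
  (forall i, {ae @lebesgue_measure R, forall x, u i x = u' i x}) -> ip u v = ip u' v.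
Proof.
move=> h; apply: eq_bigr => i _; apply: dot_ae => //.
- exact: (vecL2 u i).1.
- exact: (vecL2 u' i).1.
- exact: (vecL2 v i).1.
Qed.

(** The graph of k^-1 times the weak derivative. *)
Definition der (k : R) (u du : vec) := forall i,
  exists2 u1, Prim u1 (fun x => k * du i x) &
  {ae @lebesgue_measure R, forall x, u i x = u1 x}.

End Vectors.
Arguments ip {R I}.
Arguments der {R I}.

Section ComplexVectors.
Variables (R : realType) (I0 : finType).
Let I := (I0 * bool)%type.
Notation V := (vec R I).
Local Notation mu := (@lebesgue_measure R).

(* (j, false) and (j, true) are the real and the imaginary part of the j-th
   component, and J is the multiplication by the imaginary unit *)
Let Jfun (u : V) (i : I) (x : R) : R :=
  if i.2 then u (i.1, false) x else - u (i.1, true) x.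

Let JfunL2 u i : L2 (Jfun u i).
Proof.
case: i => j [] /=; first exact: (vecL2 u (j, false)).
exact: (L2N (vecL2 u (j, true))).
Qed.

Definition Jv (u : V) : V := mkvec (JfunL2 u).

Lemma JvE u j b x : Jv u (j, b) x = if b then u (j, false) x else - u (j, true) x.
Proof. by []. Qed.

Lemma ip_pair (u v : V) : ip u v =
  \sum_j (dot (u (j, false)) (v (j, false)) + dot (u (j, true)) (v (j, true))).
Proof.
rewrite /ip (eq_bigr (fun p : I => dot (u (p.1, p.2)) (v (p.1, p.2)))); last by case.
rewrite -(pair_bigA _ (fun j b => dot (u (j, b)) (v (j, b))))/=.
by apply: eq_bigr => j _; rewrite big_bool/= addrC.
Qed.

Variable k : R.
Hypothesis kn : k != 0.

Lemma derP (u du : V) (f : I -> R -> R) : (forall i, Prim (f i) (fun x => k * du i x)) ->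
  (forall i, {ae mu, forall x, u i x = f i x}) -> der k u du.
Proof. by move=> h1 h2 i; exists (f i). Qed.

(** The multiplication by e^(- i k tau x) turns D_tau into d, and the resolvent of
    d acts on the real and the imaginary parts separately. *)
Lemma der_resolvent (sg tau : R) (u : V) : sg * sg = 1 -> exists a da,
  der k a da /\ a + sg *: (da - tau *: Jv a) = u.
Proof.
move=> sg2; pose w := k * tau.
have sgk : sg * k != 0.
  by rewrite mulf_neq0//; apply: contra_eq_neq sg2 => ->; rewrite mul0r eq_sym oner_neq0.
pose c x : R := cos (w * x); pose s x : R := sin (w * x).
have cs x : c x * c x + s x * s x = 1 by rewrite -!expr2 cos2Dsin2.
have cw : continuous ( *%R w : R -> R) by exact: mulrl_continuous.
have mc : measurable_fun setT c.
  apply: continuous_measurable_fun => x; apply: continuous_comp; first exact: cw.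
  exact: continuous_cos.
have ms : measurable_fun setT s.
  apply: continuous_measurable_fun => x; apply: continuous_comp; first exact: cw.
  exact: continuous_sin.
have c1 x : `|c x| <= 1.
  by rewrite ler_norml cos_geN1 cos_le1.
have s1 x : `|s x| <= 1 by rewrite ler_norml sin_geN1 sin_le1.
have Lc f : L2 f -> L2 (fun x => c x * f x) by move=> hf; exact: (L2_bounded mc c1 hf).1.
have Ls f : L2 f -> L2 (fun x => s x * f x) by move=> hf; exact: (L2_bounded ms s1 hf).1.
have Pc : Prim c (fun x => w * - s x).
  apply: (Prim_scale w (@is_derive_cos R)).
  by move=> x; apply: (@continuousN _ R^o); exact: continuous_sin.
have Ps : Prim s (fun x => w * c x).
  by apply: (Prim_scale w (@is_derive_sin R)); exact: continuous_cos.
have /choice[psi hpsi] : forall j, exists p : (R -> R) * (R -> R), [/\ L2 p.1, L2 p.2,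
    Prim p.1 (fun x => sg * k * (c x * u (j, false) x + s x * u (j, true) x - p.1 x)) &
    Prim p.2 (fun x => sg * k * (c x * u (j, true) x - s x * u (j, false) x - p.2 x))].
  move=> j; have h1 := vecL2 u (j, false); have h2 := vecL2 u (j, true).
  have [p1 q1 r1] := resolvent_scalar sgk (L2D (Lc _ h1) (Ls _ h2)).
  have [p2 q2 r2] := resolvent_scalar sgk (L2D (Lc _ h2) (L2N (Ls _ h1))).
  by exists (p1, p2); split.
pose af (i : I) x : R := let p := psi i.1 in
  if i.2 then s x * p.1 x + c x * p.2 x else c x * p.1 x + - (s x * p.2 x).
have aL i : L2 (af i).
  have [l1 l2 _ _] := hpsi i.1; rewrite /af; case: (i.2).
    by apply: L2D; [exact: Ls|exact: Lc].
  by apply: L2D; [exact: Lc|apply: L2N; exact: Ls].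
pose a : V := mkvec aL.
pose da : V := sg *: (u - a) + tau *: Jv a.
exists a, da; split; last first.
  by rewrite /da addrK scalerA sg2 scale1r addrC subrK.
apply: (@derP a da af); last by move=> i; exact: ae_all.
move=> [j b]; have [l1 l2 r1 r2] := hpsi j.
case: b.
  have := Prim_D (Prim_mul Ps r1) (Prim_mul Pc r2).
  congr Prim; apply/funext => x.
  rewrite !(vecDE, vecZE, vecNE) JvE /= /af/= /w.
  have := cs x; move: (c x) (s x) => C S CS.
  transitivity (k * tau * (C * (psi j).1 x - S * (psi j).2 x) + k * sg *
     ((C * C + S * S) * u (j, true) x - (S * (psi j).1 x + C * (psi j).2 x))); first by ring.
  by rewrite CS; ring.
have := Prim_D (Prim_mul Pc r1) (Prim_Z (-1) (Prim_mul Ps r2)).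
congr Prim; apply/funext => x; first by rewrite /af/= mulN1r.
rewrite !(vecDE, vecZE, vecNE) JvE /= /af/= /w.
have := cs x; move: (c x) (s x) => C S CS.
transitivity (- k * tau * (S * (psi j).1 x + C * (psi j).2 x) + k * sg *
     ((C * C + S * S) * u (j, false) x - (C * (psi j).1 x - S * (psi j).2 x))); first by ring.
by rewrite CS; ring.
Qed.

Theorem vec_frame : skew_frame ip Jv (der k).
Proof.
split.
- exact: ip_symE.
- exact: ip_linE.
- exact: ip_ge0E.
- move=> a u v; apply: vecP => -[j b] x; rewrite vecE !JvE !vecE.
  by case: b => //; ring.
- move=> u; apply: vecP => -[j b] x; rewrite vecNE !JvE.
  by case: b.
- move=> u v; rewrite !ip_pair; apply: eq_bigr => j _; rewrite addrC; congr (_ + _).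
  by apply: eq_Rintegral => x _; rewrite !JvE mulrNN.
- move=> a u du v dv hu hv i.
  have [u1 p1 e1] := hu i; have [v1 p2 e2] := hv i.
  exists (fun x => a * u1 x + v1 x).
    by have := Prim_lin a p1 p2; congr Prim; apply/funext => x; rewrite vecE; ring.
  by apply: (ae_imp (ae_and e1 e2)) => x [h1 h2]; rewrite vecE h1 h2.
- move=> u du hu [j b]; case: b.
    exact: (hu (j, false)).
  have [u1 p1 e1] := hu (j, true); exists (fun x => - u1 x).
    have := Prim_Z (-1) p1; congr Prim; apply/funext => x; rewrite ?mulN1r// JvE; ring.
  by apply: (ae_imp e1) => x h; rewrite JvE h.
- move=> u du v dv hu hv; rewrite /ip -sumrN; apply: eq_bigr => i _.
  have [u1 p1 e1] := hu i; have [v1 p2 e2] := hv i.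
  have Lu1 := ae_L2 (vecL2 u i) (Prim_meas p1) e1.
  have Lv1 := ae_L2 (vecL2 v i) (Prim_meas p2) e2.
  have L2u := L2Z k (vecL2 du i); have L2v := L2Z k (vecL2 dv i).
  have := L2_skew p1 p2 Lu1 L2u Lv1 L2v.
  have dZ f g : L2 f -> L2 g -> dot (fun x => k * f x) g = k * dot f g.
    move=> hf hg; have := dot_lin k hf (@L2_0 R) hg.
    under [X in dot X g = _ -> _]eq_fun do rewrite addr0.
    move=> ->; rewrite /dot; under [X in _ + X]eq_Rintegral do rewrite mul0r.
    by rewrite Rintegral_cst// mul0r addr0.
  rewrite dZ//; last exact: vecL2.
  rewrite (dotC u1) dZ//; last exact: vecL2.
  rewrite -mulrN => /(mulfI kn).
  have sw f g g1 : L2 f -> L2 g -> L2 g1 -> {ae mu, forall x, g x = g1 x} -> dot f g1 = dot f g.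
    by move=> [mf _] [mg _] [mg1 _] e; rewrite !(dotC f); apply/esym/dot_ae.
  rewrite (sw _ _ _ _ _ _ e2)//; [|exact: vecL2|exact: vecL2].
  by rewrite (sw _ _ _ _ _ _ e1)//; [rewrite (dotC (dv i))|exact: vecL2|exact: vecL2].
- move=> tau u; have [a [da [h1 h2]]] := @der_resolvent 1 tau u (mulr1 1).
  by exists a, da; split=> //; rewrite -h2 scale1r.
- move=> tau u; have [|a [da [h1 h2]]] := @der_resolvent (-1) tau u; first by rewrite mulrNN mulr1.
  by exists a, da; split=> //; rewrite -h2 scaleN1r.
Qed.

End ComplexVectors.

(** * Stability under an elliptic law *)

Section EllipticStability.
Variables (R : realType) (V : lmodType R).

(** The frame of the reversed time: D_(-tau) = d - tau (- J). *)
Lemma skew_frame_opp (ip : V -> V -> R) (J : V -> V) (der : V -> V -> Prop) :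
  skew_frame ip J der -> skew_frame ip (fun u => - J u) der.
Proof.
move=> F.
have dN u du : der u du -> der (- u) (- du).
  move=> h; have d0 : der 0 0 by have := der_lin F (-1) h h; rewrite !scaleN1r !addNr.
  by have := der_lin F (-1) h d0; rewrite !scaleN1r !addr0.
have oe (tau : R) x : tau *: (- J x) = (- tau) *: J x by rewrite scalerN scaleNr.
split.
- exact: ip_sym F.
- exact: ip_lin F.
- exact: ip_ge0 F.
- by move=> a u v; rewrite (J_lin F) opprD scalerN.
- by move=> u; rewrite (JN F) opprK (J_inv F).
- move=> u v.
  by rewrite (form_Nl (ip_lin F)) (form_Nr (ip_sym F) (ip_lin F)) opprK (J_iso F).
- exact: der_lin F.
- by move=> u du h; apply/dN/(der_J F).
- exact: der_skew F.
- move=> tau u; have [a [da [h1 h2]]] := der_resp F (- tau) u.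
  by exists a, da; split => //; rewrite oe.
- move=> tau u; have [a [da [h1 h2]]] := der_resm F (- tau) u.
  by exists a, da; split => //; rewrite oe.
Qed.

Variables (ip : V -> V -> R) (J : V -> V) (der : V -> V -> Prop).
Hypothesis F : skew_frame ip J der.

Lemma multiplier_opp A A' K :
  multiplier ip J der A A' K -> multiplier ip (fun u => - J u) der A A' K.
Proof.
move=> h; split; [exact: mult_lin h| |exact: mult_der h|exact: mult_bound h|exact: mult_bound' h].
by move=> u; rewrite (multN _ h) (mult_J h).
Qed.

Lemma multiplier_J A A' K : multiplier ip J der A A' K ->
  multiplier ip J der (fun u => J (A u)) (fun u => J (A' u)) K.
Proof.
move=> h; split.
- by move=> a u v; rewrite (mult_lin h) (J_lin F).
- by move=> u; rewrite (mult_J h).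
- by move=> u du hu; rewrite -(JD F); apply/(der_J F)/(mult_der h).
- by move=> u; rewrite (J_iso F); exact: (mult_bound h u).
- by move=> u; rewrite (J_iso F); exact: (mult_bound' h u).
Qed.

(** The equation (G D_t)^2 Psi - Psi = W, where v1 stands for G D_t Psi. *)
Definition elliptic_at (G : V -> V) (t : R) (W Psi : V) := exists dPsi v1 dv1,
  [/\ der Psi dPsi, der v1 dv1,
      forall z, ip v1 z = ip (G (dPsi - t *: J Psi)) z &
      forall z, ip (G (dv1 - t *: J v1)) z - ip Psi z = ip W z].

(** The elliptic estimate bounds Psi and D_t Psi by the resolvent of w, so that
    A Psi is a forcing to which the uniform stability applies. *)
Theorem elliptic_stability (c C nu M : R) (G Q Q' P P' A A' : V -> V)
    (w Psi : R -> V) :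
  0 < c -> 0 < C -> 0 <= nu -> 8 * C * nu <= c ^+ 2 ->
  0 <= M -> 192 ^+ 2 * (12 * M * (48 * C / c ^+ 2)) <= 1 ->
  (forall x, c * ip x x <= ip (G x) x) ->
  (forall x, ip (G x) (G x) <= C * ip x x) ->
  (forall x y, ip (G y) (Q x) = ip y x + ip y (P x)) ->
  (forall x, c * ip x x <= ip x (Q x)) ->
  multiplier ip J der Q Q' C -> multiplier ip J der P P' nu ->
  multiplier ip J der A A' M ->
  (forall t, 0 <= t -> elliptic_at G t (w t) (Psi t)) ->
  (forall t, 0 <= t -> tder ip w (A (Psi t)) t) ->
  forall t, 0 <= t -> ip (w t) (w t) <= 2 * ip (w 0) (w 0).
Proof.
move=> c0 C0 nu0 small M0 Msmall Gc Gb GQ Qc hQ hP hA ell dw.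
apply: (uniform_stability F dw) => j t psi jt tj rpsi.
have t0 : 0 <= t by rewrite (le_trans _ jt)// ler0n.
have [dPsi [v1 [dv1 [d1 d2 e1 e2]]]] := ell t t0.
have tt : `|t - j%:R| <= 1.
  by rewrite ger0_norm ?subr_ge0// lerBlDl.
have S := elliptic_bound F c0 C0 nu0 small tt Gc Gb GQ Qc hQ hP d1 d2 e1 e2 rpsi.
exists (A dPsi + A' (Psi t)), (A (Psi t) - (A dPsi + A' (Psi t) - j%:R *: J (A (Psi t)))).
have eh z : ip (A (Psi t)) z - (ip (A dPsi + A' (Psi t)) z - j%:R * ip (J (A (Psi t))) z) =
    ip (A (Psi t) - (A dPsi + A' (Psi t) - j%:R *: J (A (Psi t)))) z.
  by rewrite !(form_Dl (ip_lin F), form_Nl (ip_lin F), form_Zl (ip_lin F)); ring.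
split=> //; first exact: (mult_der hA d1).
have hb := mult_graph F hA M0 tt d1 eh.
have M12 : 0 <= 12 * M by rewrite mulr_ge0.
have {}hb := le_trans hb (ler_wpM2l M12 S).
apply: (le_trans (ler_wpM2l _ hb)); first by rewrite exprn_ge0.
by rewrite !mulrA -[leRHS]mul1r ler_wpM2r ?(ip_ge0 F)// -!mulrA; rewrite -!mulrA in Msmall.
Qed.

End EllipticStability.

Section TwoSided.
Variables (R : realType) (V : lmodType R).
Variables (ip : V -> V -> R) (J : V -> V) (der : V -> V -> Prop).
Hypothesis F : skew_frame ip J der.

Lemma tder_opp (w : R -> V) v t : tder ip w v (- t) -> tder ip (fun s => w (- s)) (- v) t.
Proof.
rewrite /tder => h.
have hN : (fun x : R => - x) @ 0^' --> (0 : R)^'.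
  have h0 : (fun x : R => - x) @ 0^' --> (0 : R).
    rewrite -[X in _ --> X]oppr0; apply: cvg_within_filter.
    by apply: (@continuousN _ R^o) => //; exact: cvg_id.
  move=> A [e e0 hA]; exists e => // x /= hx x0; apply: hA; last by rewrite oppr_eq0.
  by move: hx; rewrite /= !sub0r opprK normrN.
have := cvg_comp _ _ hN h.
apply: cvg_trans; apply: near_eq_cvg; apply: nearW => x /=.
have -> : (- x)^-1 *: (w (- t - x) - w (- t)) - v = - (x^-1 *: (w (- (t + x)) - w (- t)) - - v).
  by rewrite invrN scaleNr (opprD t x) opprK opprD.
by rewrite (form_Nl (ip_lin F)) (form_Nr (ip_sym F) (ip_lin F)) opprK.
Qed.

(** Negative times are positive times for the frame with - J. *)
Theorem elliptic_stability2 (c C nu M : R) (G Q Q' P P' A A' : V -> V)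
    (w Psi : R -> V) :
  0 < c -> 0 < C -> 0 <= nu -> 8 * C * nu <= c ^+ 2 ->
  0 <= M -> 192 ^+ 2 * (12 * M * (48 * C / c ^+ 2)) <= 1 ->
  (forall x, c * ip x x <= ip (G x) x) ->
  (forall x, ip (G x) (G x) <= C * ip x x) ->
  (forall x y, ip (G y) (Q x) = ip y x + ip y (P x)) ->
  (forall x, c * ip x x <= ip x (Q x)) ->
  multiplier ip J der Q Q' C -> multiplier ip J der P P' nu ->
  multiplier ip J der A A' M ->
  (forall t, elliptic_at ip J der G t (w t) (Psi t)) ->
  (forall t, tder ip w (J (A (Psi t))) t) ->
  forall t, ip (w t) (w t) <= 2 * ip (w 0) (w 0).
Proof.
move=> c0 C0 nu0 small M0 Ms Gc Gb GQ Qc hQ hP hA ell dw t.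
case: (leP 0 t) => t0.
  exact: (elliptic_stability F c0 C0 nu0 small M0 Ms Gc Gb GQ Qc hQ hP
    (multiplier_J F hA) (fun t _ => ell t) (fun t _ => dw t) t0).
have t0' : 0 <= - t by rewrite oppr_ge0 ltW.
pose FN := skew_frame_opp F.
have := @elliptic_stability _ _ _ _ _ FN c C nu M G Q Q' P P' _ _ (fun s => w (- s))
  (fun s => Psi (- s)) c0 C0 nu0 small M0 Ms Gc Gb GQ Qc (multiplier_opp hQ) (multiplier_opp hP)
  (multiplier_J FN (multiplier_opp hA)).
move/(_ _ _ (- t) t0'); rewrite opprK oppr0; apply => s s0.
  have [dPsi [v1 [dv1 [d1 d2 e1 e2]]]] := ell (- s).
  by exists dPsi, v1, dv1; split => // z; rewrite scalerN -scaleNr.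
by apply: tder_opp; exact: dw.
Qed.

End TwoSided.

(** * Matrix multipliers *)

Section Sums.
Context {R : realType}.

Lemma L2_sum (I : Type) (r : seq I) (f : I -> R -> R) : (forall i, L2 (f i)) ->
  L2 (fun x => \sum_(i <- r) f i x).
Proof.
move=> h; elim: r => [|i r ih].
  by under eq_fun do rewrite big_nil; exact: L2_0.
by under eq_fun do rewrite big_cons; exact: L2D.
Qed.

Lemma dot_suml (I : Type) (r : seq I) (f : I -> R -> R) (g : R -> R) :
  (forall i, L2 (f i)) -> L2 g ->
  dot (fun x => \sum_(i <- r) f i x) g = \sum_(i <- r) dot (f i) g.
Proof.
move=> h hg; elim: r => [|i r ih].
  under [X in dot X]eq_fun do rewrite big_nil.
  rewrite big_nil /dot; under eq_Rintegral do rewrite mul0r.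
  by rewrite Rintegral_cst// mul0r.
under [X in dot X]eq_fun do rewrite big_cons -[X in X + _]mul1r.
by rewrite dot_lin//; [rewrite ih big_cons mul1r|exact: L2_sum].
Qed.

Lemma dot_sum_le (I : finType) (f : I -> R -> R) : (forall i, L2 (f i)) ->
  dot (fun x => \sum_i f i x) (fun x => \sum_i f i x) <= #|I|%:R * \sum_i dot (f i) (f i).
Proof.
move=> h; have hs := L2_sum (index_enum I) h.
rewrite dot_suml//; under eq_bigr do rewrite dotC dot_suml//.
apply: (@le_trans _ _ (\sum_i \sum_j (2^-1 * dot (f i) (f i) + 2^-1 * dot (f j) (f j)))).
  apply: ler_sum => i _; apply: ler_sum => j _.
  have := dot_young (ltr01 : (0 : R) < 1) (h j) (h i); rewrite invr1 !mul1r.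
  by have := ler_norm (dot (f j) (f i)); lra.
under eq_bigr do rewrite big_split/=.
rewrite big_split/= [X in _ + X]exchange_big/= -big_split/=.
rewrite mulr_sumr; apply: ler_sum => i _.
rewrite !sumr_const -mulrnDl -(mulr_natl (_ + _)) ler_wpM2l ?ler0n//; lra.
Qed.

Lemma Prim_sum (I : Type) (r : seq I) (u v : I -> R -> R) : (forall i, Prim (u i) (v i)) ->
  Prim (fun x => \sum_(i <- r) u i x) (fun x => \sum_(i <- r) v i x).
Proof.
move=> h; elim: r => [|i r ih].
  rewrite (_ : (fun x => _) = fun=> 0); last by apply/funext => x; rewrite big_nil.
  rewrite [X in Prim _ X](_ : _ = fun=> 0); last by apply/funext => x; rewrite big_nil.
  exact: Prim_cst.
have := Prim_D (h i) ih.
by congr Prim; apply/funext => x; rewrite big_cons.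
Qed.

End Sums.

Lemma ae_fin {R : realType} (I : finType) (P : I -> R -> Prop) :
  (forall i, {ae @lebesgue_measure R, forall x, P i x}) ->
  {ae @lebesgue_measure R, forall x, forall i, P i x}.
Proof.
move=> h; suff H (r : seq I) : {ae @lebesgue_measure R, forall x, forall i, i \in r -> P i x}.
  by apply: (ae_imp (H (index_enum I))) => x hx i; apply: hx; rewrite mem_index_enum.
elim: r => [|i r ih]; first exact: ae_all.
apply: (ae_imp (ae_and (h i) ih)) => x [h1 h2] j; rewrite inE => /orP[/eqP->//|]; exact: h2.
Qed.

Section MatrixMultipliers.
Variables (R : realType) (I0 : finType).
Notation I := (I0 * bool)%type.
Notation V := (vec R I).
Local Notation mu := (@lebesgue_measure R).
Local Notation n := (#|I0|%:R : R).

Definition bounded_matrix (B : R) (M : I0 -> I0 -> R -> R) :=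
  forall j i, measurable_fun setT (M j i) /\ forall x, `|M j i x| <= B.

Section Mulmat.
Variables (B : R) (M : I0 -> I0 -> R -> R).
Hypothesis hM : bounded_matrix B M.

(** A real matrix acts on the real and the imaginary parts alike, hence commutes
    with J. *)
Definition mulfun (u : V) (p : I) (x : R) := \sum_i M p.1 i x * u (i, p.2) x.

Lemma mulfunL2 u p : L2 (mulfun u p).
Proof.
apply: L2_sum => i; have [h1 h2] := hM p.1 i.
by have [] := L2_bounded h1 h2 (vecL2 u (i, p.2)).
Qed.

Definition mulmat (u : V) : V := mkvec (mulfunL2 u).

Lemma mulmatE u j b x : mulmat u (j, b) x = \sum_i M j i x * u (i, b) x.
Proof. by []. Qed.

Lemma mulmat_lin (a : R) u v : mulmat (a *: u + v) = a *: mulmat u + mulmat v.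
Proof.
apply: vecP => -[j b] x; rewrite vecE !mulmatE mulr_sumr -big_split/=.
apply: eq_bigr => i _.
transitivity (M j i x * (a * u (i, b) x + v (i, b) x)); [by []|by ring].
Qed.

Lemma mulmat_J u : mulmat (Jv u) = Jv (mulmat u).
Proof.
apply: vecP => -[j b] x; rewrite JvE !mulmatE; case: b => //.
by rewrite -sumrN; apply: eq_bigr => i _; rewrite JvE mulrN.
Qed.

Lemma mulmat_dot u v : ip (mulmat u) v =
  \sum_(b : bool) \sum_j \sum_i dot (fun x => M j i x * u (i, b) x) (v (j, b)).
Proof.
rewrite exchange_big/= /ip (eq_bigr (fun p : I => dot (mulmat u (p.1, p.2)) (v (p.1, p.2)))); last by case.
rewrite -(pair_bigA _ (fun j b => dot (mulmat u (j, b)) (v (j, b))))/=.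
apply: eq_bigr => j _; apply: eq_bigr => b _; rewrite dot_suml//; last exact: vecL2.
move=> i; have [h1 h2] := hM j i.
by have [] := L2_bounded h1 h2 (vecL2 u (i, b)).
Qed.

Lemma mulmat_le u : ip (mulmat u) (mulmat u) <= (n * B) ^+ 2 * ip u u.
Proof.
have E (w : V) : ip w w = \sum_j \sum_(b : bool) dot (w (j, b)) (w (j, b)).
  rewrite /ip (eq_bigr (fun p : I => dot (w (p.1, p.2)) (w (p.1, p.2)))); last by case.
  by rewrite -(pair_bigA _ (fun j b => dot (w (j, b)) (w (j, b)))).
rewrite E (E u).
have n0 : 0 <= n by rewrite ler0n.
apply: (@le_trans _ _ (\sum_(j : I0) \sum_(b : bool) n * (B ^+ 2 * \sum_i dot (u (i, b)) (u (i, b))))).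
  apply: ler_sum => j _; apply: ler_sum => b _.
  have h i := L2_bounded (hM j i).1 (hM j i).2 (vecL2 u (i, b)).
  apply: (le_trans (dot_sum_le (fun i => (h i).1))).
  rewrite ler_wpM2l// mulr_sumr; apply: ler_sum => i _; exact: (h i).2.
rewrite sumr_const; under eq_bigr do rewrite mulrA.
rewrite -mulr_sumr exchange_big/= -[leLHS]mulr_natl.
by rewrite exprMn (expr2 n) -!mulrA.
Qed.

End Mulmat.

Lemma mulmat_adj B B' M M' (hM : bounded_matrix B M) (hM' : bounded_matrix B' M') u v :
  (forall j i x, M' i j x = M j i x) -> ip (mulmat hM u) v = ip u (mulmat hM' v).
Proof.
move=> E; rewrite ip_symE [RHS]ip_symE ip_symE !mulmat_dot.
apply: eq_bigr => b _; rewrite exchange_big/=; apply: eq_bigr => i _; apply: eq_bigr => j _.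
by apply: eq_Rintegral => x _; rewrite E; ring.
Qed.

(** N is the derivative of M divided by k, as in [der]. *)
Lemma matrix_multiplier k B M N (hM : bounded_matrix B M) (hN : bounded_matrix B N) :
  (forall j i, Prim (M j i) (fun x => k * N j i x)) ->
  multiplier ip (@Jv R I0) (der k) (mulmat hM) (mulmat hN) ((n * B) ^+ 2).
Proof.
move=> hP; split.
- exact: mulmat_lin.
- exact: mulmat_J.
- move=> u du hu [j b].
  have /choice[u1 hu1] i : exists u1 : R -> R, Prim u1 (fun x => k * du (i, b) x) /\
      {ae mu, forall x, u (i, b) x = u1 x}.
    by have [u1 h1 h2] := hu (i, b); exists u1.
  exists (fun x => \sum_i M j i x * u1 i x); last first.
    apply: (ae_imp (ae_fin (fun i => (hu1 i).2))) => x hx.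
    by rewrite mulmatE; apply: eq_bigr => i _; rewrite hx.
  have P0 := Prim_sum (index_enum I0) (fun i => Prim_mul (hP j i) (hu1 i).1).
  have mN i := (hN j i).1; have mM i := (hM j i).1.
  apply: (Prim_ae P0).
    by apply: measurable_funM => //; exact: (vecL2 (mulmat hM du + mulmat hN u) (j, b)).1.
  apply: (ae_imp (ae_fin (fun i => (hu1 i).2))) => x hx.
  rewrite vecDE !mulmatE -big_split/= mulr_sumr; apply: eq_bigr => i _.
  by rewrite hx; ring.
- exact: mulmat_le.
- exact: mulmat_le.
Qed.

End MatrixMultipliers.

(** * Differences and their Leibniz rule *)

Section Differences.
Context {R : realType}.
Variables (a h : R).

(** Used with a = dl / h, this is dl times a difference quotient: the fixed weight
    dl makes higher differences of the coefficients small, uniformly in h. *)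
Definition dif (u : R -> R) (x : R) : R := a * (u (x + h) - u x).

Lemma dif_lin j (c : R) (u v : R -> R) x :
  iter j dif (fun y => c * u y + v y) x = c * iter j dif u x + iter j dif v x.
Proof. by elim: j x => //= j ih x; rewrite /dif !ih; ring. Qed.

(** Each use of the product rule (u v)(x + h) - (u v)(x) shifts v once. *)
Lemma dif_leibniz j (u v : R -> R) x :
  iter j dif (fun y => u y * v y) x = \sum_(i < j.+1)
    'C(j, i)%:R * (iter (j - i) dif u x * iter i dif v (x + (j - i)%:R * h)).
Proof.
elim: j x => [|j ih] x.
  by rewrite big_ord_recr big_ord0 /= add0r mul0r addr0 mul1r.
rewrite iterS {1}/dif !ih.
pose A i := iter (j - i).+1 dif u x * iter i dif v (x + (j - i).+1%:R * h).
pose B i := iter (j - i) dif u x * iter i.+1 dif v (x + (j - i)%:R * h).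
transitivity (\sum_(i < j.+1) 'C(j, i)%:R * (A i + B i)).
  rewrite -sumrB mulr_sumr; apply: eq_bigr => i _.
  rewrite /A /B 2!iterS /dif -(addrA x h) -(addrA x _ h).
  rewrite (_ : h + (j - i)%:R * h = (j - i).+1%:R * h); last by rewrite -natr1; ring.
  rewrite (_ : (j - i)%:R * h + h = (j - i).+1%:R * h); last by rewrite -natr1; ring.
  by ring.
under eq_bigr do rewrite mulrDr.
rewrite big_split/= [in RHS]big_ord_recl/= bin0 subn0.
under [in RHS]eq_bigr => i _ do rewrite /bump/= add1n binS natrD mulrDl subSS.
rewrite big_split/= addrA; congr (_ + _).
rewrite [LHS]big_ord_recl [X in _ = _ + X]big_ord_recr /= (bin_small (ltnSn j)) mul0r addr0.
rewrite bin0 /A subn0; congr (_ + _); apply: eq_bigr => i _.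
by rewrite /bump add0n !add1n -(subnSK (ltn_ord i)).
Qed.

Lemma measurable_shift (u : R -> R) (b : R) : measurable_fun setT u ->
  measurable_fun setT (fun x : R => u (x + b)).
Proof. by move=> hu; apply: measurableT_comp => //; exact: measurable_funD. Qed.

Lemma measurable_dif (u : R -> R) : measurable_fun setT u -> measurable_fun setT (dif u).
Proof.
move=> hu; apply: measurable_funM => //; apply: measurable_funB => //.
exact: measurable_shift.
Qed.

Lemma Prim_dif (u v : R -> R) : Prim u v -> Prim (dif u) (dif v).
Proof.
move=> p; have := Prim_Z a (Prim_D (Prim_shift h p) (Prim_Z (-1) p)).
by congr Prim; apply/funext => x; rewrite /dif mulN1r.
Qed.

Lemma Prim_difj j (u v : R -> R) : Prim u v -> Prim (iter j dif u) (iter j dif v).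
Proof. by move=> p; elim: j => //= j ih; exact: Prim_dif. Qed.

End Differences.

Section RegularDifferences.
Context {R : realType}.
Variables (dl h : R).
Hypotheses (h0 : 0 < h) (dl0 : 0 <= dl).
Local Notation D := (dif (dl / h) h).

(** The mean value inequality trades one derivative for the factor dl. *)
Lemma regular_dif n (K : R) e : regular n.+1 K e -> regular n (dl * K) (fun j => D (e j)).
Proof.
move=> [m b p]; split.
- by move=> j jn; apply: measurable_dif; apply: m; rewrite ltnW.
- move=> j x jn; rewrite /dif normrM normrM (ger0_norm dl0) normfV (gtr0_norm h0).
  rewrite -mulrA ler_wpM2l// mulrC ler_pdivrMr//.
  have xh : x <= x + h by rewrite lerDl ltW.
  have := Prim_le (p j jn) (fun y => b j.+1 y jn) xh.
  by rewrite addrAC subrr add0r.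
- by move=> j jn; apply: Prim_dif; apply: p; rewrite ltnW.
Qed.

Lemma regular_difj n j (K : R) e : regular (j + n) K e ->
  regular n (dl ^+ j * K) (fun i => iter j D (e i)).
Proof.
elim: j n => [|j ih] n; first by rewrite expr0 mul1r.
rewrite addSnnS => /ih/regular_dif; by rewrite mulrA -exprS.
Qed.

End RegularDifferences.

Lemma bin_le_expn n m : ('C(n, m) <= 2 ^ n)%N.
Proof.
elim: n m => [|n ih] [|m] //; first by rewrite bin0 expn_gt0.
by rewrite binS expnS mul2n -addnn leq_add.
Qed.

Section Coefficients.
Context {R : realType}.
Variables (s : nat) (dl h : R).
Hypotheses (h0 : 0 < h) (dl0 : 0 <= dl) (dl1 : dl <= 1).
Local Notation D := (dif (dl / h) h).

(** The shifts make the family of the differences of a product depend only on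
    the family of the differences of each factor. *)
Definition difv (u : R -> R) (j : nat) (x : R) := iter j D u (x + (s - j)%:R * h).

(** The coefficients of the Leibniz rule; for i > j the binomial vanishes, so that
    they form a lower triangular matrix. *)
Definition difc (e : R -> R) (j i : nat) (x : R) :=
  'C(j, i)%:R * iter (j - i) D e (x + (s - j)%:R * h).

Lemma difv_mul (e u : R -> R) j x : (j <= s)%N ->
  difv (fun y => e y * u y) j x = \sum_(i < s.+1) difc e j i x * difv u i x.
Proof.
move=> js; rewrite /difv dif_leibniz.
rewrite (big_ord_widen s.+1 (fun i => 'C(j, i)%:R * (iter (j - i) D e (x + (s - j)%:R * h) *
  iter i D u (x + (s - j)%:R * h + (j - i)%:R * h))))//.
rewrite big_mkcond/=; apply: eq_bigr => i _; rewrite /difc.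
case: ifPn => [ij|]; last first.
  by rewrite -leqNgt => ij; rewrite bin_small// !mul0r.
rewrite mulrA -addrA -mulrDl -natrD addnBA//.
by rewrite subnK.
Qed.

Lemma difc_diag (e : R -> R) j x : difc e j j x = e (x + (s - j)%:R * h).
Proof. by rewrite /difc binn subnn mul1r. Qed.

Variables (K : R) (e : nat -> R -> R).
Hypothesis he : regular s.+1 K e.

Let K0 : 0 <= K. Proof. by have [_ /(_ 0%N 0 isT) + _] := he; apply: le_trans. Qed.

Let difc_le i j b x : (j <= s)%N -> (b <= 1)%N ->
  `|difc (e b) j i x| <= 2 ^+ s * (dl ^+ (j - i) * K).
Proof.
move=> js b1; have hd : regular 1 (dl ^+ (j - i) * K) (fun b => iter (j - i) D (e b)).
  apply: (regular_difj h0 dl0); have [m bd p] := he.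
  have le k : (k <= j - i + 1)%N -> (k <= s.+1)%N.
    by move=> /leq_trans -> //; rewrite addn1 ltnS (leq_trans (leq_subr _ _)).
  by split=> [k /le|k y /le|k /le]; [exact: m|exact: bd|exact: p].
have [_ bd _] := hd; rewrite /difc normrM ler_pM//; last exact: bd.
rewrite ger0_norm ?ler0n// -natrX ler_nat (leq_trans (bin_le_expn _ _))//.
by rewrite leq_exp2l.
Qed.

Lemma difc_bound i j b x : (j <= s)%N -> (b <= 1)%N -> `|difc (e b) j i x| <= 2 ^+ s * K.
Proof.
move=> js b1; apply: (le_trans (difc_le _ _ js b1)).
by rewrite ler_wpM2l ?exprn_ge0// -[leRHS]mul1r ler_wpM2r// exprn_ile1.
Qed.

(** Below the diagonal there is at least one difference of e, hence a factor dl. *)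
Lemma difc_offdiag i j b x : (j <= s)%N -> (b <= 1)%N -> i != j ->
  `|difc (e b) j i x| <= dl * (2 ^+ s * K).
Proof.
move=> js b1; rewrite neq_ltn => /orP[] ij; last first.
  by rewrite /difc bin_small// mul0r normr0 !mulr_ge0// exprn_ge0.
apply: (le_trans (difc_le _ _ js b1)).
rewrite [leRHS]mulrCA ler_wpM2l ?exprn_ge0// ler_wpM2r//.
move: ij; rewrite -subn_gt0; case: (j - i)%N => // m _.
by rewrite exprS -[leRHS]mulr1 ler_wpM2l// exprn_ile1.
Qed.

Lemma difc_meas i j b : (b <= 1)%N -> measurable_fun setT (difc (e b) j i).
Proof.
move=> b1; apply: measurable_funM => //; apply: (@measurable_shift _ (iter (j - i) D (e b))).
elim: (j - i)%N => [|m ih] /=; last exact: measurable_dif.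
by have [m _ _] := he; apply: m; rewrite (leq_trans b1).
Qed.

Lemma difc_Prim i j : Prim (difc (e 0%N) j i) (difc (e 1%N) j i).
Proof.
apply: Prim_Z; apply: (Prim_shift _ (Prim_difj _ _ _ _)).
by have [_ _ p] := he; exact: p.
Qed.

End Coefficients.

(** * Stability of the system of differences *)

Section DifferenceStability.
Variables (R : realType) (s : nat) (c K lam : R).
Hypotheses (c0 : 0 < c) (K0 : 0 <= K) (lam0 : 0 <= lam).
Notation I0 := 'I_s.+1.
Notation V := (vec R (I0 * bool)%type).
Local Notation n := (s.+1%:R : R).

(* kap bounds the entries of the matrix of g and of its derivative, BQ those of
   the inverse of its diagonal, and dl kap2 those of P = G^T Q - 1. *)
Let kap : R := 2 ^+ s * K.
Let BQ : R := c^-1 + lam * (kap * c^-1 * c^-1).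
Let C : R := (n * (kap + BQ + 1)) ^+ 2.
Let kap2 : R := kap * c^-1 + lam * (kap * c^-1 + kap * (kap * c^-1 * c^-1)).

Let kap0 : 0 <= kap. Proof. by rewrite mulr_ge0// exprn_ge0. Qed.
Let ci0 : 0 < c^-1. Proof. by rewrite invr_gt0. Qed.
Let ci0' : 0 <= c^-1. Proof. exact: ltW. Qed.
Let BQ0 : 0 <= BQ.
Proof. by rewrite addr_ge0// !mulr_ge0. Qed.
Let n0 : 0 < n. Proof. by rewrite ltr0n. Qed.
Let C0 : 0 < C.
Proof. by rewrite exprn_gt0// mulr_gt0// ltr_wpDl// addr_ge0. Qed.

Let sqle (x y : R) : 0 <= x -> x <= y -> x ^+ 2 <= y ^+ 2.
Proof. by move=> x0 xy; rewrite ler_sqr ?nnegrE// (le_trans x0). Qed.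

Section Fixed.
Variables (dl eps : R).
Hypotheses (dl0 : 0 < dl) (dl1 : dl <= 1) (eps0 : 0 < eps).
Hypothesis dlsmall1 : dl * (n * kap) <= c / 2.
Hypothesis dlsmall2 : 8 * C * (n * (dl * kap2)) ^+ 2 <= (c / 2) ^+ 2.
Hypothesis epssmall :
  192 ^+ 2 * (12 * (n * (2 ^+ s * eps * (1 + lam))) ^+ 2 * (48 * C / (c / 2) ^+ 2)) <= 1.

Variables (k h Kf : R) (eg ef : nat -> R -> R).
Hypotheses (k0 : k != 0) (h0 : 0 < h) (klam : `|k^-1| <= lam).
Hypotheses (hg : regular s.+1 K eg) (hf : regular s.+1 Kf ef).
Hypothesis gc : forall x, c <= eg 0%N x /\ eg 0%N x <= c^-1.
Hypothesis feps : `|k^-1| * Kf <= eps.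

Notation dc := (difc s dl h).

Let Mg (b : nat) (j i : I0) := dc (eg b) j i.
Let js (j : I0) : (j <= s)%N. Proof. by rewrite -ltnS. Qed.

Let g_bound b j i x : (b <= 1)%N -> `|Mg b j i x| <= kap.
Proof. by move=> b1; apply: (difc_bound h0 (ltW dl0) dl1 hg). Qed.

Let g_off b (j i : I0) x : (b <= 1)%N -> i != j -> `|Mg b j i x| <= dl * kap.
Proof. by move=> b1 ij; apply: (difc_offdiag h0 (ltW dl0) dl1 hg). Qed.

Let hMg : bounded_matrix kap (Mg 0).
Proof. by move=> j i; split=> [|x]; [exact: (difc_meas dl h hg)|exact: g_bound]. Qed.

Let diag_ge (j : I0) x : c <= Mg 0 j j x.
Proof. by rewrite /Mg difc_diag; have [] := gc (x + (s - j)%:R * h). Qed.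

Let diag_le (j : I0) x : Mg 0 j j x <= c^-1.
Proof. by rewrite /Mg difc_diag; have [] := gc (x + (s - j)%:R * h). Qed.

Let qf (j : I0) x : R := (Mg 0 j j x)^-1.
Let qf' (j : I0) x : R := - (Mg 1 j j x / Mg 0 j j x / Mg 0 j j x).

Let qf_prim j : Prim (qf j) (qf' j).
Proof.
apply: (Prim_recip c0 (diag_ge j) (fun x => g_bound _ _ _ (isT : (1 <= 1)%N))).
exact: (difc_Prim dl h hg).
Qed.

Let Mgp j x : 0 < Mg 0 j j x. Proof. exact: (lt_le_trans c0 (diag_ge j x)). Qed.

Let qf_bound j x : `|qf j x| <= c^-1.
Proof.
by rewrite /qf normfV gtr0_norm// lef_pV2 ?posrE.
Qed.

Let qf_ge j x : c <= qf j x.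
Proof. by rewrite /qf -[leLHS]invrK lef_pV2 ?posrE. Qed.

Let qf_bound' j x : `|qf' j x| <= kap * c^-1 * c^-1.
Proof.
rewrite /qf' normrN normrM; apply: ler_pM => //; last exact: qf_bound.
by rewrite normrM; apply: ler_pM => //; [exact: g_bound|exact: qf_bound].
Qed.

Let qf_meas j : measurable_fun setT (qf j). Proof. exact: (Prim_meas (qf_prim j)). Qed.

Let qf_meas' j : measurable_fun setT (qf' j). Proof. by have [] := qf_prim j. Qed.

Let Mq (j i : I0) x : R := if i == j then qf j x else 0.
Let Nq (j i : I0) x : R := if i == j then k^-1 * qf' j x else 0.
Let Mp (i j : I0) x : R := if i == j then 0 else Mg 0 j i x * qf j x.
Let Np (i j : I0) x : R :=
  if i == j then 0 else k^-1 * (Mg 1 j i x * qf j x + Mg 0 j i x * qf' j x).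

Let hMq : bounded_matrix BQ Mq.
Proof.
move=> j i; rewrite /Mq; case: eqP => _; split=> // x.
  by rewrite (le_trans (qf_bound _ _))// lerDl !mulr_ge0.
by rewrite normr0.
Qed.

Let hNq : bounded_matrix BQ Nq.
Proof.
move=> j i; rewrite /Nq; case: eqP => _; split=> //.
- exact: measurable_funM.
- move=> x; rewrite normrM (@le_trans _ _ (lam * (kap * c^-1 * c^-1)))//.
    by rewrite ler_pM//; exact: qf_bound'.
  by rewrite lerDr.
- by move=> x; rewrite normr0.
Qed.

Let dk2 : 0 <= dl * kap2.
Proof. by rewrite mulr_ge0 ?(ltW dl0)// addr_ge0 ?mulr_ge0 ?addr_ge0 ?mulr_ge0 ?ci0'. Qed.

Let hMp : bounded_matrix (dl * kap2) Mp.
Proof.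
move=> i j; rewrite /Mp; case: eqP => ij; split=> //.
- by move=> x; rewrite normr0.
- by apply: measurable_funM => //; exact: (hMg j i).1.
- move=> x; rewrite normrM (@le_trans _ _ (dl * kap * c^-1))//.
    by apply: ler_pM => //; apply: g_off => //; exact/eqP.
  rewrite -mulrA ler_wpM2l ?(ltW dl0)// lerDl.
  by rewrite mulr_ge0 ?addr_ge0 ?mulr_ge0 ?ci0'.
Qed.

Let hNp : bounded_matrix (dl * kap2) Np.
Proof.
move=> i j; rewrite /Np; case: eqP => ij; split=> //.
- by move=> x; rewrite normr0.
- apply: measurable_funM => //; apply: measurable_funD; apply: measurable_funM => //.
    exact: (difc_meas dl h hg).
  exact: (hMg j i).1.
- move=> x; rewrite normrM.
  have ij' : i != j by exact/eqP.
  have h1 : `|Mg 1 j i x * qf j x| <= dl * kap * c^-1.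
    by rewrite normrM; apply: ler_pM => //; exact: g_off.
  have h2 : `|Mg 0 j i x * qf' j x| <= dl * kap * (kap * c^-1 * c^-1).
    by rewrite normrM; apply: ler_pM => //; exact: g_off.
  have h3 := le_trans (ler_normD _ _) (lerD h1 h2).
  apply: (le_trans (ler_pM (normr_ge0 _) (normr_ge0 _) klam h3)).
  have -> : lam * (dl * kap * c^-1 + dl * kap * (kap * c^-1 * c^-1)) =
     dl * (lam * (kap * c^-1 + kap * (kap * c^-1 * c^-1))) by ring.
  by rewrite ler_wpM2l ?(ltW dl0)// lerDr mulr_ge0// ltW.
Qed.

Let cardI : #|I0|%:R = n. Proof. by rewrite card_ord. Qed.

Let G := mulmat hMg.

Let Gb x : ip (G x) (G x) <= C * ip x x.
Proof.
apply: (le_trans (mulmat_le hMg x)); rewrite cardI ler_wpM2r ?ip_ge0E//.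
have h1 : kap <= kap + BQ + 1 by rewrite -addrA lerDl addr_ge0.
by apply: sqle; [rewrite mulr_ge0 ?(ltW n0)|rewrite ler_wpM2l ?(ltW n0)].
Qed.

Let diag_dot c' (m : I0 -> R -> R) B (hm : bounded_matrix B (fun j i x => if i == j then m j x else 0)) x :
  (forall j y, c' <= m j y) -> c' * ip x x <= ip (mulmat hm x) x.
Proof.
move=> cm; rewrite /ip mulr_sumr; apply: ler_sum => -[j b] _.
have L := vecL2 x (j, b); have [mm mB] := hm j j; rewrite eqxx in mm mB.
have E : mulmat hm x (j, b) = fun y => m j y * x (j, b) y.
  apply/funext => y; rewrite mulmatE (bigD1 j)//= eqxx big1 ?addr0// => i ij.
  by rewrite (negbTE ij) mul0r.
rewrite E; have [L1 _] := L2_bounded mm mB L.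
have cL := L2Z c' L.
have := dot_lin c' L (@L2_0 R) L.
under [X in dot X _ = _ -> _]eq_fun do rewrite addr0.
rewrite [dot (fun=> 0) _]/dot; under [X in _ = _ + X -> _]eq_Rintegral do rewrite mul0r.
rewrite Rintegral_cst// mul0r addr0 => <-.
apply: le_Rintegral => //; [exact: L2_mul|exact: L2_mul|].
move=> y _; rewrite -!mulrA ler_wpM2r// -expr2; exact: sqr_ge0.
Qed.

Let Mn (j i : I0) x : R := if i == j then 0 else Mg 0 j i x.
Let hMn : bounded_matrix (dl * kap) Mn.
Proof.
move=> j i; rewrite /Mn; case: eqP => ij; split=> //.
- by move=> x; rewrite normr0 mulr_ge0 ?(ltW dl0).
- exact: (hMg j i).1.
- by move=> x; apply: g_off => //; exact/eqP.
Qed.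
Let Md (j i : I0) x : R := if i == j then Mg 0 j j x else 0.
Let hMd : bounded_matrix kap Md.
Proof.
move=> j i; rewrite /Md; case: eqP => ij; split=> //.
- exact: (hMg j j).1.
- by move=> x; exact: g_bound.
- by move=> x; rewrite normr0.
Qed.

Let ipL (u v w : V) : ip (u + v) w = ip u w + ip v w.
Proof. exact: (form_Dl (@ip_linE _ _)). Qed.

Let Gc x : c / 2 * ip x x <= ip (G x) x.
Proof.
have -> : G x = mulmat hMd x + mulmat hMn x.
  apply: vecP => -[j b] y; rewrite vecDE !mulmatE -big_split/=; apply: eq_bigr => i _.
  by rewrite /Md /Mn; case: eqP => [->|_]; rewrite ?mul0r ?addr0 ?add0r.
rewrite ipL; have h1 := diag_dot hMd x diag_ge.
have F := @vec_frame R I0 k k0.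
have e0 : 0 < c / 2 by rewrite divr_gt0.
have := form_young (ip_sym F) (ip_lin F) (ip_ge0 F) (- mulmat hMn x) x (e := (c / 2)^-1).
rewrite invr_gt0 => /(_ e0); rewrite invrK.
rewrite !(form_Nl (ip_lin F)) (form_Nr (ip_sym F) (ip_lin F)) opprK.
have h2 := mulmat_le hMn x; rewrite cardI in h2.
have h3 : (c / 2)^-1 * ip (mulmat hMn x) (mulmat hMn x) <= c / 2 * ip x x.
  rewrite ler_pdivrMl//; apply: (le_trans h2); rewrite [leRHS]mulrA ler_wpM2r ?ip_ge0E//.
  rewrite -expr2; apply: sqle; last by rewrite mulrCA.
  by rewrite !mulr_ge0 ?(ltW n0) ?(ltW dl0).
have := ip_ge0E x; lra.
Qed.

Let GQ x y : ip (G y) (mulmat hMq x) = ip y x + ip y (mulmat hMp x).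
Proof.
have F := @vec_frame R I0 k k0.
rewrite -(form_Dr (ip_sym F) (ip_lin F)).
pose Mg' (i j : I0) := Mg 0 j i.
have hMg' : bounded_matrix kap Mg' by move=> i j; exact: hMg.
rewrite (mulmat_adj hMg hMg')//; congr (ip y _).
apply: vecP => -[i b] z; rewrite vecDE !mulmatE.
under eq_bigr => j _.
  rewrite mulmatE (bigD1 j)//= {1}/Mq eqxx big1 ?addr0; last first.
    by move=> l lj; rewrite /Mq (negbTE lj) mul0r.
  over.
rewrite (bigD1 i)//= [in RHS](bigD1 i)//= {1}/Mp eqxx mul0r add0r; congr (_ + _).
  by rewrite /Mg' /qf mulrA divff ?mul1r// gt_eqF.
by apply: eq_bigr => j ji; rewrite /Mp eq_sym (negbTE ji) mulrA.
Qed.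

Let Qc x : c / 2 * ip x x <= ip x (mulmat hMq x).
Proof.
rewrite ip_symE (le_trans _ (diag_dot hMq x qf_ge))// ler_wpM2r ?ip_ge0E//.
by rewrite ler_pdivrMr// mulr_natr mulr2n lerDl ltW.
Qed.

Let kk x : k * (k^-1 * x) = x. Proof. by rewrite mulrA divff// mul1r. Qed.

Let Qmul : multiplier ip (@Jv R I0) (der k) (mulmat hMq) (mulmat hNq) C.
Proof.
have : multiplier ip (@Jv R I0) (der k) (mulmat hMq) (mulmat hNq) ((n * BQ) ^+ 2).
  rewrite -cardI; apply: matrix_multiplier => j i; rewrite /Mq /Nq; case: eqP => _.
    by under [X in Prim _ X]eq_fun do rewrite kk; exact: qf_prim.
  by under [X in Prim _ X]eq_fun do rewrite mulr0; exact: Prim_cst.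
have le : (n * BQ) ^+ 2 <= C.
  have h1 : BQ <= kap + BQ + 1 by rewrite addrAC lerDr addr_ge0.
  by apply: sqle; [rewrite mulr_ge0 ?(ltW n0)|rewrite ler_wpM2l ?(ltW n0)].
move=> [m1 m2 m3 m4 m5]; split=> // u.
  by apply: (le_trans (m4 u)); rewrite ler_wpM2r ?ip_ge0E.
by apply: (le_trans (m5 u)); rewrite ler_wpM2r ?ip_ge0E.
Qed.

Let Pmul : multiplier ip (@Jv R I0) (der k) (mulmat hMp) (mulmat hNp) ((n * (dl * kap2)) ^+ 2).
Proof.
rewrite -cardI; apply: matrix_multiplier => i j; rewrite /Mp /Np; case: eqP => _.
  by under [X in Prim _ X]eq_fun do rewrite mulr0; exact: Prim_cst.
under [X in Prim _ X]eq_fun do rewrite kk.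
apply: (Prim_mul _ (qf_prim j)); exact: (difc_Prim dl h hg).
Qed.

Let Ma (j i : I0) x := k^-1 * dc (ef 0%N) j i x.
Let Na (j i : I0) x := k^-1 * (k^-1 * dc (ef 1%N) j i x).

Let Ma_bound b (j i : I0) x : (b <= 1)%N -> `|k^-1 * dc (ef b) j i x| <= 2 ^+ s * eps.
Proof.
move=> b1; rewrite normrM.
apply: (le_trans (ler_wpM2l (normr_ge0 _) (difc_bound h0 (ltW dl0) dl1 hf i x (js j) b1))).
by rewrite mulrCA ler_wpM2l ?exprn_ge0.
Qed.

Let BA := 2 ^+ s * eps * (1 + lam).
Let se0 : 0 <= 2 ^+ s * eps. Proof. by rewrite mulr_ge0 ?exprn_ge0 ?(ltW eps0). Qed.

Let hMa : bounded_matrix BA Ma.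
Proof.
move=> j i; split; first by apply: measurable_funM => //; exact: (difc_meas dl h hf).
by move=> x; rewrite (le_trans (Ma_bound _ _ _ _))// ler_peMr// lerDl.
Qed.

Let hNa : bounded_matrix BA Na.
Proof.
move=> j i; split.
  by do 2![apply: measurable_funM => //]; exact: (difc_meas dl h hf).
move=> x; rewrite /Na normrM (@le_trans _ _ (lam * (2 ^+ s * eps)))//.
  by apply: ler_pM => //; exact: Ma_bound.
by rewrite mulrC ler_wpM2l// lerDr.
Qed.

Let Amul : multiplier ip (@Jv R I0) (der k) (mulmat hMa) (mulmat hNa) ((n * BA) ^+ 2).
Proof.
rewrite -cardI; apply: matrix_multiplier => j i; rewrite /Ma /Na.
under [X in Prim _ X]eq_fun do rewrite kk.
exact: (Prim_Z _ (difc_Prim dl h hf _ _)).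
Qed.

Lemma difference_stability_fixed (w Psi : R -> V)
    BG BF (hG : @bounded_matrix _ I0 BG (fun j i => dc (eg 0%N) j i))
    (hF : @bounded_matrix _ I0 BF (fun j i x => k^-1 * dc (ef 0%N) j i x)) :
  (forall t, elliptic_at ip (@Jv R I0) (der k) (mulmat hG) t (w t) (Psi t)) ->
  (forall t, tder ip w (Jv (mulmat hF (Psi t))) t) ->
  forall t, ip (w t) (w t) <= 2 * ip (w 0) (w 0).
Proof.
move=> ell dw.
have EG : mulmat hG = G by apply/funext => u; apply: vecP => -[j b] x; rewrite !mulmatE.
have EA u : mulmat hF u = mulmat hMa u by apply: vecP => -[j b] x; rewrite !mulmatE.
apply: (@elliptic_stability2 _ _ _ _ _ (@vec_frame R I0 k k0) (c / 2) C _ _ G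
  (mulmat hMq) (mulmat hNq) (mulmat hMp) (mulmat hNp) (mulmat hMa) (mulmat hNa) w Psi _ C0 _
  dlsmall2 _ epssmall Gc Gb GQ Qc Qmul Pmul Amul).
- by rewrite divr_gt0.
- exact: sqr_ge0.
- exact: sqr_ge0.
- by move=> t; rewrite -EG; exact: ell.
- by move=> t; rewrite -EA; exact: dw.
Qed.

End Fixed.

Let small_prod (a b d : R) : 0 <= a -> 0 < b -> 0 < d -> d <= b / (a + 1) -> d * a <= b.
Proof.
move=> a0 b0 d0 h; have a1 : 0 < a + 1 by rewrite ltr_wpDl.
move: h; rewrite ler_pdivlMr// mulrDr mulr1 => h; apply: le_trans h.
by rewrite lerDl ltW.
Qed.

(** The weight dl is chosen first: it makes the matrix of g a small perturbation of
    its diagonal, and P small.  The smallness eps of the coefficient f then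
    absorbs all the constants; neither depends on the step h. *)
Theorem difference_stability : exists dl eps : R, [/\ 0 < dl, dl <= 1, 0 < eps &
  forall (k h Kf : R) (eg ef : nat -> R -> R) (w Psi : R -> V) BG BF
    (hG : @bounded_matrix _ I0 BG (fun j i => difc s dl h (eg 0%N) j i))
    (hF : @bounded_matrix _ I0 BF (fun j i x => k^-1 * difc s dl h (ef 0%N) j i x)),
  k != 0 -> 0 < h -> `|k^-1| <= lam -> regular s.+1 K eg -> regular s.+1 Kf ef ->
  (forall x, c <= eg 0%N x /\ eg 0%N x <= c^-1) -> `|k^-1| * Kf <= eps ->
  (forall t, elliptic_at ip (@Jv R I0) (der k) (mulmat hG) t (w t) (Psi t)) ->
  (forall t, tder ip w (Jv (mulmat hF (Psi t))) t) ->
  forall t, ip (w t) (w t) <= 2 * ip (w 0) (w 0)].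
Proof.
have c2 : 0 < c / 2 by rewrite divr_gt0.
pose a1 := n * kap; pose a2 := 8 * C * (n * kap2) ^+ 2.
pose a3 := 192 ^+ 2 * (12 * (n * (2 ^+ s * (1 + lam))) ^+ 2 * (48 * C / (c / 2) ^+ 2)).
have a10 : 0 <= a1 by rewrite mulr_ge0 ?(ltW n0).
have a20 : 0 <= a2 by rewrite mulr_ge0 ?sqr_ge0// mulr_ge0 ?(ltW C0).
have a30 : 0 <= a3.
  rewrite mulr_ge0 ?exprn_ge0// mulr_ge0//; first by rewrite mulr_ge0 ?sqr_ge0.
  by rewrite divr_ge0 ?sqr_ge0// mulr_ge0// ltW.
have p x : 0 <= x -> 0 < x + 1 by move=> x0; rewrite ltr_wpDl.
pose dl := Num.min 1 (Num.min (c / 2 / (a1 + 1)) ((c / 2) ^+ 2 / (a2 + 1))).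
pose eps := Num.min 1 (1 / (a3 + 1)).
have dl0 : 0 < dl by rewrite !lt_min ltr01 !divr_gt0 ?p// exprn_gt0.
have dl1 : dl <= 1 by rewrite ge_min lexx.
have eps0 : 0 < eps by rewrite !lt_min ltr01 !divr_gt0 ?p.
have eps1 : eps <= 1 by rewrite ge_min lexx.
exists dl, eps; split=> // k h Kf eg ef w Psi BG BF hG hF k0 h0 kl hg hf gc fe.
apply: (@difference_stability_fixed dl eps dl0 dl1 eps0 _ _ _ k h Kf eg ef) => //.
- by apply: small_prod => //; rewrite !ge_min lexx orbT.
- have -> : 8 * C * (n * (dl * kap2)) ^+ 2 = dl * (dl * a2) by rewrite /a2; ring.
  have h2 : dl * a2 <= (c / 2) ^+ 2.
    by apply: small_prod; rewrite ?exprn_gt0// !ge_min lexx !orbT.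
  by apply: le_trans h2; rewrite ler_piMl// mulr_ge0// ltW.
- rewrite (_ : _ * _ = eps * (eps * a3)); last by rewrite /a3; ring.
  have h2 : eps * a3 <= 1 by apply: small_prod; rewrite // ge_min lexx orbT.
  by apply: le_trans h2; rewrite ler_piMl// mulr_ge0// ltW.
Qed.

End DifferenceStability.

(** * Uniqueness of weak derivatives *)

Section PrimUnique.
Context {R : realType}.
Local Notation mu := (@lebesgue_measure R).

Lemma Prim_locL1 (u v : R -> R) : Prim u v -> locL1 v.
Proof.
move=> [mv h]; split=> // a b; case: (leP a b) => ab; first by have [] := h a b ab.
by rewrite set_itv_ge ?bnd_simp -?ltNge//; exact: integrable_set0.
Qed.

Lemma int_support (f : R -> R) (N : R) : (forall x, N < `|x| -> f x = 0) ->
  \int[mu]_x f x = \int[mu]_(x in `[- N, N]) f x.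
Proof.
move=> f0; rewrite (int_cut `[- N, N]); apply: eq_Rintegral => x _.
rewrite indicE mem_setE; case: (boolP (x \in _)) => [_|]; first by rewrite mulr1.
by rewrite in_itv/= -ler_norml -ltNge => /f0 ->; rewrite mulr0.
Qed.

(** By parts, z is orthogonal to the derivatives of test functions, hence constant
    almost everywhere. *)
Lemma Prim_zero (z : R -> R) : Prim (fun=> 0) z -> {ae mu, forall x, z x = 0}.
Proof.
move=> pz; suff [k hk] : exists k, {ae mu, forall y, z y = k}.
  suff k0 : k = 0 by rewrite k0 in hk.
  have pk : Prim (fun=> 0) (fun=> k : R) by apply: (Prim_ae pz).
  have [_ /(_ 0 1 ler01)[_]] := pk.
  rewrite subrr Rintegral_cst//= lebesgue_measure_itv/= lte_fin ltr01 oppr0 addr0.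
  by rewrite mulr1.
apply: (weak_zero_cst (Prim_locL1 pz)) => phi tphi; have [N [M [N0 out _ [_ cphi'] _]]] := test_functionP tphi.
have P2 : Prim (derive1 phi) (derive1 (derive1 phi)).
  apply: Prim_C1 => //; first exact: (tphi.1 1%N).
  by move=> x; apply/differentiable_continuous/derivable1_diffP; exact: (tphi.1 2%N).
rewrite (@int_support _ N); last by move=> x /out[_ ->]; rewrite mulr0.
have [_ /(_ (- N) N)[]] := Prim_mul pz P2; first by rewrite ge0_cp.
rewrite !mul0r subrr => _ /esym h; rewrite -[RHS]h.
by apply: eq_Rintegral => x _; rewrite mul0r addr0.
Qed.

Lemma Prim_unique (u v v' : R -> R) : Prim u v -> Prim u v' ->
  {ae mu, forall x, v x = v' x}.
Proof.
move=> p p'; have := Prim_D p (Prim_Z (-1) p').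
under [X in Prim X _]eq_fun do rewrite mulN1r subrr.
move=> /Prim_zero/ae_imp; apply => x; rewrite mulN1r => /eqP.
by rewrite subr_eq0 => /eqP.
Qed.

Lemma continuous_ae_eq (f g : R -> R) : continuous f -> continuous g ->
  {ae mu, forall x, f x = g x} -> f = g.
Proof.
move=> cf cg e; apply/funext => x; apply/eqP; rewrite eq_le.
have cfg : continuous (fun x => f x - g x) by move=> y; apply: (@continuousB _ R^o _ f g); [exact: cf|exact: cg].
have cgf : continuous (fun x => g x - f x) by move=> y; apply: (@continuousB _ R^o _ g f); [exact: cg|exact: cf].
apply/andP; split; rewrite -subr_le0.
  by apply: (continuous_ae_le cfg); apply: (ae_imp e) => y ->; rewrite subrr.
by apply: (continuous_ae_le cgf); apply: (ae_imp e) => y ->; rewrite subrr.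
Qed.

Lemma weak_derivative_unique (u v v' : R -> R) : weak_derivative u v -> weak_derivative u v' ->
  {ae mu, forall x, v x = v' x}.
Proof.
move=> /weak_derivative_Prim[u1 p1 e1] /weak_derivative_Prim[u2 p2 e2].
apply: (Prim_unique p1); suff -> : u1 = u2 by [].
apply: continuous_ae_eq; [exact: Prim_continuous p1|exact: Prim_continuous p2|].
by apply: (ae_imp (ae_and e1 e2)) => x [<- <-].
Qed.

End PrimUnique.

(** * Vectors of differences *)

Section DifferenceVectors.
Variables (R : realType) (s : nat) (dl h : R).
Notation I0 := 'I_s.+1.
Notation V := (vec R (I0 * bool)%type).
Local Notation mu := (@lebesgue_measure R).
Notation dv := (difv s dl h).

Lemma dif_ae j (a : R) (u v : R -> R) : {ae mu, forall x, u x = v x} ->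
  {ae mu, forall x, iter j (dif a h) u x = iter j (dif a h) v x}.
Proof.
move=> uv; elim: j => //= j ih.
apply: (ae_imp (ae_and ih (ae_iso (iso_shift h) ih))) => x [h1 h2].
by rewrite /dif h1 h2.
Qed.

Lemma difv_ae j (u v : R -> R) : {ae mu, forall x, u x = v x} ->
  {ae mu, forall x, dv u j x = dv v j x}.
Proof. by move=> /(dif_ae j (dl / h)); exact: (ae_iso (iso_shift _)). Qed.

Lemma dif_L2 (a : R) (u : R -> R) : L2 u -> L2 (dif a h u) /\
  dot (dif a h u) (dif a h u) <= (2 * a) ^+ 2 * dot u u.
Proof.
move=> hu; have hs := L2_iso (iso_shift h) hu.
have hd : L2 (fun x => u (x + h) - u x) by apply: L2D => //; exact: L2N.
split; first exact: L2Z.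
pose v : vec R unit := mkvec (fun=> hs); pose w : vec R unit := mkvec (fun=> L2N hu).
have := form_sq_add (@ip_symE R unit) (@ip_linE R unit) (@ip_ge0E R unit) v w.
rewrite /ip !(big_pred1 tt); try by case.
have -> : dot (w tt) (w tt) = dot u u.
  by apply: eq_Rintegral => x _ /=; rewrite mulrNN.
have -> : dot (v tt) (v tt) = dot u u by exact: (dot_iso (iso_shift h) hu hu).
have -> : dot (dif a h u) (dif a h u) = a ^+ 2 * dot ((v + w) tt) ((v + w) tt).
  rewrite /dot -RintegralZl//; last first.
    exact: (L2_mul (vecL2 (v + w) tt) (vecL2 (v + w) tt)).
  by apply: eq_Rintegral => x _; rewrite vecDE /= /dif; ring.
have -> : (2 * a) ^+ 2 * dot u u = a ^+ 2 * (2 * dot u u + 2 * dot u u) by ring.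
by move=> le; rewrite ler_wpM2l ?sqr_ge0.
Qed.

Lemma difv_L2 j (u : R -> R) : L2 u -> L2 (dv u j) /\
  dot (dv u j) (dv u j) <= (2 * (dl / h)) ^+ 2 ^+ j * dot u u.
Proof.
move=> hu; have [h1 h2] : L2 (iter j (dif (dl / h) h) u) /\
    dot (iter j (dif (dl / h) h) u) (iter j (dif (dl / h) h) u) <=
      (2 * (dl / h)) ^+ 2 ^+ j * dot u u.
  elim: j => [|j [ih1 ih2]] /=; first by rewrite mul1r.
  have [g1 g2] := dif_L2 (dl / h) ih1; split=> //.
  by apply: (le_trans g2); rewrite (exprS (_ ^+ 2)) -(mulrA (_ ^+ 2)) ler_wpM2l// sqr_ge0.
split; first exact: (L2_iso (iso_shift _) h1).
by rewrite (dot_iso (iso_shift ((s - j)%:R * h)) h1 h1).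
Qed.

Lemma difv_Prim j (u v : R -> R) : Prim u v -> Prim (dv u j) (dv v j).
Proof. by move=> p; exact: (Prim_shift _ (Prim_difj _ _ _ p)). Qed.

Lemma difv_lin j (c : R) (u v : R -> R) x :
  dv (fun y => c * u y + v y) j x = c * dv u j x + dv v j x.
Proof. exact: dif_lin. Qed.

Lemma difvZ j (c : R) (u : R -> R) x : dv (fun y => c * u y) j x = c * dv u j x.
Proof.
have := difv_lin j c u (fun y => 0 * u y) x.
have := difv_lin j 0 u (fun y => 0 * u y) x.
rewrite !mul0r !add0r => _.
have -> : (fun y => c * u y + 0 * u y) = fun y => c * u y.
  by apply/funext => y; rewrite mul0r addr0.
move=> ->; have := difv_lin j (-1) (fun y => 0 * u y) (fun y => 0 * u y) x.
have -> : (fun y => -1 * (0 * u y) + 0 * u y) = fun y => 0 * u y.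
  by apply/funext => y; ring.
by rewrite mulN1r addNr => ->; rewrite addr0.
Qed.

(** All the differences of order at most s of a complex function, with
    components [u false] and [u true]. *)
Definition dvec (u : bool -> R -> R) (hu : forall b, L2 (u b)) : V :=
  mkvec (fun p : I0 * bool => (difv_L2 p.1 (hu p.2)).1).

Lemma dvecE u (hu : forall b, L2 (u b)) (j : I0) b x : dvec hu (j, b) x = dv (u b) j x.
Proof. by []. Qed.

Lemma dvec_der k u du u1 (hu : forall b, L2 (u b)) (hdu : forall b, L2 (du b)) :
  (forall b, Prim (u1 b) (fun x => k * du b x)) ->
  (forall b, {ae mu, forall x, u b x = u1 b x}) -> der k (dvec hu) (dvec hdu).
Proof.
move=> p e [j b]; exists (dv (u1 b) j).
  have := difv_Prim j (p b); congr Prim; apply/funext => x.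
  by rewrite dvecE -difvZ.
by apply: (ae_imp (difv_ae j (e b))) => x.
Qed.

Lemma dvec_le : exists2 C, 0 <= C &
  forall v (hv : forall b, L2 (v b)),
  ip (dvec hv) (dvec hv) <= C * \sum_b dot (v b) (v b).
Proof.
exists (\sum_(j : I0) (2 * (dl / h)) ^+ 2 ^+ j).
  by apply: sumr_ge0 => j _; rewrite exprn_ge0// sqr_ge0.
move=> v hv; rewrite ip_pair mulr_suml; apply: ler_sum => j _.
rewrite big_bool/= mulrDr addrC lerD//; exact: (difv_L2 j (hv _)).2.
Qed.

End DifferenceVectors.

(** * The equation of a mode in real components *)

Section Components.
Context {R : realType}.
Local Notation mu := (@lebesgue_measure R).

Definition cpt (b : bool) (z : R[i]) : R := if b then complex.Im z else complex.Re z.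

Definition L2C (u : R -> R[i]) := forall b, L2 (fun x => cpt b (u x)).

Lemma cpt_eq (z z' : R[i]) : (forall b, cpt b z = cpt b z') -> z = z'.
Proof. by case: z z' => [a b] [a' b'] h; rewrite (h false : a = a') (h true : b = b'). Qed.

Lemma cptD b (z z' : R[i]) : cpt b (z + z') = cpt b z + cpt b z'.
Proof. by case: z z' => [? ?] [? ?]; case: b. Qed.

Lemma cptN b (z : R[i]) : cpt b (- z) = - cpt b z.
Proof. by case: z => [? ?]; case: b. Qed.

Lemma cptZ b (a : R) (z : R[i]) : cpt b (a%:C%C * z) = a * cpt b z.
Proof. by case: z => [? ?]; case: b => /=; ring. Qed.

Lemma cpti b (z : R[i]) : cpt b ('i%C * z) = if b then cpt false z else - cpt true z.
Proof. by case: z => [? ?]; case: b => /=; ring. Qed.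

Lemma L2_sqnormE (u : R -> R[i]) : L2C u ->
  L2_sqnorm u = (\sum_b dot (fun x => cpt b (u x)) (fun x => cpt b (u x)))%:E.
Proof.
move=> hu; rewrite big_bool/= addrC.
have h b := L2_mul (hu b) (hu b).
rewrite /dot -RintegralD//; [|exact: (h false)|exact: (h true)].
rewrite /L2_sqnorm /Rintegral fineK.
  by apply: eq_integral => x _.
by apply: integrable_fin_num => //; exact: (L1D (h false) (h true)).
Qed.

Lemma L2_sqnorm_L2C (u : R -> R[i]) : (forall b, measurable_fun setT (fun x => cpt b (u x))) ->
  (L2_sqnorm u < +oo)%E -> L2C u.
Proof.
move=> mu_ fin b; split=> //.
have mm : measurable_fun setT (fun x => cpt false (u x) ^+ 2 + cpt true (u x) ^+ 2).
  by apply: measurable_funD; exact: measurable_funX.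
apply: (@le_L1 _ _ (fun x => cpt false (u x) ^+ 2 + cpt true (u x) ^+ 2)).
- exact: measurable_funX.
- apply/integrableP; split; first exact/measurable_EFinP.
  apply: le_lt_trans fin; apply: ge0_le_integral => //.
  + by apply: measurableT_comp => //; exact/measurable_EFinP.
  + exact/measurable_EFinP.
  + by move=> x _ /=; rewrite lee_fin ger0_norm// addr_ge0// sqr_ge0.
- move=> x /=; rewrite ger0_norm ?sqr_ge0//.
  by case: b; rewrite ?lerDr ?lerDl sqr_ge0.
Qed.

Lemma weak_derivativesC_meas n (u : R -> R[i]) d j : weak_derivativesC n u d -> (j <= n)%N ->
  forall b, measurable_fun setT (fun x => cpt b (d j x)).
Proof.
suff H (v : R -> R) (e : nat -> R -> R) : weak_derivatives n v e -> (j <= n)%N ->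
    measurable_fun setT (e j).
  by move=> [h1 h2] jn [] /=; [exact: (H _ _ h2 jn)|exact: (H _ _ h1 jn)].
move=> [e0 lv he]; case: j => [|j] jn; first by rewrite e0; case: lv.
by have [_ [mm _ _] _] := he j jn.
Qed.

Lemma L2_sqnorm_ge0 (u : R -> R[i]) : (0 <= L2_sqnorm u)%E.
Proof. by apply: integral_ge0 => x _; rewrite lee_fin addr_ge0// sqr_ge0. Qed.

Lemma weak_derivativesC_L2C n (u : R -> R[i]) d : weak_derivativesC n u d ->
  (\sum_(j < n.+1) L2_sqnorm (d j) < +oo)%E -> forall j, (j <= n)%N -> L2C (d j).
Proof.
move=> hd fin j jn; apply: L2_sqnorm_L2C; first exact: weak_derivativesC_meas hd jn.
apply: le_lt_trans fin; rewrite (bigD1 (Ordinal (jn : (j < n.+1)%N)))//=.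
by rewrite leeDl// sume_ge0// => i _; exact: L2_sqnorm_ge0.
Qed.

Lemma in_HsP n (u : R -> R[i]) : in_Hs n u -> exists d, [/\ weak_derivativesC n u d,
  (\sum_(j < n.+1) L2_sqnorm (d j) < +oo)%E, forall j, (j <= n)%N -> L2C (d j) & d 0%N = u].
Proof.
move=> /ereal_inf_lt[_ [d hd <-] fin]; exists d; split=> //.
  exact: weak_derivativesC_L2C hd fin.
have [[e1 _ _] [e2 _ _]] := hd; apply/funext => x; apply: cpt_eq => -[].
  exact: (congr1 (@^~ x) e2).
exact: (congr1 (@^~ x) e1).
Qed.

Lemma in_Hs_L2C n u : in_Hs n u -> L2C u.
Proof. by move=> /in_HsP[d [_ _ h <-]]; exact: h. Qed.

Lemma weak_derivativeCP (u v : R -> R[i]) b : weak_derivativeC u v ->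
  weak_derivative (fun x => cpt b (u x)) (fun x => cpt b (v x)).
Proof. by case: b => -[]. Qed.

End Components.

Section ModeEquation.
Variables (R : realType) (s : nat) (dl h : R).
Notation I0 := 'I_s.+1.
Notation V := (vec R (I0 * bool)%type).
Local Notation mu := (@lebesgue_measure R).
Notation dv := (difv s dl h).
Local Notation comp u := (fun b x => cpt b (u x)).

Definition dvecC (u : R -> R[i]) (hu : L2C u) : V := @dvec R s dl h (comp u) hu.

Lemma mulmat_dvec (e : R -> R) B
    (hM : @bounded_matrix _ I0 B (fun j i => difc s dl h e j i))
    (u v : bool -> R -> R) (hu : forall b, L2 (u b)) (hv : forall b, L2 (v b)) :
  (forall b, {ae mu, forall x, u b x = e x * v b x}) ->
  forall p : I0 * bool,
    {ae mu, forall x, (dvec s dl h hu : V) p x = mulmat hM (dvec s dl h hv) p x}.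
Proof.
move=> E [j b]; apply: (ae_imp (difv_ae s dl h j (E b))) => x hx.
rewrite dvecE mulmatE hx difv_mul; last by rewrite -ltnS.
by apply: eq_bigr => i _; rewrite dvecE.
Qed.

(** The multiplication by the imaginary unit, on components. *)
Definition Jb (u : bool -> R -> R) (b : bool) (x : R) : R :=
  if b then u false x else - u true x.

Lemma Jb_L2 u : (forall b, L2 (u b)) -> forall b, L2 (Jb u b).
Proof. by move=> hu [] /=; [exact: (hu false)|exact: L2N (hu true)]. Qed.

Lemma dvec_J u (hu : forall b, L2 (u b)) (hJ : forall b, L2 (Jb u b)) :
  dvec s dl h hJ = Jv (dvec s dl h hu) :> V.
Proof.
apply: vecP => -[j b] x; rewrite JvE !dvecE; case: b => //=.
rewrite /Jb/= -mulN1r -difvZ; congr (difv _ _ _ _ _ _); apply/funext => y.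
by rewrite mulN1r.
Qed.

Lemma dvec_lin (a : R) u v w (hu : forall b, L2 (u b)) (hv : forall b, L2 (v b))
    (hw : forall b, L2 (w b)) : (forall b x, w b x = a * u b x + v b x) ->
  dvec s dl h hw = a *: dvec s dl h hu + dvec s dl h hv :> V.
Proof.
move=> E; apply: vecP => -[j b] x; rewrite vecE !dvecE -difv_lin.
by congr (difv _ _ _ _ _ _); apply/funext => y.
Qed.

Variables (k c B K : R) (g : R -> R) (e : nat -> R -> R).
Hypotheses (k0 : k != 0) (c0 : 0 < c).
Hypothesis he : regular s.+1 K e.
Hypothesis ec : forall x, c <= e 0%N x.
Hypothesis ge : {ae mu, forall x, g x = e 0%N x}.
Hypothesis hG : @bounded_matrix _ I0 B (fun j i => difc s dl h (e 0%N) j i).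

Let cpt_shift b (gy t : R) (z u : R[i]) :
  cpt b (gy%:C%C * ((k^-1)%:C%C * z - 'i%C * t%:C%C * u)) =
  gy * (k^-1 * cpt b z - t * (if b then cpt false u else - cpt true u)).
Proof.
by rewrite cptZ cptD cptZ cptN -mulrA cpti !cptZ; case: b => //; rewrite mulrN.
Qed.

(** The function v1 and its derivative turn out to be square integrable: the weak
    derivative of Phi is unique, and dividing by g recovers the derivative of v1
    from w + Phi. *)
Lemma stream_elliptic (w Phi : R -> R[i]) (t : R) (hw : L2C w) (hPhi : L2C Phi) :
  stream_function g k t w Phi ->
  elliptic_at ip (@Jv R I0) (der k) (mulmat hG) t (dvecC hw) (dvecC hPhi).
Proof.
move=> [/in_HsP[d [hd _ dL2 d0]] [v1 [v2 [[du hdu E1] [dv1 hdv1 E2] E3]]]].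
have me : measurable_fun setT (e 0%N) by have [m _ _] := he; exact: m.
have be x : `|e 0%N x| <= K by have [_ m _] := he; exact: m.
have mcpt (u u' : R -> R[i]) b : weak_derivativeC u u' ->
    measurable_fun setT (fun x => cpt b (u x)) /\ measurable_fun setT (fun x => cpt b (u' x)).
  by move=> /weak_derivativeCP -/(_ b) [[m1 _ _] [m2 _ _] _].
have Ldu b : L2 (fun x => cpt b (du x)).
  have hd1 : weak_derivative (fun x => cpt b (Phi x)) (fun x => cpt b (d 1%N x)).
    rewrite -d0; have [[_ _ w1] [_ _ w2]] := hd.
    by case: b; [exact: (w2 0%N)|exact: (w1 0%N)].
  apply: (ae_L2 (dL2 1%N isT b) (mcpt Phi du b hdu).2).
  exact: weak_derivative_unique hd1 (weak_derivativeCP b hdu).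
pose X b x := k^-1 * cpt b (du x) - t * Jb (comp Phi) b x.
have hX0 b : L2 (fun x => k^-1 * cpt b (du x)) by exact: L2Z.
have hX b : L2 (X b).
  rewrite /X; under eq_fun do rewrite addrC -mulNr.
  exact: (L2_lin _ (Jb_L2 hPhi b) (hX0 b)).
have E1' b : {ae mu, forall x, cpt b (v1 x) = e 0%N x * X b x}.
  by apply: (ae_imp (ae_and E1 ge)) => x [-> <-]; rewrite cpt_shift.
have Lv1 b : L2 (fun x => cpt b (v1 x)).
  have [L _] := L2_bounded me be (hX b).
  apply: (ae_L2 L (mcpt _ _ b hdv1).1).
  by apply: (ae_imp (E1' b)) => x ->.
have wP b : L2 (fun x => cpt b (w x) + cpt b (Phi x)) by exact: L2D.
have mr : measurable_fun setT (fun x => (e 0%N x)^-1).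
  have [_ b1 p] := he.
  exact: (Prim_meas (Prim_recip c0 ec (fun x => b1 1%N x isT) (p 0%N isT))).
have br x : `|(e 0%N x)^-1| <= c^-1.
  have ex := lt_le_trans c0 (ec x).
  by rewrite normfV gtr0_norm// lef_pV2 ?posrE.
pose Y b x := k^-1 * cpt b (dv1 x) - t * Jb (comp v1) b x.
have E2' b : {ae mu, forall x, cpt b (w x) + cpt b (Phi x) = e 0%N x * Y b x}.
  apply: (ae_imp (ae_and E3 (ae_and E2 ge))) => x [<- [-> <-]].
  by rewrite cptD cptN cpt_shift addrAC addNr add0r.
have Ldv b : L2 (fun x => k^-1 * cpt b (dv1 x)).
  have [L _] := L2_bounded mr br (wP b).
  have L' := L2_lin t (Jb_L2 Lv1 b) L.
  apply: (ae_L2 L').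
    by apply: measurable_funM => //; exact: (mcpt _ _ b hdv1).2.
  apply: (ae_imp (E2' b)) => x ->.
  rewrite mulrA mulVf ?mul1r /Y; last by rewrite gt_eqF// (lt_le_trans c0).
  by rewrite addrC subrK.
have hY b : L2 (Y b).
  rewrite /Y; under eq_fun do rewrite addrC -mulNr.
  exact: (L2_lin _ (Jb_L2 Lv1 b) (Ldv b)).
have kk x : k * (k^-1 * x) = x by rewrite mulrA divff// mul1r.
have derk (u u' : R -> R[i]) (hu : forall b, L2 (fun x => cpt b (u x)))
    (hu' : forall b, L2 (fun x => k^-1 * cpt b (u' x))) : weak_derivativeC u u' ->
    der k (@dvec R s dl h _ hu) (@dvec R s dl h _ hu').
  move=> wd.
  have /choice[u1 hu1] b : exists u1 : R -> R, Prim u1 (fun x => cpt b (u' x)) /\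
      {ae mu, forall x, cpt b (u x) = u1 x}.
    by have [u1 h1 h2] := weak_derivative_Prim (weak_derivativeCP b wd); exists u1.
  apply: (@dvec_der _ _ _ _ _ _ _ u1) => b; last exact: (hu1 b).2.
  by under [X in Prim _ X]eq_fun do rewrite kk; exact: (hu1 b).1.
have EX hu (hu' : forall b, L2 (fun x => k^-1 * cpt b (hu x))) u (hu0 : L2C u)
    (Z : bool -> R -> R) (hZ : forall b, L2 (Z b)) :
    (forall b x, Z b x = k^-1 * cpt b (hu x) - t * Jb (comp u) b x) ->
    dvec s dl h hZ = @dvec R s dl h _ hu' - t *: Jv (dvecC hu0) :> V.
  move=> EZ; rewrite /dvecC -(dvec_J _ (Jb_L2 hu0)) addrC -scaleNr.
  by apply: dvec_lin => b x; rewrite EZ; ring.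
exists (dvec s dl h hX0), (@dvecC v1 Lv1), (dvec s dl h Ldv); split.
- exact: derk.
- exact: derk.
- move=> z; rewrite -(EX _ _ _ _ X hX)//; apply: ip_ae => p.
  exact: (mulmat_dvec hG (u := comp v1)).
- move=> z; rewrite -(EX _ _ _ _ Y hY)//.
  rewrite -(ip_ae z (mulmat_dvec hG wP hY E2')).
  rewrite (@dvec_lin 1 (comp Phi) (comp w) _ hPhi hw); last by move=> b x; rewrite mul1r addrC.
  by rewrite scale1r (form_Dl (@ip_linE _ _)) addrAC subrr add0r.
Qed.

End ModeEquation.

(** * Stability of a mode *)

Section ModeDifferences.
Variables (R : realType) (s : nat) (c K lam : R).
Hypotheses (c0 : 0 < c) (K0 : 0 <= K) (lam0 : 0 <= lam).
Notation I0 := 'I_s.+1.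
Notation V := (vec R (I0 * bool)%type).
Local Notation mu := (@lebesgue_measure R).
Local Notation comp u := (fun b x => cpt b (u x)).

Definition difnorm (dl h : R) (u : R -> R[i]) : R :=
  \sum_(j < s.+1) \sum_b dot (difv s dl h (fun x => cpt b (u x)) j)
                             (difv s dl h (fun x => cpt b (u x)) j).

Lemma difnormE dl h u (hu : L2C u) :
  difnorm dl h u = ip (dvecC s dl h hu) (dvecC s dl h hu).
Proof.
by rewrite ip_pair; apply: eq_bigr => j _; rewrite big_bool/= addrC.
Qed.

Lemma difcZ dl h (a : R) (e : R -> R) j i x :
  difc s dl h (fun y => a * e y) j i x = a * difc s dl h e j i x.
Proof.
rewrite /difc mulrCA; congr (_ * _).
have E y : iter (j - i) (dif (dl / h) h) (fun y => a * e y) y =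
    a * iter (j - i) (dif (dl / h) h) e y.
  by elim: (j - i)%N y => //= m ih y; rewrite /dif !ih; ring.
exact: E.
Qed.

(** Differences are bounded on L2, so that they commute with time derivatives. *)
Lemma mode_tder dl h k BF (f : R -> R) (ef : R -> R) (M : R) (w : R -> R -> R[i]) (Phi : R -> R[i]) t
    (hw : forall t, L2C (w t)) (hPhi : L2C Phi)
    (hF : @bounded_matrix _ I0 BF (fun j i x => k^-1 * difc s dl h ef j i x)) :
  measurable_fun setT f -> measurable_fun setT ef -> (forall x, `|ef x| <= M) ->
  {ae mu, forall x, f x = ef x} ->
  L2_time_derivative w t (fun y => 'i%C * (f y)%:C%C / k%:C%C * Phi y) ->
  tder ip (fun t => dvecC s dl h (hw t)) (Jv (mulmat hF (dvecC s dl h hPhi))) t.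
Proof.
move=> mf me be fe lim.
set v := fun y => _ * Phi y in lim.
have vE b x : cpt b (v x) = k^-1 * f x * Jb (comp Phi) b x.
  have -> : v x = 'i%C * ((f x)%:C%C * ((k^-1)%:C%C * Phi x)) by rewrite /v -!mulrA fmorphV.
  by rewrite cpti !cptZ /Jb; case: b; ring.
have hFE j i x : difc s dl h (fun y => k^-1 * ef y) j i x = k^-1 * difc s dl h ef j i x.
  exact: difcZ.
have hF' : @bounded_matrix _ I0 BF (fun j i => difc s dl h (fun y => k^-1 * ef y) j i).
  move=> j i; have [m b] := hF j i; split; last by move=> x; rewrite hFE.
  by move: m; congr measurable_fun; apply/funext => x; rewrite hFE.
have LJ := Jb_L2 hPhi.
have vae b : {ae mu, forall x, cpt b (v x) = k^-1 * ef x * Jb (comp Phi) b x}.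
  by apply: (ae_imp fe) => x fx; rewrite vE fx.
have hv : L2C v.
  move=> b; have [L _] := L2_bounded me be (LJ b).
  apply: (ae_L2 (L2Z k^-1 L)).
    under eq_fun do rewrite vE.
    by apply: measurable_funM; [exact: measurable_funM|exact: (LJ b).1].
  by apply: (ae_imp (vae b)) => x ->; rewrite mulrA.
have hZ th : L2C (fun y => (th^-1)%:C%C * (w (t + th) y - w t y) - v y).
  move=> b; under eq_fun do rewrite cptD cptN cptZ cptD cptN.
  exact: (L2_lin _ (L2D (hw _ b) (L2N (hw _ b))) (L2N (hv b))).
rewrite /L2_time_derivative in lim.
pose S th := \sum_b dot (fun x => cpt b ((th^-1)%:C%C * (w (t + th) x - w t x) - v x))
    (fun x => cpt b ((th^-1)%:C%C * (w (t + th) x - w t x) - v x)).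
have {}lim : S @ 0^' --> (0 : R).
  have -> : S = fine \o (fun th : R => L2_sqnorm (fun y => (th^-1)%:C%C * (w (t + th) y - w t y) - v y)).
    by apply/funext => th; rewrite /= (L2_sqnormE (hZ th)).
  exact: fine_cvg lim.
have [C C0 hC] := @dvec_le R s dl h.
have limC : (fun th => C * S th) @ 0^' --> (0 : R).
  rewrite -[X in _ --> X](mulr0 C); apply: cvgM; first exact: cvg_cst.
  exact: lim.
rewrite /tder; apply: (@squeeze_cvgr _ _ _ _ (fun=> 0) (fun th => C * S th)); last first.
- exact: limC.
- exact: cvg_cst.
apply: nearW => th; rewrite ip_ge0E/=.
apply: (@le_trans _ _ _ _ _ _ (hC _ (hZ th))).
set A := (X in ip X X <= _).
suff -> : ip A A = ip (dvecC s dl h (hZ th)) (dvecC s dl h (hZ th)) by [].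
have E : forall p : I0 * bool, {ae mu, forall x, A p x = (dvecC s dl h (hZ th) : V) p x}.
  move=> p; have := mulmat_dvec hF' hv LJ.
  move=> /(_ _ p) ae1.
  have {}ae1 : {ae mu, forall x, (dvecC s dl h hv : V) p x = mulmat hF' (dvec s dl h LJ) p x}.
    by apply: ae1 => b; exact: vae.
  apply: (ae_imp ae1) => x.
  have EZ : (dvecC s dl h (hZ th) : V) = th^-1 *: (dvecC s dl h (hw (t + th)) - dvecC s dl h (hw t)) - dvecC s dl h hv.
    have -> : dvecC s dl h (hZ th) = th^-1 *: (dvecC s dl h (hw (t + th)) - dvecC s dl h (hw t)) +
       (-1) *: dvecC s dl h hv.
      apply: vecP => -[j b] y; rewrite !(vecDE, vecZE, vecNE) !dvecE.
      have e1 (u1 u2 u3 : R -> R) : difv s dl h (fun y => th^-1 * (u1 y - u2 y) - u3 y) j y =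
          th^-1 * (difv s dl h u1 j y - difv s dl h u2 j y) + -1 * difv s dl h u3 j y.
        rewrite -!difvZ; rewrite (_ : (fun y => _) = fun y => th^-1 * (u1 y - u2 y) + -1 * u3 y); last first.
          by apply/funext => z; rewrite mulN1r.
        rewrite difv_lin !difvZ; congr (_ * _ + _).
        rewrite (_ : (fun y => u1 y - u2 y) = fun y => -1 * u2 y + u1 y); last first.
          by apply/funext => z; rewrite mulN1r addrC.
        by rewrite difv_lin mulN1r addrC.
      rewrite -e1; congr (difv _ _ _ _ _ _); apply/funext => z.
      by rewrite cptD cptN cptZ cptD cptN.
    by rewrite scaleN1r.
  rewrite EZ /A => hx; rewrite !(vecDE _ (- _)) !vecNE hx; congr (_ - _).
  rewrite -mulmat_J /dvecC -(dvec_J s dl h hPhi LJ).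
  case: p {ae1} hx => j b _; rewrite !mulmatE; apply: eq_bigr => i _.
  by rewrite hFE.
by rewrite (ip_ae _ E) ip_symE (ip_ae _ E).
Qed.

(** The vector of the differences solves the equation of the mode, with the
    matrices of the Leibniz rule in place of g and f. *)
Theorem mode_differences : exists dl eps : R, [/\ 0 < dl, dl <= 1, 0 < eps &
  forall (k h Kf : R) (g f : R -> R) (eg ef : nat -> R -> R) (w Phi : R -> R -> R[i]),
  k != 0 -> 0 < h -> `|k^-1| <= lam -> regular s.+1 K eg -> regular s.+1 Kf ef ->
  (forall x, c <= eg 0%N x /\ eg 0%N x <= c^-1) -> `|k^-1| * Kf <= eps ->
  {ae mu, forall x, g x = eg 0%N x} -> {ae mu, forall x, f x = ef 0%N x} ->
  measurable_fun setT f ->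
  (forall t, L2C (w t)) ->
  (forall t, stream_function g k t (w t) (Phi t)) ->
  (forall t, L2_time_derivative w t (fun y => 'i%C * (f y)%:C%C / k%:C%C * Phi t y)) ->
  forall t, difnorm dl h (w t) <= 2 * difnorm dl h (w 0)].
Proof.
have [dl [eps [dl0 dl1 eps0 H]]] := difference_stability s c0 K0 lam0.
exists dl, eps; split=> // k h Kf g f eg ef w Phi k0 h0 kl hg hf gc fe ge fe' mf hw st dw t.
have hPhi t' : L2C (Phi t') by have [/in_Hs_L2C] := st t'.
have bm (e : nat -> R -> R) (Ke : R) : regular s.+1 Ke e ->
    @bounded_matrix _ I0 (2 ^+ s * Ke) (fun j i => difc s dl h (e 0%N) j i).
  move=> he j i; split=> [|x]; first exact: (difc_meas dl h he).
  by apply: (difc_bound h0 (ltW dl0) dl1 he) => //; rewrite -ltnS.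
have hG := bm _ _ hg.
have hF : @bounded_matrix _ I0 (`|k^-1| * (2 ^+ s * Kf)) (fun j i x => k^-1 * difc s dl h (ef 0%N) j i x).
  move=> j i; have [m b] := bm _ _ hf j i; split; first exact: measurable_funM.
  by move=> x; rewrite normrM ler_wpM2l.
rewrite !(difnormE _ _ (hw _)).
apply: (H k h Kf eg ef (fun t => dvecC s dl h (hw t)) (fun t => dvecC s dl h (hPhi t)) _ _ hG hF) => //.
  move=> t'; apply: (stream_elliptic k0 c0 hg _ ge) => //.
  by move=> x; have [] := gc x.
move=> t'; have [me be _] := hf.
exact: (@mode_tder dl h k _ f (ef 0%N) Kf w (Phi t') t' hw (hPhi t') hF mf (me 0%N isT)
  (fun x => be 0%N x isT) fe' (dw t')).
Qed.

End ModeDifferences.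

(** * Differences of functions in H^s *)

Section DifferenceBound.
Context {R : realType}.
Local Notation mu := (@lebesgue_measure R).
Local Notation L1 f := (mu.-integrable setT (EFin \o f)).

Lemma dot_cs (f g : R -> R) : L2 f -> L2 g -> dot f g ^+ 2 <= dot f f * dot g g.
Proof.
move=> hf hg; pose v : vec R unit := mkvec (fun=> hf); pose w : vec R unit := mkvec (fun=> hg).
have := form_cs (@ip_symE R unit) (@ip_linE R unit) (@ip_ge0E R unit) v w.
by rewrite /ip !(big_pred1 tt)//; case.
Qed.

Lemma ereal_dot (f : R -> R) : L2 f -> (\int[mu]_x ((f x) ^+ 2)%:E)%E = (dot f f)%:E.
Proof.
move=> hf; rewrite /dot /Rintegral fineK.
  by apply: eq_integral => x _; rewrite expr2.
by apply: integrable_fin_num => //; exact: (L2_mul hf hf).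
Qed.

Lemma L2_indic (b h : R) : L2 (\1_`[b, h] : R -> R).
Proof.
split; first by apply: measurable_indic; exact: mcc.
have : mu.-integrable `[b, h] (EFin \o (fun=> 1 : R)).
  apply/integrableP; split; first exact/measurable_EFinP.
  by rewrite integral_cst//= lebesgue_measure_itv/=; case: ifP => _;
    rewrite ?mule0 ?ltry// normr1 mul1e -EFinB ltry.
move/(L1_cut _ (mcc b h)); congr integrable; apply/funext => x /=.
by rewrite indicE; case: (_ \in _); rewrite ?mul1r ?mulr1 ?mulr0 ?expr0n ?expr1n.
Qed.

Lemma dot_indic (h : R) : 0 <= h -> dot (\1_`[0, h]) (\1_`[0, h]) = h.
Proof.
move=> h0; rewrite /dot -(int_cut `[0, h] (\1_`[0, h])).
under eq_Rintegral => x xh do rewrite indicE xh.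
rewrite Rintegral_cst//= lebesgue_measure_itv/= lte_fin.
case: ltgtP h0 => // [_ _|<- _]; last by rewrite mulr0.
by rewrite oppr0 addr0 mul1r.
Qed.

Lemma dif_int (a h : R) (u v : R -> R) x : 0 < h -> Prim u v ->
  dif a h u x = a * \int[mu]_(y in `[0, h]) v (x + y).
Proof.
move=> h0 p; rewrite /dif; congr (_ * _).
have [_ /(_ 0 h (ltW h0))[_]] := Prim_shift x p.
rewrite add0r (addrC h) => ->; apply: eq_Rintegral => y _.
by rewrite addrC.
Qed.

(** The increment over an interval of length h is an integral of translates of
    the derivative; Cauchy-Schwarz and Tonelli bound its norm. *)
Lemma dot_dif_le (a h : R) (u v : R -> R) : 0 < h -> Prim u v -> L2 u -> L2 v ->
  dot (dif a h u) (dif a h u) <= (a * h) ^+ 2 * dot v v.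
Proof.
move=> h0 p hu hv; have [hd _] := dif_L2 h a hu.
rewrite -lee_fin -ereal_dot//.
pose F (q : R * R) : \bar R := (a ^+ 2 * h * (v (q.1 + q.2) ^+ 2 * \1_`[0, h] q.2))%:E.
have mv := hv.1.
have m1 : measurable_fun setT (fun y : R => (\1_`[0, h] y : R)).
  by apply: measurable_indic; exact: mcc.
have mF : measurable_fun setT F.
  apply/measurable_EFinP; apply: measurable_funM => //; apply: measurable_funM.
    apply: measurable_funX; apply: (measurableT_comp mv).
    by apply: measurable_funD; [exact: measurable_fst|exact: measurable_snd].
  by apply: (measurableT_comp m1); exact: measurable_snd.
have a2h : 0 <= a ^+ 2 * h by rewrite mulr_ge0 ?sqr_ge0// ltW.
have F0 q : (0 <= F q)%E by rewrite lee_fin mulr_ge0// mulr_ge0 ?sqr_ge0// indicE.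
have shL (x : R) : L2 (fun y => v (x + y)).
  have := L2_iso (iso_shift x) hv; congr L2; apply/funext => y /=; by rewrite addrC.
have cut (x : R) : L1 (fun y => v (x + y) ^+ 2 * \1_`[0, h] y).
  apply/(L1_cut _ (mcc 0 h)); apply: (integrableS _ _ _ (shL x).2) => //; exact: mcc.
apply: (@le_trans _ _ (\int[mu]_x \int[mu]_y F (x, y))%E).
  apply: ge0_le_integral => //.
  - by move=> x _; rewrite lee_fin sqr_ge0.
  - by apply/measurable_EFinP; apply: measurable_funX; exact: hd.1.
  - exact: (@measurable_fun_fubini_tonelli_F _ _ (measurableTypeR R) (measurableTypeR R) R mu _ mF).
  - move=> x _; rewrite /F/=.
    have -> : (\int[mu]_y (a ^+ 2 * h * (v (x + y) ^+ 2 * \1_`[0, h] y))%:E =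
       (a ^+ 2 * h * \int[mu]_y (v (x + y) ^+ 2 * \1_`[0, h] y))%:E)%E.
      rewrite -RintegralZl//.
      rewrite /Rintegral fineK//; apply: integrable_fin_num => //.
      exact: (L1Z _ (cut x)).
    rewrite lee_fin (dif_int _ _ h0 p) exprMn -mulrA ler_wpM2l ?sqr_ge0//.
    have L1' : L2 (fun y => v (x + y) * \1_`[0, h] y).
      have := (L2_bounded m1 _ (shL x) (K := 1)).1; under [X in _ -> L2 X]eq_fun do rewrite mulrC; apply.
      by move=> y; rewrite indicE; case: (_ \in _); rewrite ?normr1 ?normr0.
    have := dot_cs L1' (L2_indic 0 h); rewrite dot_indic ?(ltW h0)// mulrC.
    congr (_ ^+ 2 <= h * _).
      rewrite int_cut; apply: eq_Rintegral => y _; rewrite indicE.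
      by case: (_ \in _); rewrite ?mulr1 ?mulr0.
    apply: eq_Rintegral => y _; rewrite indicE.
    by case: (_ \in _); rewrite ?mulr1 ?mulr0 ?expr2.
rewrite (@fubini_tonelli _ _ (measurableTypeR R) (measurableTypeR R) R mu mu F mF F0).
have -> : (\int[mu]_y \int[mu]_x F (x, y) = \int[mu]_y (a ^+ 2 * h * dot v v * (\1_`[0, h] y * \1_`[0, h] y))%:E)%E.
  apply: eq_integral => y _; rewrite /F/=.
  have i2 : L1 (fun x => v (x + y) ^+ 2) by exact: (L2_iso (iso_shift y) hv).2.
  transitivity ((a ^+ 2 * h * \1_`[0, h] y) * \int[mu]_x (v (x + y) ^+ 2))%:E.
    rewrite -RintegralZl//= /Rintegral fineK.
      by apply: eq_integral => x _; congr EFin; ring.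
    apply: integrable_fin_num => //; exact: (L1Z _ i2).
  congr EFin; have -> : \int[mu]_x (v (x + y) ^+ 2) = dot v v.
    rewrite -(dot_iso (iso_shift y) hv hv); apply: eq_Rintegral => x _; by rewrite expr2.
  by rewrite indicE; case: (_ \in _); rewrite ?mulr1 ?mulr0 ?mul0r.
have E := dot_indic (ltW h0); rewrite /dot in E.
have -> : (\int[mu]_y (a ^+ 2 * h * dot v v * (\1_`[0, h] y * \1_`[0, h] y))%:E =
    (a ^+ 2 * h * dot v v * \int[mu]_y (\1_`[0, h] y * \1_`[0, h] y))%:E)%E.
  have ii := L2_mul (L2_indic 0 h) (L2_indic 0 h).
  rewrite -RintegralZl// /Rintegral fineK//; apply: integrable_fin_num => //; exact: (L1Z _ ii).
by rewrite E lee_fin le_eqVlt; apply/orP; left; apply/eqP; ring.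
Qed.

(** Weak differentiability, in a form that differences preserve. *)
Definition aePrim (u v : R -> R) :=
  exists2 u1, Prim u1 v & {ae mu, forall x, u x = u1 x}.

Lemma aePrim_dif (a h : R) (u v : R -> R) : aePrim u v -> aePrim (dif a h u) (dif a h v).
Proof.
move=> [u1 p e]; exists (dif a h u1); first exact: Prim_dif.
exact: (dif_ae h 1 a e).
Qed.

Lemma dot_dif_ae (a h : R) (u v : R -> R) : 0 < h -> aePrim u v -> L2 u -> L2 v ->
  dot (dif a h u) (dif a h u) <= (a * h) ^+ 2 * dot v v.
Proof.
move=> h0 [u1 p e] hu hv; have hu1 := ae_L2 hu (Prim_meas p) e.
have [Lu _] := dif_L2 h a hu; have [Lu1 _] := dif_L2 h a hu1.
have ed := dif_ae h 1 a e.
rewrite (dot_ae Lu.1 Lu1.1 Lu.1 ed) dotC (dot_ae Lu.1 Lu1.1 Lu1.1 ed).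
exact: dot_dif_le.
Qed.

Lemma dot_difj_le (a h : R) j (d : nat -> R -> R) : 0 < h ->
  (forall i, (i <= j)%N -> L2 (d i)) -> (forall i, (i < j)%N -> aePrim (d i) (d i.+1)) ->
  dot (iter j (dif a h) (d 0%N)) (iter j (dif a h) (d 0%N)) <= (a * h) ^+ 2 ^+ j * dot (d j) (d j).
Proof.
move=> h0; elim: j d => [|j ih] d dL dP; first by rewrite mul1r.
rewrite iterSr.
apply: (le_trans (ih (fun i => dif a h (d i)) _ _)).
- by move=> i ij; have [] := dif_L2 h a (dL i (leqW ij)).
- by move=> i ij; apply: aePrim_dif; apply: dP; exact: leqW.
rewrite (exprSr (_ ^+ 2) j) -(mulrA (_ ^+ j)) ler_wpM2l//.
  by apply: exprn_ge0; exact: sqr_ge0.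
by apply: dot_dif_ae => //; [exact: dP|exact: dL|exact: dL].
Qed.

End DifferenceBound.

(** * Almost shortest convex combinations *)

Section ConvexHull.
Variables (R : realType) (V : lmodType R) (ip : V -> V -> R).
Hypothesis ipC : forall u v, ip u v = ip v u.
Hypothesis ipL : forall (a : R) u v w, ip (a *: u + v) w = a * ip u w + ip v w.
Hypothesis ip0 : forall u, 0 <= ip u u.

Variables (x : nat -> V) (M : R).
Hypothesis xM : forall n, ip (x n) (x n) <= M.

Definition midclosed (P : V -> Prop) :=
  forall u v, P u -> P v -> P (2^-1 *: (u + v)).

(** The combinations of the n-th tail with dyadic coefficients, as an intersection;
    midpoints are all that the parallelogram identity uses. *)
Definition hull (n : nat) (v : V) := forall P : V -> Prop,
  (forall m, (n <= m)%N -> P (x m)) -> midclosed P -> P v.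

Let ipE := (form_Dl ipL, form_Dr ipC ipL, form_Nl ipL, form_Nr ipC ipL,
  form_Zl ipL, form_Zr ipC ipL).

(** The parallelogram identity. *)
Lemma mid_norm u v : ip (2^-1 *: (u + v)) (2^-1 *: (u + v)) =
  2^-1 * ip u u + 2^-1 * ip v v - 2^-1 ^+ 2 * ip (u - v) (u - v).
Proof. by rewrite !ipE (ipC v u); field. Qed.

Lemma hull_mid n : midclosed (hull n).
Proof. by move=> u v hu hv P h1 h2; exact: (h2 _ _ (hu P h1 h2) (hv P h1 h2)). Qed.

Lemma hull_le m n v : (m <= n)%N -> hull n v -> hull m v.
Proof. by move=> mn h P h1; apply: h => k nk; apply: h1; rewrite (leq_trans mn). Qed.

Lemma hull_x n : hull n (x n).
Proof. by move=> P h1 _; exact: h1. Qed.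

Lemma hull_ball n v : hull n v -> ip v v <= M.
Proof.
move=> /(_ (fun v => ip v v <= M)); apply=> [m _|u w hu hw]; first exact: xM.
rewrite mid_norm; have : 0 <= 2^-1 ^+ 2 * ip (u - w) (u - w) by rewrite mulr_ge0 ?sqr_ge0.
lra.
Qed.

Let E n : set R := [set r | exists2 v, hull n v & r = ip v v].
Let dlt n := inf (E n).

Let E_inf n : has_inf (E n).
Proof.
split; first by exists (ip (x n) (x n)), (x n) => //; exact: hull_x.
by exists 0 => _ [v _ ->].
Qed.

Let dlt_le n v : hull n v -> dlt n <= ip v v.
Proof. by move=> hv; apply: (ge_inf (E_inf n).2); exists v. Qed.

Let Es : has_sup (range dlt).
Proof.
split; first by exists (dlt 0%N), 0%N.
exists M => _ [n _ <-]; exact: le_trans (dlt_le (@hull_x n)) (xM n).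
Qed.

(** Almost shortest elements of the hulls of the tails form a Cauchy sequence,
    by the parallelogram identity. *)
Lemma hull_cauchy (e : nat -> R) : (forall k, 0 < e k) -> (forall k, e k.+1 <= e k) ->
  exists z : nat -> V, forall k, hull k (z k) /\ ip (z k.+1 - z k) (z k.+1 - z k) <= 8 * e k.
Proof.
move=> e0 e1; pose D := sup (range dlt).
have /choice[N hN] k : exists n, D - e k < dlt n.
  by have [_ [n _ <-] h] := sup_adherent (e0 k) Es; exists n.
have mono m n : (m <= n)%N -> dlt m <= dlt n.
  move=> mn; apply: lb_le_inf; first exact: (E_inf n).1.
  by move=> _ [v hv ->]; exact: (dlt_le (hull_le mn hv)).
have /choice[z hz] k : exists v, hull (maxn k (N k)) v /\ ip v v < D + e k.
  have [_ [v hv ->] h] := inf_adherent (e0 k) (E_inf (maxn k (N k))).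
  exists v; split=> //; apply: (lt_le_trans h); rewrite lerD2r.
  by apply: (ub_le_sup Es.2); exists (maxn k (N k)).
have low k v : hull (maxn k (N k)) v -> D - e k <= ip v v.
  move=> hv; apply: (le_trans (ltW (hN k))); apply: (le_trans _ (dlt_le hv)).
  by apply: mono; rewrite leq_maxr.
exists z => k; split; first exact: (hull_le (leq_maxl _ _) (hz k).1).
have midlow : D - e k <= ip (2^-1 *: (z k.+1 + z k)) (2^-1 *: (z k.+1 + z k)).
  case: (leqP (maxn k.+1 (N k.+1)) (maxn k (N k))) => le.
    apply: (@le_trans _ _ (D - e k.+1)); first by rewrite lerD2l lerN2.
    by apply: low; apply: hull_mid; [exact: (hz k.+1).1|exact: (hull_le le (hz k).1)].
  by apply: low; apply: hull_mid; [exact: (hull_le (ltnW le) (hz k.+1).1)|exact: (hz k).1].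
have := hz k => -[_ h1]; have := hz k.+1 => -[_ h2]; have h3 := e1 k.
by move: midlow; rewrite mid_norm; move: (ip (z k.+1 - z k) _) => q; lra.
Qed.

End ConvexHull.

Section HalfPowers.
Context {R : realType}.

Lemma half_powers (a b C : R) : (forall k : nat, a <= b + C * 2^-1 ^+ k) -> a <= b.
Proof.
move=> h; have lim : (fun k : nat => b + C * 2^-1 ^+ k) @ \oo --> (b + 0 : R).
  apply: cvgD; first exact: cvg_cst.
  by apply: cvg_geometric; rewrite ger0_norm// invf_lt1// ltr1n.
rewrite addr0 in lim; rewrite -(cvg_lim _ lim)//; apply: limr_ge; [by apply/cvg_ex; exists b|exact: nearW].
Qed.

(** u k - 2 c 2^-k increases, u k + 2 c 2^-k decreases. *)
Lemma half_cauchy (u : nat -> R) (c : R) : 0 <= c ->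
  (forall k, `|u k.+1 - u k| <= c * 2^-1 ^+ k) ->
  exists l, forall k, `|l - u k| <= 2 * c * 2^-1 ^+ k.
Proof.
move=> c0 hu; pose a k := u k - 2 * c * 2^-1 ^+ k; pose b k := u k + 2 * c * 2^-1 ^+ k.
have p0 k : 0 <= c * 2^-1 ^+ k by rewrite mulr_ge0// exprn_ge0.
have step k : a k <= a k.+1 /\ b k.+1 <= b k.
  have := hu k; rewrite ler_norml /a /b exprS; have := p0 k.
  have -> : 2 * c * (2^-1 * 2^-1 ^+ k) = c * 2^-1 ^+ k by field.
  rewrite -!mulrA; move: (c * _) (u k) (u k.+1) => q u1 u2 _ /andP[]; lra.
have am k n : a k <= a (k + n)%N.
  by elim: n => [|n ih]; rewrite ?addn0// addnS (le_trans ih)// (step _).1.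
have bm k n : b (k + n)%N <= b k.
  by elim: n => [|n ih]; rewrite ?addn0// addnS (le_trans _ ih)// (step _).2.
have ab k : a k <= b k by rewrite /a /b -!mulrA; have := p0 k; lra.
have abm k n : a k <= b n.
  apply: (le_trans (am k n)); apply: (le_trans (ab _)); rewrite addnC; exact: bm.
have hs : has_sup (range a).
  by split; [exists (a 0%N), 0%N|exists (b 0%N) => _ [k _ <-]].
exists (sup (range a)) => k.
have h1 : a k <= sup (range a) by apply: (ub_le_sup hs.2); exists k.
have h2 : sup (range a) <= b k by apply: (ge_sup hs.1) => _ [n _ <-].
by rewrite ler_norml; move: h1 h2; rewrite /a /b; lra.
Qed.

End HalfPowers.

(** * Completeness of L2 and weak limits *)

Section Completeness.
Context {R : realType}.
Local Notation mu := (@lebesgue_measure R).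
Local Notation L1 f := (mu.-integrable setT (EFin \o f)).

(** Weighting the squared increments makes their series integrable, hence
    finite almost everywhere, and this series dominates the errors. *)
Lemma L2_complete (z : nat -> R -> R) : (forall k, L2 (z k)) ->
  (forall k, dot (fun x => z k.+1 x - z k x) (fun x => z k.+1 x - z k x)
     <= (4 * 4) ^- k / 2) ->
  exists2 l, L2 l & forall k,
    dot (fun x => l x - z k x) (fun x => l x - z k x) <= (2 * 2^-1 ^+ k) ^+ 2.
Proof.
move=> zL hz; pose g k x := z k.+1 x - z k x.
have gL k : L2 (g k) by apply: L2D => //; exact: L2N.
(* The weight 4 ^ k still leaves the summable bound 4 ^- k / 2, and 2 ^- k sqrt S
   bounds the k-th increment. *)
pose F k x : \bar R := (4 ^+ k * g k x ^+ 2)%:E.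
pose S x := (\sum_(0 <= k <oo) F k x)%E.
have F0 k x : (0 <= F k x)%E by rewrite lee_fin mulr_ge0 ?sqr_ge0 ?exprn_ge0.
have mF k : measurable_fun setT (F k).
  apply/measurable_EFinP; apply: measurable_funM => //; apply: measurable_funX.
  exact: (gL k).1.
have S0 x : (0 <= S x)%E by apply: nneseries_ge0 => k _ _.
have FS k x : (F k x <= S x)%E.
  apply: le_trans (nneseries_lim_ge k.+1 _) => [|n _ _]; last exact: F0.
  by rewrite big_nat_recr//= leeDr// sume_ge0.
have mS : measurable_fun setT S.
  exact: (@ge0_emeasurable_sum _ _ _ setT F xpredT).
have SI : (\int[mu]_x S x <= 1)%E.
  rewrite integral_nneseries//; apply: le_trans (epsilon_trick0 xpredT (@ler01 R)).
  apply: lee_nneseries => [k _ _|k _]; first by apply: integral_ge0.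
  have -> : (\int[mu]_x F k x = (4 ^+ k * dot (g k) (g k))%:E)%E.
    rewrite /F EFinM -ereal_dot// -ge0_integralZl ?lee_fin ?exprn_ge0//.
    - by apply/measurable_EFinP; apply: measurable_funX; exact: (gL k).1.
    - by move=> x _; rewrite lee_fin sqr_ge0.
  rewrite lee_fin (le_trans (ler_wpM2l _ (hz k)))// ?exprn_ge0//.
  rewrite div1r expnS natrM natrX invfM exprMn invfM !mulrA divff ?expf_neq0// mul1r mulrC.
  rewrite ler_wpM2l// lef_pV2 ?posrE ?exprn_gt0//.
  by rewrite lerXn2r ?nnegrE ?ler_nat.
have iS : mu.-integrable setT S.
  apply/integrableP; split=> //; under eq_integral do rewrite gee0_abs//.
  by apply: le_lt_trans SI _; rewrite ltry.
have [N [mN N0 NS]] := integrable_ae measurableT iS.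
pose s x := if x \in N then 0 else fine (S x).
have NS' x : x \notin N -> (S x = (s x)%:E)%E.
  move=> xN; rewrite /s (negbTE xN) fineK//; apply/negP => /negP fS.
  move: xN; rewrite notin_setE; apply; apply: NS => /= h; move/negP: fS; apply; exact: h.
have s0 x : 0 <= s x by rewrite /s; case: ifP => // _; exact: fine_ge0.
pose zE k x := z k x * \1_(~` N) x.
have gs k x : x \notin N -> `|g k x| <= Num.sqrt (s x) * 2^-1 ^+ k.
  move=> xN; have := FS k x; rewrite NS'// lee_fin => h.
  rewrite -[leLHS](ger0_norm (normr_ge0 _)) normr_id -ler_sqr ?nnegrE ?mulr_ge0 ?sqrtr_ge0 ?exprn_ge0//.
  rewrite real_normK ?num_real// exprMn sqr_sqrtr// exprAC.
  rewrite (_ : 2^-1 ^+ 2 = 4^-1); last by rewrite expr2 -invfM -natrM.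
  by rewrite exprVn ler_pdivlMr ?exprn_gt0// mulrC.
have /choice[l hl] x : exists l : R, forall k, `|l - zE k x| <= 2 * Num.sqrt (s x) * 2^-1 ^+ k.
  apply: half_cauchy; first exact: sqrtr_ge0.
  move=> k; rewrite /zE indicE in_setC; case: (boolP (x \in N)) => xN /=.
    by rewrite !mulr0 subrr normr0 mulr_ge0 ?sqrtr_ge0 ?exprn_ge0.
  by rewrite !mulr1; exact: gs.
have mzE k : measurable_fun setT (zE k).
  apply: measurable_funM; first exact: (zL k).1.
  by apply: measurable_indic; exact: measurableC.
have zEz k : {ae mu, forall x, zE k x = z k x}.
  exists N; split=> // x /= h; apply: contrapT => xN; apply: h.
  by rewrite /zE indicE in_setC memNset//= mulr1.
have ml : measurable_fun setT l.
  apply: (measurable_fun_cvg mzE) => x _; apply/cvgrPdist_le => e e0.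
  have lim : (fun k : nat => 2 * Num.sqrt (s x) * 2^-1 ^+ k) @ \oo --> (0 : R).
    by apply: cvg_geometric; rewrite ger0_norm// invf_lt1// ltr1n.
  move/cvgrPdist_le : lim => /(_ e e0); apply: filterS => k.
  rewrite sub0r normrN => h; apply: (le_trans (hl x k)); exact: le_trans (ler_norm _) h.
have ms : measurable_fun setT s.
  have -> : s = fine \o (fun x => S x * (\1_(~` N) x)%:E)%E.
    apply/funext => x; rewrite /s /= indicE in_setC.
    by case: (x \in N); rewrite ?mule0 ?mule1.
  apply: measurableT_comp => //; apply: emeasurable_funM => //.
  by apply/measurable_EFinP; apply: measurable_indic; exact: measurableC.
have sS x : ((s x)%:E <= S x)%E.
  by case: (boolP (x \in N)) => [xN|/NS' ->//]; rewrite /s xN.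
have is_ : L1 s.
  apply/integrableP; split; first exact/measurable_EFinP.
  apply: le_lt_trans (ltry 1); apply: le_trans SI.
  apply: ge0_le_integral => //.
  - by apply: measurableT_comp => //; exact/measurable_EFinP.
  - by move=> x _ /=; rewrite ger0_norm.
have sI : \int[mu]_x s x <= 1.
  rewrite -lee_fin /Rintegral fineK; last exact: integrable_fin_num.
  apply: le_trans SI; apply: ge0_le_integral => //.
  - by move=> x _; rewrite lee_fin.
  - exact/measurable_EFinP.
have errE k x : (l x - zE k x) ^+ 2 <= (2 * 2^-1 ^+ k) ^+ 2 * s x.
  have := hl x k; rewrite -ler_sqr ?nnegrE ?mulr_ge0 ?sqrtr_ge0 ?exprn_ge0//.
  rewrite real_normK ?num_real// => /le_trans; apply.
  by rewrite -mulrA (mulrC (Num.sqrt _)) mulrA exprMn sqr_sqrtr.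
have errL k : L2 (fun x => l x - zE k x).
  split; first exact: measurable_funB.
  apply: (le_L1 _ (L1Z ((2 * 2^-1 ^+ k) ^+ 2) is_)).
    by apply: measurable_funX; exact: measurable_funB.
  by move=> x; rewrite ger0_norm ?sqr_ge0.
have zEL k : L2 (zE k).
  apply: (ae_L2 (zL k)) => //; apply: (ae_imp (zEz k)) => x ->//.
have lL : L2 l.
  have := L2D (errL 0%N) (zEL 0%N); congr L2; apply/funext => x.
  by rewrite subrK.
exists l => // k.
have errL' : L2 (fun x => l x - z k x) by apply: L2D => //; exact: L2N.
have aeE : {ae mu, forall x, l x - z k x = l x - zE k x}.
  by apply: (ae_imp (zEz k)) => x ->.
rewrite (dot_ae errL'.1 (errL k).1 errL'.1 aeE) dotC (dot_ae errL'.1 (errL k).1 (errL k).1 aeE).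
apply: (@le_trans _ _ ((2 * 2^-1 ^+ k) ^+ 2 * \int[mu]_x s x)); last first.
  by rewrite -[leRHS]mulr1 ler_wpM2l ?sqr_ge0.
rewrite -RintegralZl//; apply: le_Rintegral => //.
- exact: (L2_mul (errL k) (errL k)).
- exact: (L1Z _ is_).
- by move=> x _; rewrite -expr2; exact: errE.
Qed.

End Completeness.

Section WeakLimit.
Context {R : realType}.
Local Notation mu := (@lebesgue_measure R).
Notation V := (vec R unit).

Let vip (u v : V) : ip u v = dot (u tt) (v tt).
Proof. by rewrite /ip (big_pred1 tt)//; case. Qed.

(** Almost shortest convex combinations of the tails converge strongly.  The bound
    and the proximity to the limit ell phi hold on sets stable under midpoints, so
    that the combinations inherit them. *)
Lemma weak_limit (x : nat -> R -> R) (M : R) (T : (R -> R) -> Prop) (ell : (R -> R) -> R) :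
  (forall n, L2 (x n)) -> (forall n, dot (x n) (x n) <= M) ->
  (forall phi, T phi -> L2 phi /\ (dot (x n) phi @[n --> \oo] --> ell phi)) ->
  exists l, [/\ L2 l, dot l l <= M & forall phi, T phi -> dot l phi = ell phi].
Proof.
move=> xL xM xT; pose X n : V := mkvec (fun=> xL n).
have XM n : ip (X n) (X n) <= M by rewrite vip; exact: xM.
have ipC := @ip_symE R unit; have ipL := @ip_linE R unit; have ip0 := @ip_ge0E R unit.
pose e (k : nat) : R := (4 * 4) ^- k / 2 / 8.
have e0 k : 0 < e k by rewrite !divr_gt0 ?invr_gt0 ?exprn_gt0 ?ltr0n// muln_gt0.
have e1 k : e k.+1 <= e k.
  rewrite !ler_pM2r ?invr_gt0// lef_pV2 ?posrE ?exprn_gt0 ?ltr0n// .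
  by rewrite exprS ler_peMl ?exprn_ge0//; lra.
have [z hz] := hull_cauchy ipC ipL ip0 XM e0 e1.
have zL k : L2 (z k tt) := vecL2 (z k) tt.
have [|l lL hl] := @L2_complete R (fun k => z k tt) zL.
  move=> k; have [_] := hz k; rewrite vip => /le_trans; apply.
  by rewrite /e mulrC divfK// lt0r_neq0.
pose l' : V := mkvec (fun=> lL).
have lz k : ip (l' - z k) (l' - z k) <= (2 * 2^-1 ^+ k) ^+ 2 by rewrite vip; exact: hl.
have zM k : ip (z k) (z k) <= M by exact: (hull_ball ipC ipL ip0 XM (hz k).1).
have M0 : 0 <= M by exact: le_trans (zM 0%N).
have cs (u : V) k : `|ip (l' - z k) u| <= 2 * (ip u u + 1) * 2^-1 ^+ k.
  have q0 : 0 <= (2 : R)^-1 ^+ k by rewrite exprn_ge0.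
  have u0 := ip0 u.
  rewrite -ler_sqr ?nnegrE ?mulr_ge0 ?addr_ge0// real_normK ?num_real//.
  apply: (le_trans (form_cs ipC ipL ip0 _ _)).
  have -> : (2 * (ip u u + 1) * 2^-1 ^+ k) ^+ 2 = (2 * 2^-1 ^+ k) ^+ 2 * (ip u u + 1) ^+ 2 by ring.
  apply: ler_pM => //; have : 0 <= ip u u * ip u u by exact: mulr_ge0.
  by rewrite expr2 mulrDl mulrDr mul1r mulr1; lra.
exists l; split=> //.
  have -> : dot l l = ip l' l' by rewrite vip.
  apply: (@half_powers _ _ _ (2 * (ip l' l' + 1) + 2 * (M + 1))) => k.
  have E : ip l' l' = ip (l' - z k) l' + ip (l' - z k) (z k) + ip (z k) (z k).
    rewrite !(form_Dl ipL, form_Dr ipC ipL, form_Nl ipL, form_Nr ipC ipL) (ipC (z k) l').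
    by ring.
  have h1 := le_trans (ler_norm _) (cs l' k).
  have h2 := le_trans (ler_norm _) (cs (z k) k).
  have h3 : 2 * (ip (z k) (z k) + 1) * 2^-1 ^+ k <= 2 * (M + 1) * 2^-1 ^+ k.
    by rewrite ler_wpM2r ?exprn_ge0// ler_wpM2l// lerD2r.
  have := zM k; rewrite {1}E mulrDl; lra.
move=> phi Tp; have [pL lim] := xT phi Tp; pose p : V := mkvec (fun=> pL).
have close (eps : R) : 0 < eps -> exists K, forall k, (K <= k)%N -> `|ip (z k) p - ell phi| <= eps.
  move=> eps0; have /cvgrPdist_le/(_ eps eps0)[K _ hK] := lim.
  exists K => k Kk; apply: ((hz k).1 (fun v => `|ip v p - ell phi| <= eps)).
    by move=> m km; rewrite vip distrC; apply: hK; exact: leq_trans Kk km.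
  move=> u v hu hv /=; rewrite (form_Zl ipL) (form_Dl ipL).
  have -> : 2^-1 * (ip u p + ip v p) - ell phi = 2^-1 * ((ip u p - ell phi) + (ip v p - ell phi)) by field.
  rewrite normrM ger0_norm// ler_pdivrMl//; apply: (le_trans (ler_normD _ _)).
  by move: hu hv => /=; lra.
have -> : dot l phi = ip l' p by rewrite vip.
apply/eqP; rewrite -subr_eq0 -normr_eq0 eq_le normr_ge0 andbT.
apply/ler_addgt0Pr => eps eps0; rewrite add0r.
have [K hK] := close _ eps0.
apply: (@half_powers _ _ _ (2 * (ip p p + 1))) => k.
have hk := hK (K + k)%N (leq_addr _ _).
have -> : ip l' p - ell phi = ip (l' - z (K + k)%N) p + (ip (z (K + k)%N) p - ell phi).
  by rewrite (form_Dl ipL) (form_Nl ipL); ring.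
apply: (le_trans (ler_normD _ _)); rewrite addrC lerD//.
apply: (le_trans (cs p _)); rewrite exprD ler_wpM2l ?mulr_ge0 ?addr_ge0//.
by rewrite ler_piMl ?exprn_ge0// exprn_ile1// invf_le1// ler1n.
Qed.

End WeakLimit.

(** * Weak derivatives from bounded differences *)

Section TestDifferences.
Context {R : realType}.
Local Notation mu := (@lebesgue_measure R).
Local Notation L1 f := (mu.-integrable setT (EFin \o f)).

Lemma test_derive1 (phi : R -> R) : test_function phi -> test_function (derive1 phi).
Proof.
move=> [sm cS]; split; first exact: smooth_derive1S.
apply: (subclosed_compact (@closed_closure _ _) cS).
rewrite [X in _ `<=` X](closure_id _).1; last exact: closed_closure.
apply: closure_subset => x /= /eqP dx; apply: contrapT => nx; apply: dx.
have [e /= e0 he] : \forall y \near x, phi y = 0.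
  have : nbhs x (~` closure [set x | phi x != 0]).
    by apply: open_nbhs_nbhs; split=> //; exact/closed_openC/closed_closure.
  apply: filterS => y /= ny; apply/eqP; apply: contrapT => /negP py; apply: ny.
  exact: subset_closure.
rewrite derive1E.
have nr : \near x, (cst 0 : R -> R) x = phi x by exists e => // y /he.
by have [_ ->] := near_eq_is_derive nr (is_derive_cst 0 x 1).
Qed.

Lemma test_derive1n j (phi : R -> R) : test_function phi -> test_function (derive1n j phi).
Proof. by move=> h; elim: j => // j ih; rewrite derive1nS; exact: test_derive1. Qed.

Lemma bounded_support_L2 (f : R -> R) (N e : R) : measurable_fun setT f -> 0 <= N ->
  (forall x, N < `|x| -> f x = 0) -> (forall x, `|f x| <= e) ->
  L2 f /\ dot f f <= e ^+ 2 * (2 * N).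
Proof.
move=> mf N0 f0 fe; have [L le] := L2_bounded mf fe (L2_indic (- N) N).
have E : (fun x => f x * \1_`[- N, N] x) = f.
  apply/funext => x; rewrite indicE mem_setE in_itv/= -ler_norml.
  by case: leP => [_|/f0 ->]; rewrite ?mulr1 ?mul0r.
rewrite E in L le; split=> //; apply: (le_trans le); rewrite ler_wpM2l ?sqr_ge0//.
rewrite /dot -(int_cut `[- N, N] (\1_`[- N, N])).
under eq_Rintegral => x xh do rewrite indicE xh.
rewrite Rintegral_cst//= lebesgue_measure_itv/= lte_fin mul1r.
by case: ifP => _ /=; lra.
Qed.

Lemma test_L2 (phi : R -> R) : test_function phi -> L2 phi.
Proof.
move=> /test_functionP[N [M [N0 out bd [c _] _]]].
have [] := @bounded_support_L2 phi N M => //; first exact: continuous_measurable_fun.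
  by move=> x /out[].
by move=> x; have [] := bd x.
Qed.

Lemma is_derive_difj (a h : R) j (f f' : R -> R) : (forall x : R, is_derive x 1 f (f' x)) ->
  forall x : R, is_derive x 1 (iter j (dif a h) f) (iter j (dif a h) f' x).
Proof.
elim: j => //= j ih df x; have {}ih := ih df.
have sh (y : R) : is_derive y 1 (fun y => iter j (dif a h) f (y + h)) (iter j (dif a h) f' (y + h)).
  have d := is_derive_shift y 1 h.
  have := @is_derive1_comp R _ (shift h) y _ _ (ih _) d; rewrite mulr1.
  by [].
have := is_deriveZ a (is_deriveB (sh x) (ih x)).
by [].
Qed.

(** An iterated difference quotient of a smooth function is a value of its
    derivative, by as many applications of the mean value theorem. *)
Lemma dif_mean_value (h : R) j (phi : R -> R) y : 0 < h -> smooth phi ->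
  exists2 xi, y - j%:R * h <= xi <= y &
    iter j (dif h^-1 (- h)) phi y = (-1) ^+ j * derive1n j phi xi.
Proof.
move=> h0; elim: j phi y => [|j ih] phi y sm.
  by exists y; rewrite ?mul0r ?subr0 ?lexx//= mul1r.
have sm' := smooth_derive1S sm.
have dphi (x : R) : is_derive x 1 phi (derive1 phi x).
  by have d := smooth_derivable sm (x := x); rewrite derive1E; exact: DeriveDef.
have dj := is_derive_difj h^-1 (- h) j dphi.
have yh : y - h < y by rewrite gtrBl.
have [|c] := MVT yh (fun x _ => dj x).
  apply: continuous_subspaceT => x; apply/differentiable_continuous/derivable1_diffP.
  by have [] := dj x.
rewrite in_itv/= => /andP[c1 c2] E.
have [xi /andP[x1 x2] E'] := ih (derive1 phi) c sm'.
exists xi.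
  by rewrite -natr1 mulrDl mul1r; apply/andP; split; lra.
rewrite {1}/dif -opprB E E' -derive1nS derive1Sn exprS.
rewrite (_ : y - (y - h) = h); last by ring.
by field; rewrite gt_eqF.
Qed.

Lemma dot_dif_adj (a h : R) (u v : R -> R) : L2 u -> L2 v ->
  dot (dif a h u) v = dot u (dif a (- h) v).
Proof.
move=> hu hv; have Lu := L2_iso (iso_shift h) hu; have Lv := L2_iso (iso_shift (- h)) hv.
have E : dot (u \o +%R^~ h) v = dot u (v \o +%R^~ (- h)).
  apply: (etrans (esym (Rintegral_iso (iso_shift (- h)) (L2_mul Lu hv)))).
  by apply: eq_Rintegral => x _ /=; rewrite subrK.
have lin (p q r : R -> R) : L2 p -> L2 q -> L2 r ->
    dot (fun x => a * (p x - q x)) r = a * (dot p r - dot q r).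
  move=> hp hq hr; have := dot_lin (- a) hq (L2Z a hp) hr.
  have -> : dot (fun x => a * p x) r = a * dot p r.
    have := dot_lin a hp (@L2_0 R) hr.
    under [X in dot X r = _ -> _]eq_fun do rewrite addr0.
    move=> ->; rewrite [X in _ + X](_ : _ = 0) ?addr0//.
    by rewrite /dot; under eq_Rintegral do rewrite mul0r; rewrite Rintegral_cst// mul0r.
  rewrite (_ : (fun x => - a * q x + a * p x) = fun x => a * (p x - q x)); last first.
    by apply/funext => x; ring.
  by move=> ->; ring.
rewrite (lin _ _ _ Lu hu hv) [RHS]dotC (lin _ _ _ Lv hv hu).
by rewrite E (dotC v u) (dotC u (v \o _)).
Qed.

Lemma difj_L2 (a h : R) j (u : R -> R) : L2 u -> L2 (iter j (dif a h) u).
Proof. by move=> hu; elim: j => //= j ih; have [] := dif_L2 h a ih. Qed.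

Lemma dot_difj_adj (a h : R) j (u v : R -> R) : L2 u -> L2 v ->
  dot (iter j (dif a h) u) v = dot u (iter j (dif a (- h)) v).
Proof.
move=> hu; elim: j v => //= j ih v hv.
rewrite dot_dif_adj//; last exact: difj_L2.
by rewrite ih -?iterSr//; have [] := dif_L2 (- h) a hv.
Qed.

(** Summation by parts moves the differences to phi, where they converge uniformly
    and keep their supports in a fixed interval. *)
Lemma dif_dot_cvg j (u phi : R -> R) : L2 u -> test_function phi ->
  dot (iter j (dif (n.+1%:R^-1)^-1 n.+1%:R^-1) u) phi @[n --> \oo]
    --> (-1) ^+ j * dot u (derive1n j phi).
Proof.
move=> hu tp; have hp := test_L2 tp.
have tpj := test_derive1n j tp.
have [N [M [N0 out bd [cj cj'] Pj]]] := test_functionP tpj.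
have sm : smooth phi by case: tp.
pose N' := N + j%:R; have N'0 : 0 <= N' by rewrite addr_ge0.
pose r (n : nat) x := iter j (dif (n.+1%:R^-1)^-1 (- n.+1%:R^-1)) phi x - (-1) ^+ j * derive1n j phi x.
have M0 : 0 <= M by have [+ _] := bd 0; apply: le_trans.
have hn (n : nat) : 0 < (n.+1%:R^-1 : R) by rewrite invr_gt0.
have hn1 (n : nat) : (n.+1%:R^-1 : R) <= 1 by rewrite invf_le1// ler1n.
have rE (n : nat) x : exists2 xi, x - j%:R * n.+1%:R^-1 <= xi <= x &
    r n x = (-1) ^+ j * (derive1n j phi xi - derive1n j phi x).
  have [xi h1 h2] := dif_mean_value j x (hn n) sm; exists xi => //.
  by rewrite /r h2; ring.
have rle n x : `|r n x| <= M * j%:R * n.+1%:R^-1.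
  have [xi /andP[x1 x2] ->] := rE n x.
  rewrite normrM normrX normrN1 expr1n mul1r distrC.
  apply: (le_trans (Prim_le Pj (fun y => (bd y).2) x2)).
  by rewrite -mulrA ler_wpM2l// lerBlDr -lerBlDl.
have r0 n x : N' < `|x| -> r n x = 0.
  have [xi /andP[x1 x2] ->] := rE n x => Nx.
  have jn : j%:R * n.+1%:R^-1 <= j%:R :> R by rewrite -[leRHS]mulr1 ler_wpM2l.
  move: (j%:R * n.+1%:R^-1) x1 jn => q x1 jn.
  have Nxi : N < `|xi|.
    have : `|x| <= `|xi| + j%:R.
      by rewrite ler_norml; have := ler_norm xi; have := ler_norm (- xi); rewrite normrN; lra.
    by move: Nx; rewrite /N'; lra.
  have Nx' : N < `|x| by apply: le_lt_trans Nx; rewrite lerDl.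
  by rewrite (out _ Nxi).1 (out _ Nx').1 subrr mulr0.
have Ldj := test_L2 tpj.
have rL n : L2 (r n) /\ dot (r n) (r n) <= (M * j%:R * n.+1%:R^-1) ^+ 2 * (2 * N').
  apply: bounded_support_L2 => //; [|exact: r0].
  have L := L2_lin (- (-1) ^+ j) Ldj (difj_L2 (n.+1%:R^-1)^-1 (- n.+1%:R^-1) j hp).
  by move: L.1; congr measurable_fun; apply/funext => x; rewrite /r; ring.
have E n : dot (iter j (dif (n.+1%:R^-1)^-1 n.+1%:R^-1) u) phi =
    (-1) ^+ j * dot u (derive1n j phi) + dot (r n) u.
  rewrite dot_difj_adj// (dotC u (derive1n j phi)) -dot_lin//; last exact: (rL n).1.
  by rewrite dotC; apply: eq_Rintegral => x _; rewrite /r; ring.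
rewrite (_ : (fun n => _) = fun n : nat => (-1) ^+ j * dot u (derive1n j phi) + dot (r n) u); last first.
  by apply/funext => n; exact: E.
rewrite -[X in _ --> X]addr0; apply: cvgD; first exact: cvg_cst.
pose B := M * j%:R * (2 * N' + 1) * (dot u u + 1).
have u0 := dot_ge0 u.
have dle n : `|dot (r n) u| <= B * n.+1%:R^-1.
  have B0 : 0 <= B * n.+1%:R^-1 by rewrite !mulr_ge0 ?addr_ge0 ?mulr_ge0.
  rewrite -ler_sqr ?nnegrE// real_normK ?num_real//.
  apply: (le_trans (dot_cs (rL n).1 hu)).
  have [_ h1] := rL n.
  apply: (le_trans (ler_wpM2r u0 h1)).
  have -> : (B * n.+1%:R^-1) ^+ 2 = (M * j%:R * n.+1%:R^-1) ^+ 2 * (2 * N' + 1) ^+ 2 * (dot u u + 1) ^+ 2.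
    by rewrite /B; ring.
  have sq (x : R) : 0 <= x -> x <= (x + 1) ^+ 2.
    by move=> x0; rewrite expr2 mulrDl mulrDr mul1r mulr1; have := mulr_ge0 x0 x0; lra.
  apply: ler_pM => //; [by rewrite mulr_ge0 ?sqr_ge0 ?mulr_ge0| |exact: sq].
  by rewrite ler_wpM2l ?sqr_ge0//; apply: sq; rewrite mulr_ge0.
have lim : (fun n : nat => B * n.+1%:R^-1) @ \oo --> (0 : R).
  rewrite -[X in _ --> X](mulr0 B); apply: cvgM; first exact: cvg_cst.
  exact: cvg_harmonic.
have limN : (fun n : nat => - (B * n.+1%:R^-1)) @ \oo --> (0 : R).
  by rewrite -[X in _ --> X]oppr0; apply: cvgN.
apply: (squeeze_cvgr _ limN lim); apply: nearW => n.
by rewrite -ler_norml.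
Qed.

Lemma L2_locL1 (v : R -> R) : L2 v -> locL1 v.
Proof.
move=> hv; split; first exact: hv.1.
by move=> a b; apply/(L1_cut _ (mcc a b)); exact: (L2_mul hv (L2_indic a b)).
Qed.

(** Differences bounded in L2 uniformly in the step produce weak derivatives:
    their weak limits are determined by integration against test functions. *)
Theorem weak_derivatives_of_differences (s : nat) (u : R -> R) (M : R) : L2 u ->
  (forall (n j : nat), (j <= s)%N ->
    dot (iter j (dif (n.+1%:R^-1)^-1 n.+1%:R^-1) u)
        (iter j (dif (n.+1%:R^-1)^-1 n.+1%:R^-1) u) <= M) ->
  exists2 d, weak_derivatives s u d &
    forall j, (j <= s)%N -> L2 (d j) /\ dot (d j) (d j) <= M.
Proof.
move=> hu hM.
have /choice[d hd] j : exists l, (j <= s)%N -> [/\ L2 l, dot l l <= M &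
    forall phi, test_function phi -> dot l phi = (-1) ^+ j * dot u (derive1n j phi)].
  case: (leqP j s) => [js|]; last by exists u.
  have [|l hl] := @weak_limit R (fun n => iter j (dif (n.+1%:R^-1)^-1 n.+1%:R^-1) u) M test_function
    (fun phi => (-1) ^+ j * dot u (derive1n j phi)) (fun n => difj_L2 _ _ _ hu) (fun n => hM n j js).
    by move=> phi tp; split; [exact: test_L2|exact: dif_dot_cvg].
  by exists l.
pose e j := if j is 0%N then u else d j.
have he j : (j <= s)%N -> [/\ L2 (e j), dot (e j) (e j) <= M &
    forall phi, test_function phi -> dot (e j) phi = (-1) ^+ j * dot u (derive1n j phi)].
  case: j => [js|j js]; last exact: hd.
  split=> //; first by have := hM 0%N 0%N js.
  by move=> phi _; rewrite mul1r.
exists e; last by move=> j /he[].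
split=> //; first exact/locL1_locally_integrable/L2_locL1.
move=> j js; have [l1 _ w1] := he j (ltnW js); have [l2 _ w2] := he j.+1 js.
split; [exact/locL1_locally_integrable/L2_locL1|exact/locL1_locally_integrable/L2_locL1|].
move=> phi tp; have := w1 _ (test_derive1 tp); rewrite -derive1Sn /dot => ->.
have := w2 _ tp; rewrite /dot => ->.
by rewrite exprS; ring.
Qed.

End TestDifferences.

(** * From differences to the H^s norm *)

Section ModeBound.
Variables (R : realType) (s : nat).
Local Notation mu := (@lebesgue_measure R).

Lemma dif_scale (dl h : R) j (u : R -> R) x :
  iter j (dif (dl / h) h) u x = dl ^+ j * iter j (dif h^-1 h) u x.
Proof.
elim: j x => [|j ih] x; first by rewrite mul1r.
by rewrite !iterS {1}/dif !ih exprS {3}/dif; ring.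
Qed.

Lemma sum_L2_sqnorm (d : nat -> R -> R[i]) : (forall j, (j <= s)%N -> L2C (d j)) ->
  (\sum_(j < s.+1) L2_sqnorm (d j))%E = (\sum_(j < s.+1) \sum_b
    dot (fun x => cpt b (d j x)) (fun x => cpt b (d j x)))%:E.
Proof.
move=> dL; rewrite -sumEFin; apply: eq_bigr => j _.
by rewrite L2_sqnormE//; apply: dL; rewrite -ltnS.
Qed.

(** In L2, the weighted difference of order j is at most dl^j <= 1 times the
    derivative of order j. *)
Lemma difnorm_le (dl h : R) (u : R -> R[i]) d : 0 <= dl -> dl <= 1 -> 0 < h ->
  weak_derivativesC s u d -> (forall j, (j <= s)%N -> L2C (d j)) -> d 0%N = u ->
  difnorm s dl h u <= \sum_(j < s.+1) \sum_b
    dot (fun x => cpt b (d j x)) (fun x => cpt b (d j x)).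
Proof.
move=> dl0 dl1 h0 [[_ _ w1] [_ _ w2]] dL d0.
apply: ler_sum => j _; apply: ler_sum => b _.
have js : (j <= s)%N by rewrite -ltnS.
have hu := difj_L2 (dl / h) h j (dL 0%N isT b).
rewrite d0 in hu; rewrite /difv (dot_iso (iso_shift ((s - j)%:R * h)) hu hu).
have := @dot_difj_le R (dl / h) h j (fun i x => cpt b (d i x)) h0 _ _.
rewrite d0 divfK ?gt_eqF// => /(_ _ _)/le_trans; apply.
- by move=> i ij; apply: dL; rewrite (leq_trans ij).
- move=> i ij; have is_ := leq_trans ij js.
  by case: b {hu}; [have [u1 p e] := weak_derivative_Prim (w2 i is_)
                  |have [u1 p e] := weak_derivative_Prim (w1 i is_)]; exists u1.
- rewrite -[leRHS]mul1r ler_wpM2r ?dot_ge0//.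
  by apply: exprn_ile1; [exact: sqr_ge0|exact: exprn_ile1].
Qed.

(** The negative powers of dl undo the weights of the differences. *)
Lemma Hs_of_difnorm (dl : R) (u : R -> R[i]) (S : R) : 0 < dl -> dl <= 1 -> L2C u -> 0 <= S ->
  (forall h, 0 < h -> difnorm s dl h u <= S) ->
  (Hs_sqnorm s u <= ((s.+1 * 2)%:R * (dl ^- (s * 2) * S))%:E)%E.
Proof.
move=> dl0 dl1 hu S0 hS.
have hM (n j : nat) b : (j <= s)%N ->
    dot (iter j (dif (n.+1%:R^-1)^-1 n.+1%:R^-1) (fun x => cpt b (u x)))
        (iter j (dif (n.+1%:R^-1)^-1 n.+1%:R^-1) (fun x => cpt b (u x))) <= dl ^- (s * 2) * S.
  move=> js; set h : R := n.+1%:R^-1; have h0 : 0 < h by rewrite invr_gt0.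
  set v := iter j (dif h^-1 h) _.
  have vL : L2 v := difj_L2 _ _ _ (hu b).
  have vE : iter j (dif (dl / h) h) (fun x => cpt b (u x)) = fun x => dl ^+ j * v x.
    by apply/funext => x; exact: dif_scale.
  have wL := difj_L2 (dl / h) h j (hu b).
  have le1 : dot (iter j (dif (dl / h) h) (fun x => cpt b (u x)))
                 (iter j (dif (dl / h) h) (fun x => cpt b (u x))) <= S.
    apply: le_trans (hS h h0); rewrite /difnorm (bigD1 (Ordinal (js : (j < s.+1)%N)))//=.
    rewrite (bigD1 b)//= /difv (dot_iso (iso_shift ((s - j)%:R * h)) wL wL) -addrA lerDl.
    by rewrite addr_ge0 ?sumr_ge0// => *; rewrite ?sumr_ge0// => *; exact: dot_ge0.
  rewrite vE in le1.
  have E : dot (fun x => dl ^+ j * v x) (fun x => dl ^+ j * v x) = dl ^+ (j * 2) * dot v v.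
    rewrite /dot -RintegralZl//; last exact: (L2_mul vL vL).
    by apply: eq_Rintegral => x _; rewrite exprM; ring.
  rewrite E in le1; rewrite ler_pdivlMl ?exprn_gt0//; apply: le_trans le1.
  by rewrite ler_wpM2r ?dot_ge0// ler_wiXn2l ?leq_mul2r ?js ?orbT// ltW.
have [d1 w1 b1] := weak_derivatives_of_differences (hu false) (fun n j => hM n j false).
have [d2 w2 b2] := weak_derivatives_of_differences (hu true) (fun n j => hM n j true).
pose d j x : R[i] := (d1 j x +i* d2 j x)%C.
have wd : weak_derivativesC s u d by split.
have dL j : (j <= s)%N -> L2C (d j) by move=> js []; [exact: (b2 j js).1|exact: (b1 j js).1].
apply: (@le_trans _ _ (\sum_(j < s.+1) L2_sqnorm (d j))%E).
  by apply: ereal_inf_lbound; exists d.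
rewrite sum_L2_sqnorm// lee_fin.
apply: (@le_trans _ _ (\sum_(j < s.+1) 2 * (dl ^- (s * 2) * S))).
  apply: ler_sum => j _; have js : (j <= s)%N by rewrite -ltnS.
  by rewrite big_bool/=; have := (b1 j js).2; have := (b2 j js).2; rewrite /d/=; lra.
by rewrite sumr_const card_ord -[leLHS]mulr_natl natrM -mulrA.
Qed.

(** Every family of weak derivatives of u bounds the differences of u, hence those
    of w for all steps, hence the weak derivatives of w. *)
Lemma Hs_bound_of_difnorm (dl : R) (u w : R -> R[i]) : 0 < dl -> dl <= 1 -> L2C w ->
  (forall h, 0 < h -> difnorm s dl h w <= 2 * difnorm s dl h u) ->
  (Hs_sqnorm s w <= ((s.+1 * 2)%:R * (dl ^- (s * 2) * 2))%:E * Hs_sqnorm s u)%E.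
Proof.
move=> dl0 dl1 hw le.
set K := (s.+1 * 2)%:R * _.
have K0 : 0 < K by rewrite !mulr_gt0// ?ltr0n ?muln_gt0// invr_gt0 exprn_gt0.
rewrite -lee_pdivrMl//; apply: le_ereal_inf_tmp => _ [d hd <-].
have [fin|] := boolP (\sum_(j < s.+1) L2_sqnorm (d j) < +oo)%E; last first.
  by rewrite -leNgt leye_eq => /eqP ->; rewrite leey.
have dL := weak_derivativesC_L2C hd fin.
rewrite lee_pdivrMl//.
have d0 : d 0%N = u.
  have [[e1 _ _] [e2 _ _]] := hd; apply/funext => x; apply: cpt_eq => -[].
    exact: (congr1 (@^~ x) e2).
  exact: (congr1 (@^~ x) e1).
rewrite sum_L2_sqnorm//; set S := \sum_(j < s.+1) _.
have S0 : 0 <= S by do 2![apply: sumr_ge0 => ? _]; exact: dot_ge0.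
have S2 : 0 <= 2 * S by rewrite mulr_ge0.
apply: (le_trans (Hs_of_difnorm dl0 dl1 hw S2 _)).
  move=> h h0; apply: (le_trans (le h h0)); rewrite ler_wpM2l//.
  exact: difnorm_le (ltW dl0) dl1 h0 hd dL d0.
by rewrite lee_fin /K !mulrA.
Qed.

Lemma Hs_sqnorm_ge0 (u : R -> R[i]) : (0 <= Hs_sqnorm s u)%E.
Proof.
apply: le_ereal_inf_tmp => _ [d _ <-]; apply: sume_ge0 => j _; exact: L2_sqnorm_ge0.
Qed.

(** In a family of weak derivatives of u, replace the first member by v. *)
Lemma Hs_sqnorm_ae (u v : R -> R[i]) : L2C v -> ae_eqC u v ->
  (Hs_sqnorm s v <= Hs_sqnorm s u)%E.
Proof.
move=> hv uv; apply: le_ereal_inf_tmp => _ [d hd <-].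
have md b : measurable_fun setT (fun x => cpt b (d 0%N x)).
  exact: weak_derivativesC_meas hd _ b.
have [[e1 l1 w1] [e2 l2 w2]] := hd.
have d0 : d 0%N = u.
  by apply/funext => x; apply: cpt_eq => -[]; [exact: (congr1 (@^~ x) e2)|exact: (congr1 (@^~ x) e1)].
pose e j := if j is 0%N then v else d j.
have aeb b : {ae mu, forall x, cpt b (u x) = cpt b (v x)} by apply: (ae_imp uv) => x ->.
have wk b (w : R -> R) : weak_derivative (fun x => cpt b (u x)) w ->
    weak_derivative (fun x => cpt b (v x)) w.
  move=> [h1 h2 h3]; split=> //; first exact/locL1_locally_integrable/L2_locL1.
  move=> phi tp; rewrite -h3//; apply: eq_ae_Rintegral.
  - apply: measurable_funM; first exact: (hv b).1.
    exact: (test_L2 (test_derive1 tp)).1.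
  - apply: measurable_funM; first by case: h1.
    exact: (test_L2 (test_derive1 tp)).1.
  - by apply: (ae_imp (aeb b)) => x ->.
have we : weak_derivativesC s v e.
  split; split=> //.
  - exact/locL1_locally_integrable/(L2_locL1 (hv false)).
  - case=> [|j] js; last exact: w1.
    by apply: (wk false); have := w1 0%N js; rewrite d0.
  - exact/locL1_locally_integrable/(L2_locL1 (hv true)).
  - case=> [|j] js; last exact: w2.
    by apply: (wk true); have := w2 0%N js; rewrite d0.
apply: (@le_trans _ _ (\sum_(j < s.+1) L2_sqnorm (e j))%E).
  by apply: ereal_inf_lbound; exists e.
apply: lee_sum => -[[|j] js] _ //=; rewrite d0.
rewrite le_eqVlt; apply/orP; left; apply/eqP.
have mm (w : R -> R[i]) : (forall b, measurable_fun setT (fun x => cpt b (w x))) ->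
    measurable_fun setT (fun y => (complex.Re (w y) ^+ 2 + complex.Im (w y) ^+ 2)%:E).
  move=> h; apply/measurable_EFinP; apply: measurable_funD; apply: measurable_funX.
    exact: (h false).
  exact: (h true).
apply: ae_eq_integral => //.
- by apply: mm => b; exact: (hv b).1.
- by apply: mm => b; have := md b; rewrite d0.
- by apply: (ae_imp uv) => x -> _.
Qed.

End ModeBound.

(** * Fourier modes *)

Section Modes.
Context {R : realType}.
Local Notation mu := (@lebesgue_measure R).

Lemma trig_is_derive (k a b x : R) :
  is_derive x 1 (fun x : R => a * cos (k * x) + b * sin (k * x))
    (k * b * cos (k * x) + (- (k * a)) * sin (k * x)).
Proof.
have dk : is_derive x (1 : R) (fun x : R => k * x) k.
  by have := is_deriveZ k (is_derive_id x (1 : R)); rewrite /GRing.scale/= mulr1.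
have dc := @is_derive1_comp R cos (fun x => k * x) x _ _ (is_derive_cos _) dk.
have ds := @is_derive1_comp R sin (fun x => k * x) x _ _ (is_derive_sin _) dk.
have := is_deriveD (is_deriveZ a dc) (is_deriveZ b ds).
move/is_derive_eq; apply.
by rewrite /GRing.scale/=; ring.
Qed.

Lemma smooth_trig (k a b : R) : smooth (fun x : R => a * cos (k * x) + b * sin (k * x)).
Proof.
move=> n; have [a' [b' ->]] : exists a' b',
    derive1n n (fun x : R => a * cos (k * x) + b * sin (k * x)) =
    (fun x : R => a' * cos (k * x) + b' * sin (k * x)).
  elim: n => [|n [a' [b' ih]]]; first by exists a, b.
  exists (k * b'), (- (k * a')); rewrite derive1nS ih; apply/funext => x.
  by rewrite derive1E; have [_ ->] := trig_is_derive k a' b' x.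
by move=> x; have [] := trig_is_derive k a' b' x.
Qed.

Lemma trig_periodic (n : int) (x : R) :
  cos (x + 2 * pi * n%:~R) = cos x /\ sin (x + 2 * pi * n%:~R) = sin x.
Proof.
have pos (m : nat) (y : R) : cos (y + 2 * pi * m%:R) = cos y /\ sin (y + 2 * pi * m%:R) = sin y.
  have -> : 2 * pi * m%:R = (pi *+ 2) *+ m :> R by rewrite mulr_natr mulr_natl.
  by rewrite (periodicn (@cosD2pi R)) (periodicn (@sinD2pi R)).
case: n => m; first by rewrite -[Posz m]/(m%:Z) -pmulrn; exact: pos.
rewrite NegzE mulrNz mulrN; have [<- <-] := pos m.+1 (x - 2 * pi * m.+1%:R).
by rewrite subrK.
Qed.

Lemma expi_torus_test (L : R) (n : int) : L != 0 ->
  torus_test L (fun x => expi (- (freq L n * x))).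
Proof.
move=> L0; split.
- have := @smooth_trig (freq L n) 1 0; congr smooth; apply/funext => x /=.
  by rewrite mul0r addr0 mul1r cosN.
- have := @smooth_trig (freq L n) 0 (-1); congr smooth; apply/funext => x /=.
  by rewrite mul0r add0r mulN1r sinN.
move=> x; have -> : freq L n * (x + L) = freq L n * x + 2 * pi * n%:~R.
  by rewrite /freq; field.
have [h1 h2] := trig_periodic n (freq L n * x).
by rewrite /expi !(cosN, sinN) h1 h2.
Qed.

Lemma fourier_L2C (L : R) T (n : int) : L != 0 -> periodic_distribution L T ->
  L2C (fourier L T n).
Proof.
move=> L0 [h _ _] b; have := in_Hs_L2C (h _ (expi_torus_test n L0)) b => hL.
rewrite /fourier; under eq_fun do rewrite cptZ.
exact: L2Z.
Qed.

Lemma dot_eq0 (f : R -> R) : L2 f -> dot f f = 0 -> {ae mu, forall x, f x = 0}.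
Proof.
move=> hf f0; have mf2 : measurable_fun setT (fun x => (f x ^+ 2)%:E).
  by apply/measurable_EFinP; apply: measurable_funX; exact: hf.1.
have [h _] := ae_eq_integral_abs mu measurableT mf2.
have {}h : ae_eq mu setT (fun x => (f x ^+ 2)%:E) (cst 0%E).
  apply: h; rewrite -[RHS](congr1 EFin f0) -ereal_dot//.
  by apply: eq_integral => x _; rewrite gee0_abs// lee_fin sqr_ge0.
apply: (ae_imp h) => x /= /(_ I) [/eqP]; by rewrite sqrf_eq0 => /eqP.
Qed.

(** The square distance to the initial value has zero derivative. *)
Lemma L2_time_constant (w : R -> R -> R[i]) : (forall t, L2C (w t)) ->
  (forall t, L2_time_derivative w t (fun=> 0)) -> forall t, ae_eqC (w 0) (w t).
Proof.
move=> hw dw t.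
have hd t' : L2C (fun y => w t' y - w 0 y).
  move=> b; under eq_fun do rewrite cptD cptN.
  exact: (L2D (hw t' b) (L2N (hw 0 b))).
pose W t' : vec R (unit * bool)%type := mkvec (fun p : unit * bool => hd t' p.2).
have td t' : tder ip W 0 t'.
  rewrite /tder; have lim := dw t'; rewrite /L2_time_derivative in lim.
  have hZ th : L2C (fun y => (th^-1)%:C%C * (w (t' + th) y - w t' y) - 0).
    move=> b; under eq_fun do rewrite subr0 cptZ cptD cptN.
    exact: (L2Z _ (L2D (hw _ b) (L2N (hw _ b)))).
  have E : (fun th : R => ip (th^-1 *: (W (t' + th) - W t') - 0) (th^-1 *: (W (t' + th) - W t') - 0)) =
      fine \o (fun th : R => L2_sqnorm (fun y => (th^-1)%:C%C * (w (t' + th) y - w t' y) - 0)).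
    apply/funext => th; rewrite /= (L2_sqnormE (hZ th)) /=.
    rewrite ip_pair (big_pred1 tt); last by case.
    rewrite big_bool/= addrC.
    have Eb b x : (th^-1 *: (W (t' + th) - W t') - 0) (tt, b) x =
        cpt b ((th^-1)%:C%C * (w (t' + th) x - w t' x) - 0).
      rewrite subr0 cptD cptN cptZ cptD cptN (_ : cpt b 0 = 0); last by case: b.
      transitivity (th^-1 * (W (t' + th) (tt, b) x - W t' (tt, b) x)); first by [].
      by rewrite /W/= !cptD !cptN; ring.
    congr (_ + _); apply: eq_Rintegral => x _.
      by congr (_ * _); exact: (Eb false x).
    by congr (_ * _); exact: (Eb true x).
  by rewrite E; exact: fine_cvg lim.
have dc t' : is_derive t' (1 : R) (fun r => ip (W r) (W r)) 0.
  have F := @vec_frame R unit 1 (oner_neq0 _).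
  have := tder_form F (ip_sym F) (ip_lin F) (ip_ge0 F) (fun u => lexx _) (td t').
  by rewrite (form_0l (ip_lin F)) mulr0.
have := is_derive_0_is_cst t 0 dc.
have -> : ip (W 0) (W 0) = 0.
  rewrite /ip big1// => b _; rewrite /dot; under eq_Rintegral => x _.
    rewrite (_ : W 0 b x = 0); last by rewrite /W/= subrr; case: (b.2).
    rewrite mul0r; over.
  by rewrite Rintegral_cst// mul0r.
move=> W0; have Wb b : {ae mu, forall x, W t b x = 0}.
  apply: (dot_eq0 (vecL2 (W t) b)); apply/eqP; rewrite eq_le dot_ge0 andbT -W0.
  by rewrite /ip (bigD1 b)//= lerDl sumr_ge0// => b' _; exact: dot_ge0.
apply: (ae_imp (ae_and (Wb (tt, false)) (Wb (tt, true)))) => x [h1 h2]; apply: cpt_eq => b.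
apply/esym/eqP; rewrite -subr_eq0 -cptN -cptD; apply/eqP; by case: b.
Qed.

Lemma esum_scale (T : choiceType) (a b : T -> \bar R) (K : R) : 0 <= K ->
  (forall i, (0 <= b i)%E) -> (forall i, (a i <= K%:E * b i)%E) ->
  (\esum_(i in setT) a i <= K%:E * \esum_(i in setT) b i)%E.
Proof.
move=> K0 b0 ab; apply: le_trans (le_esum (fun i _ => ab i)) _.
apply: ge_ereal_sup => _ [X hX <-].
have finX : finite_set X by case: hX.
rewrite -ge0_mule_fsumr//; apply: lee_wpmul2l; first by rewrite lee_fin.
by apply: esum_ge; exists X.
Qed.

End Modes.

(** * The linearized Euler equations *)

Section Coefficients.
Context {R : realType}.
Local Notation mu := (@lebesgue_measure R).

Lemma Winfty_regular (n : nat) (u : R -> R) (K : R) : 0 <= K ->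
  (Winfty_norm n.+1 u < K%:E)%E -> measurable_fun setT u /\
  exists2 e, regular n.+1 K e & {ae mu, forall x, u x = e 0%N x}.
Proof.
move=> K0 /ereal_inf_lt[_ [d hd <-] dK].
have [d0 lu wd] := hd; split; first by case: lu.
apply: (@regular_rep _ _ _ _ d hd) => // j jn.
have md : measurable_fun setT (d j).
  case: j jn => [_|j jn]; first by rewrite d0; case: lu.
  by have [_ [] ] := wd j jn.
apply: Lnormy_le => //; apply: le_trans (ltW dK).
rewrite (bigD1 (Ordinal (jn : (j < n.+2)%N)))//= leeDl// sume_ge0// => i _.
exact: Lnorm_ge0.
Qed.

Lemma freq_neq0 (L : R) (n : int) : 0 < L -> n != 0 -> freq L n != 0.
Proof.
move=> L0 n0; apply: mulf_neq0; last by rewrite intr_eq0.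
by rewrite gt_eqF// divr_gt0// mulr_gt0// pi_gt0.
Qed.

Lemma freq_inv_le (L : R) (n : int) : 0 < L -> n != 0 -> `|(freq L n)^-1| <= L.
Proof.
move=> L0 n0; have fn := freq_neq0 L0 n0.
rewrite normfV -[leRHS]invrK lef_pV2 ?posrE ?normr_gt0 ?invr_gt0//.
have n1 : 1 <= `|n%:~R : R| by rewrite -intr_norm ler1z -gtz0_ge1 normr_gt0.
have p2 : 1 <= 2 * pi :> R by have := pi_ge2 R; lra.
rewrite /freq !normrM normfV (gtr0_norm L0) mulrAC -[leLHS]mul1r ler_wpM2r ?invr_ge0 ?(ltW L0)//.
rewrite -normrM ger0_norm; last by rewrite mulr_ge0// pi_ge0.
by rewrite -[leLHS]mulr1 ler_pM.
Qed.

(** Since |1 / k| <= L for the nonzero frequencies, the smallness of L |f| gives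
    that of the coefficient f / k, with one constant for all modes. *)
Theorem mode_bound (s : nat) (c G Lmax : R) : 0 < c -> exists eps K : R,
  [/\ 0 < eps, 1 <= K & forall (L : R) (n : int) (g f : R -> R) (w Phi : R -> R -> R[i]),
  0 < L -> L <= Lmax -> n != 0 ->
  (forall y, c < g y /\ g y < c^-1) ->
  (Winfty_norm s.+1 g <= G%:E)%E -> (L%:E * Winfty_norm s.+1 f < eps%:E)%E ->
  (forall t, L2C (w t)) ->
  (forall t, stream_function g (freq L n) t (w t) (Phi t)) ->
  (forall t, L2_time_derivative w t
     (fun y : R => 'i%C * (f y)%:C%C / (freq L n)%:C%C * Phi t y)) ->
  forall t, (Hs_sqnorm s (w t) <= K%:E * Hs_sqnorm s (w 0%R))%E].
Proof.
move=> c0; have G0 : 0 <= `|G| + 1 by rewrite addr_ge0.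
have [dl [eps [dl0 dl1 eps0 H]]] := mode_differences s c0 G0 (normr_ge0 Lmax).
exists eps, ((s.+1 * 2)%:R * (dl ^- (s * 2) * 2)); split=> //.
  rewrite -[leLHS]mulr1 ler_pM//; first by rewrite ler1n muln_gt0.
  rewrite -[leLHS]mul1r ler_pM//; last by rewrite ler1n.
  by rewrite invf_ge1 ?exprn_gt0// exprn_ile1 ?(ltW dl0).
move=> L n g f w Phi L0 LLmax n0 gc gG fL hw st dw t.
have [||_ [eg hg ge]] := @Winfty_regular s g (`|G| + 1) => //.
  apply: (le_lt_trans gG); rewrite lte_fin.
  by have := ler_norm G; lra.
have [||mf [ef hf fe]] := @Winfty_regular s f (eps / L).
- by rewrite divr_ge0 ?(ltW L0) ?(ltW eps0).
- by rewrite EFinM muleC -lte_pdivlMl || rewrite mulrC EFinM lte_pdivlMl.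
apply: Hs_bound_of_difnorm => // h h0.
have [_ _ pg] := hg.
have ceg := Prim_continuous (pg 0%N isT).
apply: (H (freq L n) h (eps / L) g f eg ef w Phi) => //.
- exact: freq_neq0.
- apply: (le_trans (freq_inv_le L0 n0)); exact: le_trans LLmax (ler_norm _).
- move=> x; split.
    rewrite -lerN2; apply: (continuous_ae_le (f := fun x => - eg 0%N x)).
      by move=> y; apply: (@continuousN _ R^o); exact: ceg.
    by apply: (ae_imp ge) => y <-; rewrite lerN2 ltW//; have [] := gc y.
  apply: (continuous_ae_le ceg); apply: (ae_imp ge) => y <-.
  by rewrite ltW//; have [] := gc y.
- rewrite -[leRHS](divfK (lt0r_neq0 L0)) mulrC ler_wpM2l ?divr_ge0 ?(ltW L0) ?(ltW eps0)//.
  exact: freq_inv_le.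
Qed.

End Coefficients.

Theorem theorem1p1 (R : realType) (s : nat) (c G Lmax : R) (c_gt0 : 0 < c) :
  exists2 eps : R, 0 < eps &
  forall (L : R) (U : R -> R),
    0 < L -> L <= Lmax ->
    (forall y, derivable U y 1) ->
    (forall y, derivable (derive1 U) y 1) ->
    (forall y, c < derive1 U y /\ derive1 U y < c^-1) ->
    in_Winfty s.+1 (shear_g U) ->
    in_Winfty s.+1 (shear_f U) ->
    (Winfty_norm s.+1 (shear_g U) <= G%:E)%E ->
    (L%:E * Winfty_norm s.+1 (shear_f U) < eps%:E)%E ->
  forall m : int,
  exists2 K : R, 0 < K &
  forall (omega0 : (R -> R[i]) -> R -> R[i])
         (W : R -> (R -> R[i]) -> R -> R[i]),
    in_HmHs L m s omega0 ->
    scattering_solution L (shear_f U) (shear_g U) omega0 W ->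
  forall t : R,
    (HmHs_norm L m s (W t) <= K%:E * HmHs_norm L m s omega0)%E.
Proof.
have [eps [K [eps0 K1 H]]] := mode_bound s G Lmax c_gt0.
exists eps => // L U L0 LLmax _ _ Uc _ _ gG fL m.
have K0 : 0 < K by exact: lt_le_trans K1.
exists (K `^ 2^-1); first exact: powR_gt0.
move=> omega0 W [pom _] [pW W0 dW0 dW] t.
have Ln0 : L != 0 by rewrite gt_eqF.
have wL n t' : L2C (fourier L (W t') n) by exact: fourier_L2C.
have init n : (Hs_sqnorm s (fourier L (W 0%R) n) <= Hs_sqnorm s (fourier L omega0 n))%E.
  apply: Hs_sqnorm_ae => //.
  by apply: (ae_imp (W0 _ (expi_torus_test n Ln0))) => x e; rewrite /fourier e.
have mode n : (Hs_sqnorm s (fourier L (W t) n) <= K%:E * Hs_sqnorm s (fourier L omega0 n))%E.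
  apply: (@le_trans _ _ (K%:E * Hs_sqnorm s (fourier L (W 0%R) n))%E); last first.
    by apply: lee_wpmul2l => //; rewrite lee_fin ltW.
  have [->|n0] := eqVneq n 0.
    apply: (@le_trans _ _ (Hs_sqnorm s (fourier L (W 0%R) 0%R))).
      by apply: Hs_sqnorm_ae => //; exact: (L2_time_constant (wL 0) dW0).
    by rewrite -[leLHS]mul1e; apply: lee_wpmul2r; rewrite ?Hs_sqnorm_ge0 ?lee_fin.
  have /choice[Phi hPhi] t' : exists Phi, stream_function (shear_g U) (freq L n) t' (fourier L (W t') n) Phi /\
      L2_time_derivative (fun tau => fourier L (W tau) n) t'
        (fun y => 'i%C * (shear_f U y)%:C%C / (freq L n)%:C%C * Phi y).
    by have [Phi h1 h2] := dW n t' n0; exists Phi.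
  apply: (H L n (shear_g U) (shear_f U) (fun t => fourier L (W t) n) Phi) => //.
  - by move=> y; exact: Uc.
  - by move=> t'; exact: (hPhi t').1.
  - by move=> t'; exact: (hPhi t').2.
have wt0 n : (0 <= (1 + freq L n ^+ 2) ^ m :> R).
  by rewrite exprz_ge0// addr_ge0// sqr_ge0.
have sum0 (T : (R -> R[i]) -> R -> R[i]) : (0 <= \esum_(n in [set: int])
      (((1 + freq L n ^+ 2) ^ m)%:E * Hs_sqnorm s (fourier L T n)))%E.
  by apply: esum_ge0 => n _; rewrite mule_ge0 ?lee_fin ?Hs_sqnorm_ge0.
rewrite /HmHs_norm -poweR_EFin -poweRM ?lee_fin ?(ltW K0)//.
apply: gt0_ler_poweR; rewrite ?invr_ge0 ?in_itv/= ?andbT ?leey ?mule_ge0 ?lee_fin ?(ltW K0) ?sum0//.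
apply: esum_scale; first exact: ltW.
  by move=> n; rewrite mule_ge0 ?lee_fin ?Hs_sqnorm_ge0.
by move=> n; rewrite muleCA; apply: lee_wpmul2l => //; rewrite lee_fin.
Qed.
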